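(* Let $S$ be a finite string graph. Then there is a planar graph $G$ and a function $f:V(S)\to V(G)$ such that for all $u,v\in V(S)$, \[ \frac{1}{73944}\,d_S(u,v)-\frac{73936}{73944}\le d_G(f(u),f(v))\le 160\, d_S(u,v), \] and for every $v\in V(G)$ there is some $u\in V(S)$ with $d_G(f(u),v)\le 80$.
   Context: A string graph is a graph isomorphic to the intersection graph of a collection of path-connected subsets of $\mathbb{R}^2$ (distinct subsets adjacent iff they intersect). $d_X$ denotes shortest-path distance in a graph $X$. *)

(* Defs.v *)
From mathcomp Require Import all_boot all_order all_algebra.
From mathcomp Require Import all_classical all_reals all_analysis.

Set Implicit Arguments.
Unset Strict Implicit.
Unset Printing Implicit Defensive.

Import Order.TTheory GRing.Theory Num.Theory.
Import numFieldNormedType.Exports.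

Local Open Scope classical_set_scope.
Local Open Scope ring_scope.

(* Simple undirected graphs; the vertex type may be infinite. *)
Record sgraph := SGraph {
  vertex :> Type;
  adj : rel vertex;
  adj_sym : symmetric adj;
  adj_irr : irreflexive adj }.

Definition finite_graph (G : sgraph) : Prop := finite_set [set: G].

Definition graph_iso (G H : sgraph) : Prop :=
  exists2 phi : G -> H, bijective phi &
    forall u v : G, adj (phi u) (phi v) = adj u v.

(* Shortest-path distance: a walk from u is u :: p and has size p edges.
   As ereal_inf set0 = +oo, vertices in different components are at
   distance +oo. *)
Definition gdist (R : realType) (G : sgraph) (u v : G) : \bar R :=
  ereal_inf [set ((size p)%:R)%:E |
             p in [set p : seq G | path (@adj G) u p /\ last u p = v]].

Definition path_connected (R : realType) (A : set (R * R)) : Prop :=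
  forall x y : R * R, A x -> A y ->
    exists gamma : R -> R * R,
      [/\ {within `[0, 1], continuous gamma},
          gamma 0 = x, gamma 1 = y & gamma @` `[0, 1] `<=` A].

Section IntersectionGraph.
Variables (T : Type) (C : set (set T)).

Definition inter_adj : rel {A : set T | C A} := fun A B =>
  `[< sval A <> sval B /\ sval A `&` sval B !=set0 >].

Lemma inter_adj_sym : symmetric inter_adj.
Proof.
move=> A B; apply/asboolP/asboolP => -[neq AB]; split; rewrite 1?setIC//;
by move/esym.
Qed.

Lemma inter_adj_irr : irreflexive inter_adj.
Proof. by move=> A; apply/asboolP => -[]. Qed.

Definition intersection_graph : sgraph := SGraph inter_adj_sym inter_adj_irr.

End IntersectionGraph.

Definition string_graph (R : realType) (S : sgraph) : Prop :=
  exists2 C : set (set (R * R)),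
    (forall A, C A -> path_connected A) & graph_iso S (intersection_graph C).

Definition is_arc (R : realType) (x y : R * R) (A : set (R * R)) : Prop :=
  exists gamma : R -> R * R,
    [/\ {within `[0, 1], continuous gamma},
        {in `[0, 1] &, injective gamma},
        gamma 0 = x, gamma 1 = y & gamma @` `[0, 1] = A].

(* A drawing places the vertices at distinct points and the edge uv along an
   arc, indexed by the unordered pair [set u; v], whose interior contains no
   vertex and no point of any other edge. *)
Definition plane_drawing (R : realType) (G : sgraph)
    (pt : G -> R * R) (arc : set G -> set (R * R)) : Prop :=
  [/\ injective pt,
      forall u v : G, adj u v -> is_arc (pt u) (pt v) (arc [set u; v]),
      forall u v w : G, adj u v ->
        ~ (arc [set u; v] `\` [set pt u; pt v]) (pt w)
    & forall u v x y : G, adj u v -> adj x y -> [set u; v] <> [set x; y] ->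
        (arc [set u; v] `\` [set pt u; pt v]) `&` arc [set x; y] = set0].

Definition planar (R : realType) (G : sgraph) : Prop :=
  exists (pt : G -> R * R) (arc : set G -> set (R * R)), plane_drawing pt arc.

(* Main.v *)
(** Discretising the strings turns them into connected regions of a finite
    piece of the square grid, two strings meeting iff their regions share a
    cell.  It then suffices to partition the cells into connected clusters of
    bounded diameter in the string metric such that every string meets
    clusters within bounded distance in the quotient: the quotient of the grid
    by the clusters is planar and is the required graph.

    The clusters come from a cop-and-robber decomposition.  An unexplored
    connected territory X is surrounded by at most four pairwise adjacent
    tubes; a fifth is impossible because the grid has no K5 minor.  If some
    surrounding tube no longer touches X, it is dropped after the younger
    tubes have absorbed the pieces of strings that leave X through them;
    otherwise a new tube, a neighbourhood of a geodesic tripod of X touching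
    all surrounding tubes, is laid out.  Each tube is cut along its tripod
    into clusters of length about Q, with enough slack that a string inside
    the domain of the tube meets at most two of them.  A string is thereby
    exhausted after four nested tubes, so it sees at most 80 clusters, where
    80 is the fourth term of n(0) = 0, n(d + 1) = 3 n(d) + 2.

    The absence of a K5 minor follows from a mod 2 intersection form between
    lattice walks and walks shifted by (1/2, 1/2), which vanishes on closed
    walks and on disjoint walks.  The quotient is drawn by collapsing the
    edges of spanning trees of the clusters one after the other, children
    first, with explicit maps of the plane. *)
Require Import Defs.
From mathcomp Require Import all_boot all_order all_algebra.
From mathcomp Require Import all_classical all_reals all_analysis.
From mathcomp Require Import ring lra zify.
From Stdlib Require List.

Set Implicit Arguments.
Unset Strict Implicit.
Unset Printing Implicit Defensive.

(** * Clustering a graph without K5 minor along strings *)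

(** The recursion takes unboundedly many steps, yet a cluster may be enlarged only boundedly often:
    each absorption adds one to a radius and uses up part of a margin. The remedy is that a dropped
    tube burdens only younger ones. Losing one of its k older tubes costs a tube at most 4 * 3^(k-1)
    absorptions, hence at most 2 * (3^k - 1) in its whole life. With k = 3 and the one absorption
    spent at its creation this gives 53 = N. A tripod distorts distances by a factor at most 3, so
    the anchors of two cells of one string are at most 3 * (2 * 54 + 1) = 327 apart, below sg = 6 *
    N + 12 = 330. With N + 1 margins of size sg, Q = 2 * 54 * 330 + 331 = 35971, and a cluster has
    diameter at most 2 * Q + 2 * 54 = 72050 in the string metric, below 73936. Passing through 80
    clusters takes 79 edges of the quotient, and an edge of S takes two strings, so 158 <= 160. The
    age of tubes matters once more: a string remembered for having met a tube is known to avoid all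
    older ones, and this is what makes it safe to forget a tube that no longer touches the
    territory. *)

Section Reach.
Variables (V : Type) (e : V -> V -> Prop).
Hypothesis e_sym : forall x y, e x y -> e y x.
Implicit Types A B q w : V -> Prop.

(** * Reachability and connected sets *)

Definition sub A B := forall x, A x -> B x.

Inductive rch A x : V -> Prop :=
| rch0 : A x -> rch A x x
| rchS y z : rch A x y -> e y z -> A z -> rch A x z.

Definition con A := forall x y, A x -> A y -> rch A x y.

Lemma rch_l A x y : rch A x y -> A x.
Proof. by elim. Qed.

Lemma rch_r A x y : rch A x y -> A y.
Proof. by case. Qed.

Lemma rch_trans A x y z : rch A x y -> rch A y z -> rch A x z.
Proof.
move=> xy yz; elim: yz => // u v _ IH uv Av.
exact: rchS IH uv Av.
Qed.

Lemma rch_sym A x y : rch A x y -> rch A y x.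
Proof.
elim=> [Ax|u v xu IH uv Av]; first exact: rch0.
apply: rch_trans IH; apply: rchS (e_sym uv) (rch_r xu).
exact: rch0.
Qed.

Lemma rch_mono A B x y : sub A B -> rch A x y -> rch B x y.
Proof.
move=> AB; elim=> [Ax|u v _ IH uv Av]; first by apply: rch0; apply: AB.
by apply: rchS IH uv _; apply: AB.
Qed.

Lemma rch_self A x y : rch A x y -> rch (rch A x) x y.
Proof.
move=> xy; have Ax := rch_l xy.
elim: xy => [_|u v xu IH uv Av]; first by apply: rch0; apply: rch0.
by apply: (rchS IH uv); exact: (rchS xu uv Av).
Qed.

Lemma rch_con A x : con (rch A x).
Proof.
move=> y z xy xz; apply: rch_trans (rch_self xz).
exact/rch_sym/rch_self.
Qed.

(** A walk that never left B would join x to y inside A and B. The first clause matters: the exit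
    edge hangs on the connected piece of x in the intersection of A and B. *)
Lemma rch_exit A B x y : rch A x y -> B x -> ~ B y ->
  exists u v, [/\ rch (fun z => A z /\ B z) x u, e u v, A v & ~ B v].
Proof.
move=> xy Bx nBy; apply: contrapT => nex.
suff : rch (fun z => A z /\ B z) x y by move/rch_r => [].
elim: xy => [Ax|u v _ IH uv Av]; first exact: rch0.
have [Bv|nBv] := EM (B v); first exact: rchS IH uv _.
by case: nex; exists u, v.
Qed.

Lemma con_exit A B x y : con A -> A x -> B x -> A y -> ~ B y ->
  exists u v, [/\ rch (fun z => A z /\ B z) x u, e u v, A v & ~ B v].
Proof. by move=> cA Ax Bx Ay; exact: (rch_exit (cA _ _ Ax Ay)). Qed.

Lemma con_add A x y : con A -> A x -> e x y -> con (fun z => A z \/ z = y).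
Proof.
move=> cA Ax xy; have base z : A z \/ z = y ->
    rch (fun z => A z \/ z = y) x z.
  case=> [Az|->]; first by apply: rch_mono (cA _ _ Ax Az) => v; left.
  by apply: rchS xy _; [apply: rch0; left|right].
by move=> u v Au Av; apply: rch_trans (base _ Av); apply/rch_sym/base.
Qed.

(* [str q] stands for: q is a connected set of cells inside one string. *)
Variable str : (V -> Prop) -> Prop.
Hypothesis str_con : forall q, str q -> con q.
Hypothesis str_sub : forall q w, str q -> sub w q -> con w -> str w.
Hypothesis str_edge : forall x y, e x y -> exists q, [/\ str q, q x & q y].

(** * The string metric of a territory *)

Definition ES X x y := exists q, [/\ str q, sub q X, q x & q y].

(** Distance at most n in the string metric of X, where one step moves inside a string piece
    contained in X. Being intrinsic to X, this distance can only grow when X shrinks. *)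
Fixpoint D X n x y :=
  if n is m.+1 then exists z, D X m x z /\ (z = y \/ ES X z y) else x = y.

Lemma ES_sym X x y : ES X x y -> ES X y x.
Proof. by case=> q [*]; exists q. Qed.

(** A string through the edge may leave X, but its restriction to the two cells is still a connected
    piece of it. *)
Lemma ES_edge X x y : X x -> X y -> e x y -> ES X x y.
Proof.
move=> Xx Xy xy; have [q [sq qx qy]] := str_edge xy.
exists (fun z => z = x \/ z = y); split; [|by move=> z [->|->]|by left|by right].
apply: str_sub sq _ _; first by move=> z [->|->].
apply: (@con_add (fun z => z = x) x y) => // u v -> ->; exact: rch0.
Qed.

Lemma D_refl X n x : D X n x x.
Proof. by elim: n => //= n IH; exists x; split=> //; left. Qed.

Lemma D_mono X n m x y : n <= m -> D X n x y -> D X m x y.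
Proof.
move=> /subnKC <-; elim: (m - n) => [|k IH] H; first by rewrite addn0.
by rewrite addnS; exists y; split; [exact: IH|left].
Qed.

Lemma D_trans X n m x y z : D X n x y -> D X m y z -> D X (n + m) x z.
Proof.
move=> xy; elim: m z => [z /= <-|m IH z]; first by rewrite addn0.
by rewrite addnS => -[u [yu uz]]; exists u; split => //; apply: IH.
Qed.

Lemma D1 X x y : ES X x y -> D X 1 x y.
Proof. by move=> xy; exists x; split=> //; right. Qed.

Lemma D_sym X n x y : D X n x y -> D X n y x.
Proof.
elim: n y => [y /= -> //|n IH y [z [xz zy]]].
suff : D X (1 + n) y x by [].
by apply: D_trans (IH _ xz); case: zy => [->|/ES_sym/D1//]; apply: D_refl.
Qed.

Lemma D_in X n x y : D X n x y -> X x -> X y.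
Proof.
elim: n y => [y /= -> //|n IH y [z [xz zy]]] Xx.
case: zy => [<-|[q [_ qX _ qy]]]; [exact: IH|exact: qX].
Qed.

Lemma D_sub X Y n x y : sub X Y -> D X n x y -> D Y n x y.
Proof.
move=> XY; elim: n y => // n IH y [z [xz zy]]; exists z; split; first exact: IH.
case: zy => [->|[q [sq qX qz qy]]]; first by left.
by right; exists q; split=> // v /qX/XY.
Qed.

Lemma rch_D X x y : rch X x y -> exists n, D X n x y.
Proof.
elim=> [Xx|u v xu [n Dn] uv Xv]; first by exists 0.
exists n.+1, u; split=> //; right; apply: ES_edge => //; exact: rch_r xu.
Qed.

(* A tube lives in the territory [dom] and follows a tripod: leg g of length
   [len g] (all legs but three have length 0) starts at the common foot
   [sk g 0].  The anchor (g, r) is the point at arclength r of leg g. *)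
Record tube := Tube { dom : V -> Prop; len : nat -> nat; sk : nat -> nat -> V }.

(** * Anchors on a tripod and the labels admissible at them *)

Definition valid t (a : nat * nat) := a.2 <= len t a.1.
Definition ska t (a : nat * nat) := sk t a.1 a.2.
(** Distance in the tripod itself. The two truncated subtractions add up to an absolute difference;
    different legs communicate through the foot. *)
Definition dT (a b : nat * nat) :=
  if a.1 == b.1 then (a.2 - b.2) + (b.2 - a.2) else a.2 + b.2.

(** The last clause says that the tripod is quasi-geodesic in its territory; for the factor 3 see
    [tube_exists]. *)
Definition wf t := [/\ forall a, valid t a -> dom t (ska t a),
  forall g, sk t g 0 = sk t 0 0,
  forall g r, r < len t g -> ES (dom t) (sk t g r) (sk t g r.+1) &
  forall a b n, valid t a -> valid t b -> D (dom t) n (ska t a) (ska t b) ->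
    dT a b <= 3 * n].

Lemma dT_close t a b x n m : wf t -> valid t a -> valid t b ->
  D (dom t) n (ska t a) x -> D (dom t) m (ska t b) x -> dT a b <= 3 * (n + m).
Proof. by case=> _ _ _ H va vb ax /D_sym xb; apply: H (D_trans ax xb). Qed.

(* The label (g, k) marks the part of leg g around arclength k * Q. *)
Definition lbl := (nat * nat)%type.
Variables (Q sg N : nat).
(* After n absorptions the cells of a tube are within [rho n] of their anchors,
   and their labels are still correct with a margin [bb n]. *)
Definition rho n := n.+1.
Definition bb n := sg + (N - n) * sg.
(** Cells of one string have anchors at tripod distance at most [3 * (2 * rho N + 1)] = 6 * N + 9,
    so sg bounds every displacement below. By [QE] consecutive zones of half-width [bb 0] around the
    multiples of Q are more than sg apart. *)
Hypothesis sgE : 6 * N + 12 <= sg.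
Hypothesis QE : 2 * bb 0 + sg < Q.

(* The label (0, 0) is shared by all legs: it marks the junction. *)
Definition Acc b (a : nat * nat) (l : lbl) :=
  [/\ l.2 = 0 \/ l.1 = a.1, l.2 = 0 -> l.1 = 0,
      a.2 + b < l.2.+1 * Q & l.2 * Q + b < a.2 + Q].

Definition assignment := V -> option (tube * lbl).
Implicit Type asg : assignment.
Definition Lab asg t x := exists l, asg x = Some (t, l).

Definition TI asg t r b := forall x l, asg x = Some (t, l) ->
  exists a, [/\ valid t a, D (dom t) r (ska t a) x & Acc b a l].
Definition TIn asg t n := TI asg t (rho n) (bb n).

Definition Conn asg := forall x y tl, asg x = Some tl -> asg y = Some tl ->
  rch (fun z => asg z = Some tl) x y.

Lemma bb_dec n m : n <= m -> bb m <= bb n.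
Proof. by move=> nm; rewrite /bb leq_add2l leq_mul2r leq_sub2l ?orbT. Qed.

Lemma TIn_mono asg t n m : n <= m -> TIn asg t n -> TIn asg t m.
Proof.
move=> nm H x l /H [a [va Da [A1 A2 A3 A4]]]; exists a; split=> //.
  by apply: D_mono Da; rewrite /rho.
have := bb_dec nm; split=> //; lia.
Qed.

(** Inside the zone of k * Q only the label with index k is admissible with margin b; between two
    zones exactly the two neighbouring labels are. *)
Definition zone b (a : nat * nat) :=
  exists k, a.2 <= k * Q + b /\ k * Q <= a.2 + b.

Lemma zone_dec b b' a : b' <= b -> ~ zone b a -> ~ zone b' a.
Proof. by move=> bb' nz [k [? ?]]; apply: nz; exists k; split; lia. Qed.

Lemma QlemA k l : k < l -> k * Q + Q <= l * Q.
Proof. by move=> kl; rewrite addnC -mulSn leq_mul2r kl orbT. Qed.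

(** A displacement of at most sg is paid with a margin of sg. It can change legs only near the foot,
    where no label but (0, 0) is admissible. *)
Lemma Acc_move b b' a a' l : sg <= b' -> b' + sg <= b -> b + b <= Q ->
  Acc b a l -> dT a a' <= sg -> Acc b' a' l.
Proof.
move=> h1 h2 h3 [A1 A2 A3 A4]; rewrite /dT; case: eqP => [E|E] dd.
  by split; [rewrite -E; exact: A1|exact: A2|lia|lia].
have l0 : l.2 = 0.
  apply/eqP; rewrite -leqn0 leqNgt; apply/negP => l1; have := QlemA l1; lia.
by split; [left|exact: A2|rewrite l0; lia|rewrite l0; lia].
Qed.

(** No margin is lost: gaps and zones are wider than the displacement, so two anchors both in zones
    are in the same zone, and two anchors outside are in the same gap. Either way the same labels
    are admissible. This lets a label travel along arbitrarily long chains of pieces. *)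
Lemma Acc_step b a a' l : sg <= b -> 2 * b + sg < Q ->
  (zone b a <-> zone b a') -> Acc b a l -> dT a a' <= sg -> Acc b a' l.
Proof.
move=> h1 h2 zz [A1 A2 A3 A4].
have [z|nz] := EM (zone b a).
  have [k [k1 k2]] := z; have /zz [k' [k1' k2']] := z.
  have lk : l.2 = k.
    case: (ltngtP l.2 k) => // /QlemA; lia.
  rewrite /dT; case: eqP => [E|E] dd.
    have kk : k = k' by case: (ltngtP k k') => // /QlemA; lia.
    by rewrite -kk -lk in k1' k2'; split; [rewrite -E; exact: A1|exact: A2|lia|lia].
  have k0 : k = 0 by case: (posnP k) => // /QlemA; lia.
  have k0' : k' = 0 by case: (posnP k') => // /QlemA; lia.
  rewrite k0 in lk; rewrite k0' in k1' k2'.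
  by split; [left|exact: A2|rewrite lk; lia|rewrite lk; lia].
have nz' : ~ zone b a' by move/zz.
have Q0 : 0 < Q by lia.
set k := a.2 %/ Q; have kE := divn_eq a.2 Q; have kr := ltn_pmod a.2 Q0.
rewrite -/k in kE.
have g1 : k * Q + b < a.2.
  rewrite ltnNge; apply/negP => h; apply: nz; exists k; lia.
have g2 : a.2 + b < k * Q + Q.
  rewrite ltnNge; apply/negP => h; apply: nz; exists k.+1; lia.
rewrite /dT; case: eqP => [E|E] dd; last first.
  by case: nz; exists 0; lia.
have g1' : k * Q + b < a'.2.
  rewrite ltnNge; apply/negP => h; apply: nz'; exists k; lia.
have g2' : a'.2 + b < k * Q + Q.
  rewrite ltnNge; apply/negP => h; apply: nz'; exists k.+1; lia.
split; [by rewrite -E|exact: A2| |].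
  suff : k * Q <= l.2 * Q by lia.
  by rewrite leq_mul2r; apply/orP; right; rewrite leqNgt; apply/negP => /QlemA; lia.
suff : l.2 * Q <= k.+1 * Q by lia.
by rewrite leq_mul2r; apply/orP; right; rewrite leqNgt; apply/negP => /QlemA; lia.
Qed.

(** * Absorption of string pieces by tubes *)

Definition ext asg asg' := forall x tl, asg x = Some tl -> asg' x = Some tl.
Definition old_labels asg asg' :=
  forall x tl, asg' x = Some tl -> exists y, asg y = Some tl.

Lemma ext_trans a1 a2 a3 : ext a1 a2 -> ext a2 a3 -> ext a1 a3.
Proof. by move=> h1 h2 x tl /h1/h2. Qed.

Lemma old_trans a1 a2 a3 : old_labels a1 a2 -> old_labels a2 a3 -> old_labels a1 a3.
Proof. by move=> h1 h2 x tl /h2 [y /h1]. Qed.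

Lemma ext_Lab a1 a2 t x : ext a1 a2 -> Lab a1 t x -> Lab a2 t x.
Proof. by move=> h [l /h]; exists l. Qed.

Lemma ext_None a1 a2 x : ext a1 a2 -> a2 x = None -> a1 x = None.
Proof. by move=> h E; case E1: (a1 x) => [tl|] //; rewrite (h _ _ E1) in E. Qed.

Lemma bbS n : n < N -> bb n = bb n.+1 + sg.
Proof. by move=> nN; rewrite /bb -(subnSK nN) mulSn; lia. Qed.

Lemma bb_bounds n : sg <= bb n /\ 2 * bb n + sg < Q.
Proof.
have := bb_dec (leq0n n); have : sg <= bb n by rewrite leq_addr.
lia.
Qed.

(* The components of the union of W that touch t inherit a label of t.  The
   anchors are all close to multiples of Q or all far from them, so that a
   label admissible at one end of a component is admissible all along it. *)
Lemma phase asg t n (W : (V -> Prop) -> Prop) (zn : Prop) :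
  wf t -> Conn asg -> TIn asg t n -> n < N ->
  (forall w, W w -> [/\ con w, forall x, w x -> asg x = None &
     exists a, [/\ valid t a, zone (bb n.+1) a <-> zn &
       forall x, w x -> D (dom t) (rho n.+1) (ska t a) x]]) ->
  exists asg', [/\ ext asg asg', Conn asg', old_labels asg asg' & TIn asg' t n.+1] /\
   [/\ forall x, asg x = None -> asg' x <> None ->
         (exists w, W w /\ w x) /\ Lab asg' t x,
       forall w x y, W w -> w x -> w y -> asg' x = None -> asg' y = None &
       forall w x z, W w -> w x -> asg' x = None -> e x z -> ~ Lab asg' t z].
Proof.
move=> wft cA tA nN HW.
pose Om x := exists w, W w /\ w x.
pose Ex (S : V -> Prop) l := exists y z, [/\ S y, e y z & asg z = Some (t, l)].
(* The choice depends only on the component as a set, so all its cells receive the same label. *)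
pose pk (S : V -> Prop) : option lbl :=
  if pselect (exists l, Ex S l) is left h then Some (projT1 (cid h)) else None.
pose asg' x := if asg x is Some v then Some v else
  if pselect (Om x) is left _ then omap (fun l => (t, l)) (pk (rch Om x)) else None.
have OmN x : Om x -> asg x = None by case=> w [/HW [_ H _] /H].
have a'Om x : Om x -> asg' x = omap (fun l => (t, l)) (pk (rch Om x)).
  by move=> Ox; rewrite /asg' OmN //; case: pselect.
have pkS S l : pk S = Some l -> Ex S l.
  by rewrite /pk; case: pselect => // h [<-]; case: cid.
have pkN S l : Ex S l -> pk S <> None.
  by rewrite /pk; case: pselect => // nh h; case: nh; exists l.
have rcE x y : rch Om x y -> rch Om x = rch Om y.
  move=> xy; apply/funext => z; apply/propext; split; last exact: rch_trans.
  by apply: rch_trans; apply: rch_sym.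
have same x y : rch Om x y -> asg' x = asg' y.
  by move=> xy; rewrite (a'Om _ (rch_l xy)) (a'Om _ (rch_r xy)) (rcE _ _ xy).
have a'ext : ext asg asg' by move=> x tl E; rewrite /asg' E.
have newE x : asg x = None -> asg' x <> None ->
    Om x /\ exists l, asg' x = Some (t, l) /\ Ex (rch Om x) l.
  move=> E; rewrite /asg' E; case: pselect => // Ox.
  case P : (pk _) => [l|] //= _; split=> //; exists l; split=> //; exact: pkS.
have wOm w x y : W w -> w x -> w y -> rch Om x y.
  move=> Ww wx wy; have [cw _ _] := HW _ Ww.
  by apply: rch_mono (cw _ _ wx wy) => z wz; exists w.
have oldl : old_labels asg asg'.
  move=> x tl E; case E1 : (asg x) => [tl'|].
    by rewrite (a'ext _ _ E1) in E; exists x; rewrite E1.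
  have [|_ [l [E2 [y [z [_ _ Ez]]]]]] := newE _ E1; first by rewrite E.
  by exists z; rewrite Ez -E2.
exists asg'; split; split=> //.
- have toold x tl : asg' x = Some tl -> exists2 z, asg z = Some tl &
      rch (fun v => asg' v = Some tl) x z.
    move=> E; case E1 : (asg x) => [tl'|].
      have E2 : tl' = tl by have := a'ext _ _ E1; rewrite E => -[].
      by exists x; [rewrite E1 E2|exact: rch0].
    have [|_ [l [E2 [y [z [xy yz Ez]]]]]] := newE _ E1; first by rewrite E.
    have tlE : tl = (t, l) by move: E; rewrite E2 => -[].
    exists z; first by rewrite Ez tlE.
    have xy' : rch (fun v => asg' v = Some tl) x y.
      apply: rch_mono (rch_self xy) => v xv.
      by rewrite -E; apply/esym/same.
    by apply: rchS xy' yz _; rewrite tlE; apply: a'ext.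
  move=> x y tl /toold [x' Ex' xx'] /toold [y' Ey' yy'].
  apply: (rch_trans xx'); apply: rch_trans (rch_sym yy').
  by apply: rch_mono (cA _ _ _ Ex' Ey') => v /a'ext.
- move=> x l E; have [h1 h2] := bb_bounds n.+1; have h3 := bbS nN.
  have [h4 h5] := bb_bounds n.
  case E1 : (asg x) => [tl'|].
    have E2 : asg x = Some (t, l) by rewrite E1; have := a'ext _ _ E1; rewrite E.
    exact: (TIn_mono (leqnSn n) tA E2).
  have [|_ [l' [E2 [y [z [xy yz Ez]]]]]] := newE _ E1; first by rewrite E.
  have lE : l' = l by move: E2; rewrite E => -[].
  subst l'; have [az [vz Dz Az]] := tA _ _ Ez.
  have domz : dom t z by apply: D_in Dz _; case: wft => H _ _ _; apply: H.
  (* Entering the component from the labelled cell z costs one margin ([Acc_move]); every further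
     step inside it is free ([Acc_step]). *)
  suff H v : rch Om y v -> forall w a, W w -> w v -> valid t a ->
      (zone (bb n.+1) a <-> zn) ->
      (forall x, w x -> D (dom t) (rho n.+1) (ska t a) x) -> Acc (bb n.+1) a l.
    have [w [Ww wx]] := rch_l xy; have [_ _ [a [va za Da]]] := HW _ Ww.
    exists a; split=> //; first exact: Da.
    exact: (H x (rch_sym xy) w).
  elim=> {v} [_ w a Ww wy va za Da|u v yu IH uv Ov w a Ww wv va za Da].
    have Dy := Da _ wy.
    have domy : dom t y by apply: D_in Dy _; case: wft => H _ _ _; apply: H.
    have Dz' : D (dom t) (rho n + 1) (ska t az) y.
      by apply: D_trans Dz _; apply: D1; apply: ES_edge => //; apply: e_sym.
    apply: (Acc_move (b := bb n) (a := az)) => //; try lia.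
    have := dT_close wft vz va Dz' Dy; rewrite /rho; lia.
  have [w' [Ww' w'u]] := rch_r yu.
  have [_ _ [a' [va' za' Da']]] := HW _ Ww'.
  have Du := Da' _ w'u; have Dv := Da _ wv.
  have domu : dom t u by apply: D_in Du _; case: wft => H _ _ _; apply: H.
  have domv : dom t v by apply: D_in Dv _; case: wft => H _ _ _; apply: H.
  have Du' : D (dom t) (rho n.+1 + 1) (ska t a') v.
    by apply: D_trans Du _; apply: D1; apply: ES_edge.
  apply: (Acc_step (a := a')) => //; first by rewrite za' za.
    exact: IH Ww' w'u va' za' Da'.
  have := dT_close wft va' va Du' Dv; rewrite /rho; lia.
- by move=> x /newE H /H [Ox [l [E _]]]; split=> //; exists l.
- move=> w x y Ww wx wy <-; exact/esym/same/(wOm w).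
- move=> w x z Ww wx Ex0 xz [l Ez]; case E1 : (asg z) => [tl'|].
    have E2 : asg z = Some (t, l) by rewrite E1; have := a'ext _ _ E1; rewrite Ez.
    have Ox : Om x by exists w.
    move: Ex0; rewrite a'Om //; case P : (pk _) => [//|] _.
    apply: (pkN (rch Om x) l) P; exists x, z; split=> //; exact: rch0.
  have [|Oz _] := newE _ E1; first by rewrite Ez.
  have Ox : Om x by exists w.
  have : rch Om x z by apply: rchS xz Oz; apply: rch0.
  by move/same; rewrite Ex0 Ez.
Qed.

(* Resolving costs c absorptions to the first tube and three times as much to
   each following one. *)
Fixpoint bump c (ts : seq (tube * nat)) : seq (tube * nat) :=
  if ts is (t, n) :: r then (t, n + c) :: bump (3 * c) r else [::].

Fixpoint nodup (ts : seq (tube * nat)) : Prop :=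
  if ts is p :: r then
    (forall p', List.In p' r -> p'.1 <> p.1) /\ nodup r else True.

Definition TIs asg ts := forall p, List.In p ts -> TIn asg p.1 p.2.

Lemma bumpD a b ts : bump a (bump b ts) = bump (a + b) ts.
Proof.
elim: ts a b => [//|[t n] r IH] a b /=; rewrite IH mulnDr; congr (_ :: _).
by congr (_, _); lia.
Qed.

Lemma size_bump c ts : size (bump c ts) = size ts.
Proof. by elim: ts c => [//|[t n] r IH] c /=; rewrite IH. Qed.

Lemma bump_In c ts p : List.In p ts -> exists m, List.In (p.1, m) (bump c ts).
Proof.
elim: ts c => [//|[t n] r IH] c /= [<-|/IH h].
  by exists (n + c); left.
by have [m hm] := h (3 * c); exists m; right.
Qed.

Lemma bump_InV c ts p : List.In p (bump c ts) ->
  exists m, List.In (p.1, m) ts /\ m <= p.2.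
Proof.
elim: ts c => [//|[t n] r IH] c /= [<-|/IH [m [h1 h2]]].
  by exists n; split; [left|rewrite leq_addr].
by exists m; split=> //; right.
Qed.

Lemma bump_le c d ts p : c <= d -> List.In p (bump c ts) ->
  exists m, List.In (p.1, m) (bump d ts) /\ p.2 <= m.
Proof.
elim: ts c d => [//|[t n] r IH] c d cd /= [<-|h].
  by exists (n + d); split; [left|rewrite leq_add2l].
have [|m [h1 h2]] := IH _ (3 * d) _ h; first by rewrite leq_mul2l cd orbT.
by exists m; split=> //; right.
Qed.

Lemma nodup_bump c ts : nodup ts -> nodup (bump c ts).
Proof.
elim: ts c => [//|[t n] r IH] c /= [h1 h2]; split; last exact: IH.
by move=> p /bump_InV [m [/h1]].
Qed.

Lemma TIn_other a a' t n : ext a a' -> TIn a t n ->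
  (forall x, a x = None -> a' x <> None -> ~ Lab a' t x) -> TIn a' t n.
Proof.
move=> ex H nw x l E; case E1 : (a x) => [tl|].
  by have := ex _ _ E1; rewrite E => -[?]; subst tl; apply: H.
by case: (nw x E1); [rewrite E|exists l].
Qed.

Lemma left_exit (a : assignment) y x s : con y -> y x -> a x = None -> y s ->
  a s <> None -> exists u v, [/\ rch (fun z => y z /\ a z = None) x u,
    e u v, y v & a v <> None].
Proof.
by move=> cy yx ax ys as_; apply: (@con_exit y (fun z => a z = None) x s).
Qed.

Lemma near_str t q n a z v : dom t z -> D (dom t) (rho n) (ska t a) z -> str q ->
  sub q (dom t) -> q z -> q v -> D (dom t) (rho n.+1) (ska t a) v.
Proof.
move=> dz Dz sq qd qz qv; have -> : rho n.+1 = rho n + 1 by rewrite /rho addn1.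
by apply: D_trans Dz _; apply: D1; exists q.
Qed.

Lemma TI_dom asg t n x : wf t -> TIn asg t n -> Lab asg t x -> dom t x.
Proof.
case=> H _ _ _ tA [l /tA [a [va Da _]]]; apply: D_in Da _; exact: H.
Qed.

(** The last clause puts y and the labelled cell z on one string, so that all of y is within one
    string step of z. *)
Definition contact asg (y : V -> Prop) t :=
  exists x z, [/\ y x, e x z, Lab asg t z & str (fun v => y v \/ v = z)].

(* First the pieces touching the head tube t are absorbed by t.  The remaining
   pieces left intact are given recursively to the other tubes, and so are, in
   two more rounds, the leftovers of the pieces that t has cut. *)
Lemma resolve k : forall ts (Y : (V -> Prop) -> Prop) asg, size ts = k -> nodup ts ->
  (forall p, List.In p ts -> wf p.1) -> Conn asg -> TIs asg ts ->
  (forall p, List.In p (bump 4 ts) -> p.2 <= N) ->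
  (forall y, Y y -> [/\ str y, forall x, y x -> asg x = None,
     forall p, List.In p ts -> sub y (dom p.1) &
     exists p, List.In p ts /\ contact asg y p.1]) ->
  exists asg', [/\ ext asg asg', Conn asg', old_labels asg asg' &
      TIs asg' (bump 4 ts)] /\
    [/\ forall x, asg x = None -> asg' x <> None ->
          (exists y, Y y /\ y x) /\ exists p, List.In p ts /\ Lab asg' p.1 x &
        forall y x, Y y -> y x -> asg' x <> None].
Proof.
elim: k => [|k IH] [|[t n] r] Y asg //=.
  move=> _ _ _ cA tA _ HY; exists asg; split; split=> //.
  - by move=> x tl E; exists x.
  - by move=> y x /HY [_ _ _ [p []]].
move=> [szr] [nd ndr] wfs cA tA bN HY.
have wft : wf t by apply: (wfs (t, n)); left.
have tAt : TIn asg t n by apply: (tA (t, n)); left.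
have n4 : n + 4 <= N by apply: (bN (t, n + 4)); left.
have wfr p : List.In p r -> wf p.1 by move=> h; apply: wfs; right.
have tAr : TIs asg r by move=> p h; apply: tA; right.
have bNr p : List.In p (bump 12 r) -> p.2 <= N by move=> h; apply: bN; right.
have Yd y : Y y -> sub y (dom t).
  by move=> /HY [_ _ h _]; apply: (h (t, n)); left.
have Ycon y : Y y -> con y by move=> /HY [h _ _ _]; apply: str_con.
have Ystr y : Y y -> str y by move=> /HY [].
have YN y x : Y y -> y x -> asg x = None by move=> /HY [_ h _ _]; apply: h.
(* [phase] needs anchors uniformly inside or uniformly outside the zones, so the pieces touching t
   are absorbed in two rounds, [zn] being [True] and then [False]. *)
pose ct (zn : Prop) y := Y y /\ exists x z a, [/\ y x, e x z, Lab asg t z,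
  str (fun v => y v \/ v = z) &
  [/\ valid t a, D (dom t) (rho n) (ska t a) z & zone (bb n.+1) a <-> zn]].
have ctw zn y : ct zn y -> exists a, [/\ valid t a, zone (bb n.+1) a <-> zn &
    forall x, y x -> D (dom t) (rho n.+1) (ska t a) x].
  case=> Yy [x [z [a [yx xz Lz sz [va Dz za]]]]]; exists a; split=> // v yv.
  have dz := TI_dom wft tAt Lz.
  apply: (near_str dz Dz sz) => [u [/(Yd _ Yy)//|->//]| |]; by [right|left].
have [a1 [[ex1 cA1 ol1 tA1] [nw1 al1 ne1]]] : exists asg',
   [/\ ext asg asg', Conn asg', old_labels asg asg' & TIn asg' t n.+1] /\
   [/\ forall x, asg x = None -> asg' x <> None ->
         (exists w, ct True w /\ w x) /\ Lab asg' t x,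
       forall w x y, ct True w -> w x -> w y -> asg' x = None -> asg' y = None &
       forall w x z, ct True w -> w x -> asg' x = None -> e x z -> ~ Lab asg' t z].
  apply: (phase (zn := True)) => //; first lia.
  move=> w cw; have := ctw _ _ cw; case: cw => Yw _ h; split=> //.
  - exact: Ycon.
  - by move=> x; apply: YN.
have cov1 y x : ct True y -> y x -> a1 x <> None.
  move=> cy yx E; have [_ [u [z [a [yu uz Lz _ _]]]]] := cy.
  have Eu := al1 _ _ _ cy yx yu E.
  exact: (ne1 _ _ _ cy yu Eu uz (ext_Lab ex1 Lz)).
(* The first round may have cut pieces of the second kind, which therefore enter by connected parts
   still unlabelled. *)
pose W2 w := exists y, [/\ ct False y, con w, sub w y & forall x, w x -> a1 x = None].
have [a2 [[ex2 cA2 ol2 tA2] [nw2 al2 ne2]]] : exists asg',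
   [/\ ext a1 asg', Conn asg', old_labels a1 asg' & TIn asg' t n.+2] /\
   [/\ forall x, a1 x = None -> asg' x <> None ->
         (exists w, W2 w /\ w x) /\ Lab asg' t x,
       forall w x y, W2 w -> w x -> w y -> asg' x = None -> asg' y = None &
       forall w x z, W2 w -> w x -> asg' x = None -> e x z -> ~ Lab asg' t z].
  apply: (phase (zn := False)) => //; first lia.
  move=> w [y [cy cw wy wN]]; split=> //.
  have [a [va za Da]] := ctw _ _ cy; exists a; split=> //.
    split=> // z; apply: (zone_dec (bb_dec (leqnSn n.+1)) (a := a)) => //.
    by rewrite za.
  by move=> x /wy /Da; apply: D_mono; rewrite /rho; lia.
have ex02 := ext_trans ex1 ex2.
have nw02 x : asg x = None -> a2 x <> None -> (exists y, Y y /\ y x) /\ Lab a2 t x.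
  move=> E E2; case E1 : (a1 x) => [tl|].
    have [|[y [[Yy _] yx]] L] := nw1 _ E; first by rewrite E1.
    by split; [exists y|apply: ext_Lab ex2 L].
  have [[w [[y [[Yy _] _ wy _]] wx]] L] := nw2 _ E1 E2.
  by split=> //; exists y; split=> //; apply: wy.
(* If a part of y survived, y would lead from it to a cell labelled by t, in y or at the contact z,
   and the part next to that cell would have been absorbed. *)
have cov2 y x : Y y -> contact asg y t -> y x -> a2 x <> None.
  move=> Yy [u [z [yu uz Lz sz]]] yx.
  have [l Ez] := Lz; have [a [va Da Aa]] := tAt _ _ Ez.
  have [za|nza] := EM (zone (bb n.+1) a).
    have cy : ct True y by split=> //; exists u, z, a; split=> //; split=> //; split.
    by move=> E; apply: (cov1 _ _ cy yx); apply: ext_None E.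
  have cy : ct False y by split=> //; exists u, z, a; split=> //; split=> //; split.
  move=> E.
  pose w := rch (fun v => y v /\ a2 v = None) x.
  have Ww : W2 w.
    exists y; split=> //; first exact: rch_con.
    - by move=> v /rch_r [].
    - by move=> v /rch_r [_ h]; apply: ext_None h.
  have wx : w x by apply: rch0.
  have [E2|E2] := EM (a2 u = None); last first.
    have [s [v [xs sv yv av]]] := left_exit (Ycon _ Yy) yx E yu E2.
    have Es := (rch_r xs).2.
    apply: (ne2 _ _ _ Ww xs Es sv).
    by have [] := nw02 v (YN _ _ Yy yv) av.
  have [wu|nwu] := EM (w u).
    exact: (ne2 _ _ _ Ww wu E2 uz (ext_Lab ex02 Lz)).
  have [s [v [xs sv yv nwv]]] := con_exit (B := w) (Ycon _ Yy) yx wx yu nwu.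
  have [_ ws] := rch_r xs.
  have av : a2 v <> None.
    by move=> av; apply: nwv; apply: rchS ws sv _.
  apply: (ne2 _ _ _ Ww ws (rch_r ws).2 sv).
  by have [] := nw02 v (YN _ _ Yy yv) av.
have tA2r : TIs a2 r.
  move=> p pr; apply: TIn_other ex02 (tAr _ pr) _ => x E E2 [l L].
  have [_ [l' L']] := nw02 x E E2; apply: (nd _ pr).
  by move: L; rewrite L' => -[].
(* By [cov2] an intact piece has no contact with t, so its contact is with a tube of r. *)
pose Yu y := Y y /\ (exists x, y x) /\ forall x, y x -> a2 x = None.
have [a3 [[ex3 cA3 ol3 tA3] [nw3 cov3]]] : exists asg',
    [/\ ext a2 asg', Conn asg', old_labels a2 asg' & TIs asg' (bump 4 r)] /\
    [/\ forall x, a2 x = None -> asg' x <> None ->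
          (exists y, Yu y /\ y x) /\ exists p, List.In p r /\ Lab asg' p.1 x &
        forall y x, Yu y -> y x -> asg' x <> None].
  apply: IH => //.
    move=> p /(bump_le (d := 12)) [//|m [/bNr /= h1 h2]]; lia.
  move=> y [Yy [[x yx] yN]]; split=> //; first exact: Ystr.
    by move=> p pr; have [_ _ h _] := HY _ Yy; apply: h; right.
  have [_ _ _ [p [[<-|pr] cp]]] := HY _ Yy.
    by case: (cov2 _ _ Yy cp yx); apply: yN.
  exists p; split=> //; have [u [z [yu uz Lz sz]]] := cp.
  by exists u, z; split=> //; apply: ext_Lab ex02 Lz.
have ex03 := ext_trans ex02 ex3.
have nw03 x : asg x = None -> a3 x <> None -> (exists y, Y y /\ y x) /\
    exists p, List.In p ((t, n) :: r) /\ Lab a3 p.1 x.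
  move=> E E3; case E2 : (a2 x) => [tl|].
    have [|h L] := nw02 _ E; first by rewrite E2.
    by split=> //; exists (t, n); split; [left|apply: ext_Lab ex3 L].
  have [[y [[Yy _] yx]] [p [pr L]]] := nw3 _ E2 E3.
  by split; [exists y|exists p; split=> //; right].
have tA3t : TIn a3 t n.+2.
  apply: TIn_other ex3 tA2 _ => x E E2 [l L].
  have [_ [p [pr [l' L']]]] := nw3 x E E2; apply: (nd _ pr).
  by move: L; rewrite L' => -[].
(* A cut piece contains a cell absorbed by t, hence lies within [rho n.+3] of the anchor of that
   cell, whichever tube it was in contact with. *)
pose cu (zn : Prop) y := Y y /\ exists s a, [/\ y s, Lab a2 t s, valid t a,
  D (dom t) (rho n.+2) (ska t a) s & zone (bb n.+3) a <-> zn].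
have cuw zn y : cu zn y -> exists a, [/\ valid t a, zone (bb n.+3) a <-> zn &
    forall x, y x -> D (dom t) (rho n.+3) (ska t a) x].
  case=> Yy [s [a [ys Ls va Ds za]]]; exists a; split=> // v yv.
  by apply: (near_str _ Ds (Ystr _ Yy)) => //; [exact: (Yd _ Yy)|exact: Yd].
have cutE y x : Y y -> y x -> a3 x = None -> cu True y \/ cu False y.
  move=> Yy yx E.
  have [s [ys as_]] : exists s, y s /\ a2 s <> None.
    apply: contrapT => h; apply: (cov3 y x) E => //; split=> //; split.
      by exists x.
    by move=> s ys; apply: contrapT => as_; apply: h; exists s.
  have [_ [l Ls]] := nw02 s (YN _ _ Yy ys) as_.
  have [a [va Da _]] := tA2 _ _ Ls.
  have [za|nza] := EM (zone (bb n.+3) a).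
    by left; split=> //; exists s, a; split=> //; exists l.
  by right; split=> //; exists s, a; split=> //; exists l.
have cus zn y a : cu zn y -> ext a2 a -> exists s, y s /\ a s <> None.
  move=> [_ [s [_ [ys [l Ls] _ _ _]]]] h; exists s; split=> //.
  by rewrite (h _ _ Ls).
(* Common form of the last two rounds: one absorption by t, then one recursive call. Together with
   the two absorptions and the call made above, t pays 4 and r pays 3 * 4; this is the factor 3 in
   [bump]. *)
have step zn m (a : assignment) (rr : seq (tube * nat)) :
    n.+2 <= m -> m < N -> (forall b, ~ zone (bb n.+3) b -> ~ zone (bb m.+1) b) ->
    (zn = True -> m = n.+2) -> (zn = True \/ zn = False) ->
    ext asg a -> ext a2 a -> Conn a -> TIn a t m ->
    (forall x, asg x = None -> a x <> None -> (exists y, Y y /\ y x) /\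
      exists p, List.In p ((t, n) :: r) /\ Lab a p.1 x) ->
    TIs a rr -> nodup rr -> (forall p, List.In p rr -> p.1 <> t) ->
    (forall p, List.In p rr -> exists k, List.In (p.1, k) r) ->
    (forall p, List.In p r -> exists k, List.In (p.1, k) rr) ->
    (forall p, List.In p (bump 4 rr) -> p.2 <= N) ->
    (forall Y asg, nodup rr ->
      (forall p, List.In p rr -> wf p.1) -> Conn asg -> TIs asg rr ->
      (forall p, List.In p (bump 4 rr) -> p.2 <= N) ->
      (forall y, Y y -> [/\ str y, forall x, y x -> asg x = None,
         forall p, List.In p rr -> sub y (dom p.1) &
         exists p, List.In p rr /\ contact asg y p.1]) ->
      exists asg', [/\ ext asg asg', Conn asg', old_labels asg asg' &
          TIs asg' (bump 4 rr)] /\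
        [/\ forall x, asg x = None -> asg' x <> None ->
              (exists y, Y y /\ y x) /\ exists p, List.In p rr /\ Lab asg' p.1 x &
            forall y x, Y y -> y x -> asg' x <> None]) ->
    exists a', [/\ ext a a', Conn a', old_labels a a', TIn a' t m.+1 &
        TIs a' (bump 4 rr)] /\
      [/\ forall x, asg x = None -> a' x <> None -> (exists y, Y y /\ y x) /\
            exists p, List.In p ((t, n) :: r) /\ Lab a' p.1 x &
          forall y x, cu zn y -> y x -> a' x <> None].
  move=> m1 m2 zd zm zTF exa ex2a cAa tAa nwa tAr' ndrr ntrr rr1 rr2 bNrr IHr.
  pose W w := exists y, [/\ cu zn y, con w, sub w y & forall x, w x -> a x = None].
  have [b [[exb cAb olb tAb] [nwb alb neb]]] : exists asg',
     [/\ ext a asg', Conn asg', old_labels a asg' & TIn asg' t m.+1] /\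
     [/\ forall x, a x = None -> asg' x <> None ->
           (exists w, W w /\ w x) /\ Lab asg' t x,
         forall w x y, W w -> w x -> w y -> asg' x = None -> asg' y = None &
         forall w x z, W w -> w x -> asg' x = None -> e x z -> ~ Lab asg' t z].
    apply: (phase (zn := zn)) => //.
    move=> w [y [cy cw wy wN]]; split=> //.
    have [al [va za Da]] := cuw _ _ cy; exists al; split=> //.
      case: zTF => E; first by rewrite (zm E) za.
      by rewrite E; split=> // z; apply: (zd al) => //; rewrite za E.
    by move=> x /wy /Da; apply: D_mono; rewrite /rho; lia.
  pose Y' w := exists y x, [/\ cu zn y, y x, b x = None &
    w = rch (fun v => y v /\ b v = None) x].
  have Y'W w : Y' w -> W w.
    move=> [y [x [cy yx bx ->]]]; exists y; split=> //; first exact: rch_con.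
    - by move=> v /rch_r [].
    - by move=> v /rch_r [_]; apply: ext_None.
  have tAbr : TIs b rr.
    move=> p pr; apply: TIn_other exb (tAr' _ pr) _ => x E E2 [l L].
    have [_ [l' L']] := nwb x E E2; apply: (ntrr _ pr).
    by move: L; rewrite L' => -[].
  have nwb0 x : asg x = None -> b x <> None -> (exists y, Y y /\ y x) /\
      exists p, List.In p ((t, n) :: r) /\ Lab b p.1 x.
    move=> E Eb; case Ea : (a x) => [tl|].
      have [|h [p [pr L]]] := nwa _ E; first by rewrite Ea.
      by split=> //; exists p; split=> //; apply: ext_Lab exb L.
    have [[w [[y [[Yy _] _ wy _]] wx]] L] := nwb _ Ea Eb.
    by split; [exists y; split=> //; exact: wy|exists (t, n); split=> //; left].
  have [||||||c [[exc cAc olc tAc] [nwc covc]]] := IHr Y' b.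
  - by [].
  - by move=> p /rr1 [kk /wfr].
  - by [].
  - by [].
  - by [].
  - move=> w Yw; have [y [x [cy yx bx wE]]] := Yw; have [Yy _] := cy.
    have wy : sub w y by rewrite wE => v /rch_r [].
    split.
    + by apply: (str_sub (Ystr _ Yy) wy); rewrite wE; apply: rch_con.
    + by rewrite wE => v /rch_r [].
    + move=> p /rr1 [kk pr] v /wy yv; have [_ _ h _] := HY _ Yy.
      by apply: (h (p.1, kk)) => //; right.
    + have [s [ys as_]] := cus _ _ b cy (ext_trans ex2a exb).
      (* The leftover w no longer touches t, but y contains a labelled cell; so y leaves w into a
         tube of r, with which w is in contact. *)
      have [u [v [xu uv yv bv]]] := left_exit (Ycon _ Yy) yx bx ys as_.
      have wu : w u by rewrite wE.
      have [_ [p [pin Lv]]] := nwb0 v (YN _ _ Yy yv) bv.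
      case: pin => [E|pr].
        by case: (neb _ _ _ (Y'W _ Yw) wu (rch_r xu).2 uv); rewrite -E in Lv.
      have [kk pk] := rr2 _ pr; exists (p.1, kk); split=> //.
      exists u, v; split=> //; apply: (str_sub (Ystr _ Yy)).
        by move=> z [/wy//|->].
      by apply: con_add wu uv; rewrite wE; apply: rch_con.
  exists c; split; split.
  - exact: ext_trans exc.
  - by [].
  - exact: old_trans olc.
  - apply: TIn_other exc tAb _ => x E E2 [l L].
    have [_ [p [pr [l' L']]]] := nwc x E E2; apply: (ntrr _ pr).
    by move: L; rewrite L' => -[].
  - by [].
  - move=> x E Ec; case Eb : (b x) => [tl|].
      have [|h [p [pr L]]] := nwb0 _ E; first by rewrite Eb.
      by split=> //; exists p; split=> //; apply: ext_Lab exc L.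
    have [[w [[y [z [[Yy _] _ _ ->]]] wx]] [p [pr L]]] := nwc _ Eb Ec.
    split; first by exists y; split=> //; have [] := rch_r wx.
    by have [kk pk] := rr1 _ pr; exists (p.1, kk); split=> //; right.
  - move=> y x cy yx Ec; have Eb := ext_None exc Ec.
    apply: (covc (rch (fun v => y v /\ b v = None) x) x) Ec => //.
      by exists y, x; split.
    exact: rch0.
have nt4 c p : List.In p (bump c r) -> p.1 <> t.
  by move=> /bump_InV [m [/nd]].
have bk c p : List.In p (bump c r) -> exists k, List.In (p.1, k) r.
  by move=> /bump_InV [m [h _]]; exists m.
have b8 p : List.In p (bump 4 (bump 4 r)) -> p.2 <= N.
  by rewrite bumpD => /(bump_le (d := 12)) [//|m [/bNr /= h1 h2]]; lia.
have b12 p : List.In p (bump 4 (bump 8 r)) -> p.2 <= N.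
  by rewrite bumpD => /bNr.
have [a5 [[ex5 cA5 ol5 tA5t tA5] [nw5 cov5]]] : exists a',
  [/\ ext a3 a', Conn a', old_labels a3 a', TIn a' t n.+3 &
        TIs a' (bump 4 (bump 4 r))] /\
      [/\ forall x, asg x = None -> a' x <> None -> (exists y, Y y /\ y x) /\
            exists p, List.In p ((t, n) :: r) /\ Lab a' p.1 x &
          forall y x, cu True y -> y x -> a' x <> None].
  apply: step => //; try by [left|lia|apply: nodup_bump|apply: bk|apply: nt4].
  - by move=> p /(bump_In 4).
  - by move=> *; apply: IH => //; rewrite size_bump.
rewrite bumpD in tA5.
have [a7 [[ex7 cA7 ol7 tA7t tA7] [nw7 cov7]]] : exists a',
  [/\ ext a5 a', Conn a', old_labels a5 a', TIn a' t n.+4 &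
        TIs a' (bump 4 (bump 8 r))] /\
      [/\ forall x, asg x = None -> a' x <> None -> (exists y, Y y /\ y x) /\
            exists p, List.In p ((t, n) :: r) /\ Lab a' p.1 x &
          forall y x, cu False y -> y x -> a' x <> None].
  apply: step => //; try by [right|lia|apply: nodup_bump|apply: bk|apply: nt4].
  - by move=> b; apply: zone_dec; apply: bb_dec.
  - by move=> h; exfalso; rewrite h.
  - exact: ext_trans ex5.
  - exact: ext_trans ex5.
  - by move=> p /(bump_In 8).
  - by move=> *; apply: IH => //; rewrite size_bump.
rewrite bumpD in tA7.
exists a7; split; split.
- exact: ext_trans (ext_trans ex03 ex5) ex7.
- by [].
- exact: old_trans (old_trans (old_trans (old_trans ol1 ol2) ol3) ol5) ol7.
- move=> p [<-|]; first by rewrite /= addn4.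
  exact: tA7.
- by [].
- move=> y x Yy yx E7; have E5 := ext_None ex7 E7; have E3 := ext_None ex5 E5.
  have [cy|cy] := cutE _ _ Yy yx E3; first exact: (cov5 _ _ cy yx).
  exact: (cov7 _ _ cy yx).
Qed.

(** * Geodesic tripods and new tubes *)

Lemma min_ex (P : nat -> Prop) : (exists n, P n) ->
  exists n, P n /\ forall m, P m -> n <= m.
Proof.
case=> n Pn; have exP : exists n, `[< P n >] by exists n; apply/asboolP.
case: (ex_minnP exP) => m /asboolP Pm H; exists m; split=> // k Pk.
by apply: H; apply/asboolP.
Qed.

Lemma geodesic X n x y : D X n x y -> (forall m, D X m x y -> n <= m) ->
  exists s : nat -> V, [/\ s 0 = x, s n = y &
    forall i, i < n -> ES X (s i) (s i.+1)].
Proof.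
elim: n y => [y /= -> _|n IH y [z [xz zy]] mn]; first by exists (fun=> y).
case: zy => [zy|zy]; first by subst z; have := mn _ xz; rewrite ltnn.
have [|s [s0 sn ss]] := IH _ xz.
  by move=> m xz'; rewrite -ltnS; apply: mn; exists z; split=> //; right.
exists (fun i => if i <= n then s i else y); split=> //.
  by rewrite ltnn.
move=> i hi; have [lin|->] : i < n \/ i = n by lia.
  by rewrite (ltnW lin) lin; apply: ss.
by rewrite leqnn ltnn sn.
Qed.

Lemma walk_D X (s : nat -> V) n i j : (forall i, i < n -> ES X (s i) (s i.+1)) ->
  i <= j -> j <= n -> D X (j - i) (s i) (s j).
Proof.
move=> ss /subnKC <-; elim: (j - i) => [|k IH] h.
  by rewrite addn0 subnn.
rewrite addnS -addnS addKn; exists (s (i + k)); split.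
  by have := IH; rewrite addKn; apply; lia.
by right; rewrite addnS; apply: ss; lia.
Qed.

(** Take a geodesic from x1 to x2 and a shortest path from it to x3. Let two points at string
    distance k lie on the geodesic, i from the foot, and on the third leg, j from the foot. Then j
    <= k because the third leg is shortest, and i <= k + j because the first two legs form a
    geodesic, so i + j <= 3 * k. *)
Lemma tube_exists X x1 x2 x3 : con X -> X x1 -> X x2 -> X x3 ->
  exists t, [/\ wf t, dom t = X &
    forall x, x = x1 \/ x = x2 \/ x = x3 -> exists a, valid t a /\ ska t a = x].
Proof.
move=> cX X1 X2 X3.
have [n [Dn mn]] := min_ex (rch_D (cX _ _ X1 X2)).
have [s [s0 sn ss]] := geodesic Dn mn.
have Xs i : i <= n -> X (s i).
  by move=> h; apply: D_in (walk_D ss (leq0n i) h) _; rewrite s0.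
have [m [[f [fn Dm]] mm]] : exists m, (exists f, f <= n /\ D X m (s f) x3) /\
    forall m', (exists f, f <= n /\ D X m' (s f) x3) -> m <= m'.
  apply: min_ex; have [k Dk] := rch_D (cX _ _ X1 X3).
  by exists k, 0; rewrite s0.
have [p [p0 pm ps]] : exists p : nat -> V, [/\ p 0 = s f, p m = x3 &
    forall i, i < m -> ES X (p i) (p i.+1)].
  by apply: geodesic Dm _ => m' h; apply: mm; exists f.
have Xp i : i <= m -> X (p i).
  by move=> h; apply: D_in (walk_D ps (leq0n i) h) _; rewrite p0; apply: Xs.
have G1 k i j : i <= j -> j <= n -> D X k (s i) (s j) -> j - i <= k.
  move=> ij jn Dk; have := mn (i + k + (n - j)).
  have h1 := walk_D ss (leq0n i) (leq_trans ij jn).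
  have h2 := walk_D ss jn (leqnn n).
  rewrite s0 subn0 in h1; rewrite sn in h2.
  by move/(_ (D_trans (D_trans h1 Dk) h2)); lia.
have G1' k i j : i <= n -> j <= n -> D X k (s i) (s j) -> (i - j) + (j - i) <= k.
  move=> hi hj Dk; case: (leqP i j) => ij; first by have := G1 _ _ _ ij hj Dk; lia.
  by have := G1 _ _ _ (ltnW ij) hi (D_sym Dk); lia.
have G2 k i j : i <= n -> j <= m -> D X k (s i) (p j) -> j <= k.
  move=> hi hj Dk; have := mm (k + (m - j)).
  have h2 := walk_D ps hj (leqnn m); rewrite pm in h2.
  have H : exists f, f <= n /\ D X (k + (m - j)) (s f) x3.
    by exists i; split=> //; apply: D_trans Dk h2.
  by move/(_ H); lia.
have G3 k i j : i <= n -> j <= m -> D X k (s i) (p j) -> (i - f) + (f - i) <= k + j.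
  move=> hi hj Dk; apply: G1' => //; apply: D_trans Dk _; apply: D_sym.
  by have := walk_D ps (leq0n j) hj; rewrite subn0 p0.
have G4 k i j : i <= j -> j <= m -> D X k (p i) (p j) -> j - i <= k.
  move=> ij jm Dk; have := walk_D ps (leq0n i) (leq_trans ij jm).
  rewrite p0 subn0 => h; have := G2 _ _ _ fn jm (D_trans h Dk); lia.
have G4' k i j : i <= m -> j <= m -> D X k (p i) (p j) -> (i - j) + (j - i) <= k.
  move=> hi hj Dk; case: (leqP i j) => ij; first by have := G4 _ _ _ ij hj Dk; lia.
  by have := G4 _ _ _ (ltnW ij) hi (D_sym Dk); lia.
pose ln g := match g with 0 => n - f | 1 => f | 2 => m | _ => 0 end.
pose skf g r := match g with 0 => s (f + r) | 1 => s (f - r) | 2 => p r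
  | _ => s f end.
exists (Tube X ln skf); split=> //.
- split.
  + move=> [[|[|[|g]]] r]; rewrite /valid /ska /= => h; try (apply: Xs; lia).
    by apply: Xp; lia.
  + by move=> [|[|[|g]]] //=; rewrite ?addn0 ?subn0.
  + move=> [|[|[|g]]] r //= h.
    * by rewrite addnS; apply: ss; lia.
    * apply: ES_sym; have -> : f - r = (f - r.+1).+1 by lia.
      by apply: ss; lia.
    * exact: ps.
  + have sp i j k : i <= n -> j <= m -> D X k (s i) (p j) ->
        (i - f) + (f - i) + j <= 3 * k.
      move=> hi hj Dk; have := G2 _ _ _ hi hj Dk; have := G3 _ _ _ hi hj Dk; lia.
    move=> [[|[|[|g]]] r] [[|[|[|g']]] r'] k; rewrite /valid /ska /dT /= => h h' Dk;
      try (have := G1' _ _ _ _ _ Dk; lia);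
      try (have := G4' _ _ _ _ _ Dk; lia);
      try (have := sp _ _ _ _ _ Dk; lia);
      try (have := sp _ _ _ _ _ (D_sym Dk); lia).
    by case: eqP; lia.
- move=> x [->|[->|->]].
  + by exists (1, f); rewrite /valid /ska /= subnn s0.
  + by exists (0, n - f); rewrite /valid /ska /= subnKC.
  + by exists (2, m); rewrite /valid /ska.
Qed.

(** Labels are forced in the zones. The remaining pieces along the tripod obtain theirs by one call
    of [phase], which is why a new tube starts with count 1. *)
Lemma tube_init asg t : Conn asg -> wf t -> (forall x, dom t x -> asg x = None) ->
  (forall x, ~ Lab asg t x) -> 0 < N ->
  exists asg', [/\ ext asg asg', Conn asg', TIn asg' t 1 & con (Lab asg' t)] /\
    [/\ forall x, asg x = None -> asg' x <> None -> dom t x /\ Lab asg' t x &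
        forall a, valid t a -> Lab asg' t (ska t a)].
Proof.
move=> cA wft dN fr N0; have [w1 w2 w3 w4] := wft.
have /choice [qf qfP] : forall a : nat * nat, exists q, a.2 < len t a.1 ->
    [/\ str q, sub q (dom t), q (sk t a.1 a.2) & q (sk t a.1 a.2.+1)].
  (* The value at the tip of a leg is a dummy: [PC] reads [qf] only before it. *)
  move=> [g r] /=; case: (ltnP r (len t g)) => h; last by exists (fun=> True).
  by have [q hq] := w3 _ _ h; exists q.
pose PC a x := valid t a /\ ((a.2 < len t a.1 /\ qf a x) \/ x = ska t a).
have PCD a x : PC a x -> D (dom t) 1 (ska t a) x.
  move=> [va [[h qx]|->]]; last exact: D_refl.
  by have [? ? ? ?] := qfP _ h; apply: D1; exists (qf a).
have PCdom a x : PC a x -> dom t x.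
  by move=> h; apply: D_in (PCD _ _ h) _; apply: w1; case: h.
have PCsk a : valid t a -> PC a (ska t a) by move=> va; split=> //; right.
have PCcon a x : PC a x -> rch (PC a) (ska t a) x.
  move=> [va [[h qx]|->]]; last by apply: rch0; exact: PCsk.
  have [sq qd q1 q2] := qfP _ h.
  apply: rch_mono (str_con sq q1 qx) => v qv; split=> //; by left.
have PCS g r : r < len t g -> rch (PC (g, r)) (sk t g r) (sk t g r.+1).
  move=> h; apply: (PCcon (g, r)); split; first exact: ltnW.
  by left; split=> //; have [] := qfP (g, r) h.
have [hb1 hb2] := bb_bounds 0; pose b := bb 0; rewrite -/b in hb1 hb2.
pose ZS l x := exists a, [/\ PC a x, zone b a & Acc b a l].
have zAcc a l k : zone b a -> Acc b a l -> a.2 <= k * Q + b -> k * Q <= a.2 + b ->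
    l.2 = k.
  by move=> _ [_ _ A3 A4] h1 h2; case: (ltngtP l.2 k) => // /QlemA; lia.
(* Two anchors of one cell are at most 6 apart, hence in the same zone, where a single label is
   admissible. *)
have ZSu l l' x : ZS l x -> ZS l' x -> l = l'.
  move=> [a [pa za Aa]] [a' [pa' za' Aa']].
  have dd : dT a a' <= sg.
    have := dT_close wft (proj1 pa) (proj1 pa') (PCD _ _ pa) (PCD _ _ pa'); lia.
  have Aal : Acc b a' l by apply: Acc_step Aa dd.
  have [k [k1 k2]] := za'.
  have E := zAcc _ _ _ za' Aal k1 k2; have E' := zAcc _ _ _ za' Aa' k1 k2.
  case: Aal => B1 B2 _ _; case: Aa' => B1' B2' _ _.
  case: l l' E E' B1 B2 B1' B2' {Aa} => [g r] [g' r'] /= -> -> B1 B2 B1' B2'.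
  congr (_, _); case: B1 => [E|E]; first by rewrite B2 // B2'.
  by case: B1' => [E'|E']; [rewrite B2 // B2'|rewrite E E'].
have ZSdom l x : ZS l x -> dom t x by case=> a [/PCdom].
have zl a : valid t a -> zone b a -> exists l, Acc b a l.
  move=> va [k [k1 k2]]; exists (if k is 0 then 0 else a.1, k); split=> /=.
  - by case: (k) => [|?]; [left|right].
  - by move=> ->.
  - lia.
  - lia.
have chain l g i d : i + d <= len t g ->
    (forall j, i <= j <= i + d -> zone b (g, j) /\ Acc b (g, j) l) ->
    rch (ZS l) (sk t g i) (sk t g (i + d)).
  elim: d => [|d IH] h H.
    rewrite addn0; apply: rch0; exists (g, i); have [|? ?] := H i; first lia.
    by split=> //; apply: PCsk; rewrite /valid /=; lia.
  apply: (@rch_trans _ _ (sk t g (i + d))).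
    by apply: IH => [|j hj]; [lia|apply: H; lia].
  rewrite addnS in h *; apply: rch_mono (PCS _ _ h) => v hv.
  by have [|? ?] := H (i + d); [lia|exists (g, i + d)].
have toska l a x : PC a x -> zone b a -> Acc b a l -> rch (ZS l) x (ska t a).
  move=> pa za Aa; apply: rch_sym; apply: rch_mono (PCcon _ _ pa) => v pv.
  by exists a.
have zAk a l : zone b a -> Acc b a l -> a.2 <= l.2 * Q + b /\ l.2 * Q <= a.2 + b.
  move=> za Aa; have [k [k1 k2]] := za.
  by rewrite (zAcc _ _ _ za Aa k1 k2).
have legs l g i j : i <= j -> j <= len t g -> zone b (g, i) -> zone b (g, j) ->
    Acc b (g, i) l -> Acc b (g, j) l -> rch (ZS l) (sk t g i) (sk t g j).
  move=> ij jl zi zj Ai Aj; rewrite -(subnKC ij); apply: chain; first lia.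
  have [i1 i2] := zAk _ _ zi Ai; have [j1 j2] := zAk _ _ zj Aj.
  move=> k hk; simpl in *; split; first by exists l.2; simpl; lia.
  by case: Ai => B1 B2 _ _; split=> //=; lia.
have ZScon l : con (ZS l).
  move=> x y [a [pa za Aa]] [a' [pa' za' Aa']].
  apply: rch_trans (toska _ _ _ pa za Aa) _.
  apply: rch_trans (rch_sym (toska _ _ _ pa' za' Aa')).
  move: pa pa' za za' Aa Aa' => [va _] [va' _].
  case: a va => g r va; case: a' va' => g' r' va' za za' Aa Aa'.
  have [E|E] := EM (g = g').
    subst g'; case: (leqP r r') => h; first exact: legs.
    by apply: rch_sym; apply: legs => //; apply: ltnW.
  have l0 : l.2 = 0.
    by case: Aa Aa' => [[//|/= B1] _ _ _] [[//|/= B1'] _ _ _]; case: E; rewrite -B1.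
  have to0 g1 r1 : valid t (g1, r1) -> zone b (g1, r1) -> Acc b (g1, r1) l ->
      rch (ZS l) (sk t 0 0) (sk t g1 r1).
    move=> v1 z1 A1; rewrite -(w2 g1); apply: legs => //.
      by exists 0 => /=; lia.
    by case: A1 => B1 B2 B3 B4; split; [left|exact: B2| |]; rewrite ?l0 /=; lia.
  by apply: rch_trans (to0 _ _ va' za' Aa'); apply: rch_sym; apply: to0.
pose asgz x := if pselect (exists l, ZS l x) is left h then Some (t, projT1 (cid h))
  else asg x.
have azZ l x : ZS l x -> asgz x = Some (t, l).
  move=> zx; rewrite /asgz; case: pselect => [h|]; last by case; exists l.
  by case: cid => l' zl' /=; rewrite (ZSu _ _ _ zl' zx).
have azE x tl : asgz x = Some tl -> (exists l, ZS l x /\ tl = (t, l)) \/ asg x = Some tl.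
  rewrite /asgz; case: pselect => [h|_]; last by right.
  by case: cid => l zx /= [<-]; left; exists l.
have exz : ext asg asgz.
  move=> x tl E; rewrite /asgz; case: pselect => [[l zx]|//].
  by rewrite (dN _ (ZSdom _ _ zx)) in E.
have azt x l : asgz x = Some (t, l) -> ZS l x.
  move=> /azE [[l' [zx [->]]] //|E]; by case: (fr x); exists l.
have cAz : Conn asgz.
  move=> x y tl Ex Ey; case: (azE _ _ Ex) => [[l [zx E]]|Ex'].
    subst tl; apply: rch_mono (ZScon l _ _ zx (azt _ _ Ey)) => v; exact: azZ.
  case: (azE _ _ Ey) => [[l [zy E]]|Ey'].
    by subst tl; case: (fr x); exists l.
  by apply: rch_mono (cA _ _ _ Ex' Ey') => v /exz.
have tAz : TIn asgz t 0.
  move=> x l /azt [a [pa za Aa]]; exists a; split=> //; first by case: pa.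
  exact: PCD.
pose W w := [/\ con w, forall x, w x -> asgz x = None &
  exists a, [/\ valid t a, ~ zone b a & sub w (PC a)]].
have [asg' [[ex1 cA1 ol1 tA1] [nw1 al1 ne1]]] : exists asg',
   [/\ ext asgz asg', Conn asg', old_labels asgz asg' & TIn asg' t 1] /\
   [/\ forall x, asgz x = None -> asg' x <> None ->
         (exists w, W w /\ w x) /\ Lab asg' t x,
       forall w x y, W w -> w x -> w y -> asg' x = None -> asg' y = None &
       forall w x z, W w -> w x -> asg' x = None -> e x z -> ~ Lab asg' t z].
  apply: (phase (zn := False)) => // w [cw wN [a [va nza wa]]]; split=> //.
  exists a; split=> //; first by split=> // /(zone_dec (bb_dec (leq0n 1))).
  by move=> x /wa /PCD; apply: D_mono.
have ex02 := ext_trans exz ex1.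
pose M x := exists a, PC a x.
have nwM x : asg x = None -> asg' x <> None -> M x /\ Lab asg' t x.
  move=> E E'; case Ez : (asgz x) => [tl|].
    case: (azE _ _ Ez) => [[l [[a [pa _ _]] tlE]]|]; last by rewrite E.
    by split; [exists a|exists l; apply: ex1; rewrite Ez tlE].
  have [[w [[_ _ [a [_ _ wa]]] wx]] L] := nw1 _ Ez E'.
  by split=> //; exists a; apply: wa.
have Mdom x : M x -> dom t x by case=> a /PCdom.
have foot r g : r <= len t g -> rch M (sk t 0 0) (sk t g r).
  elim: r => [_|r IH h].
    rewrite w2; apply: rch0; exists (0, 0); exact: PCsk.
  apply: rch_trans (IH (ltnW h)) _.
  by apply: rch_mono (PCS _ _ h) => v pv; exists (g, r).
have Mfoot x : M x -> rch M (sk t 0 0) x.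
  move=> [[g r] pa]; apply: rch_trans (foot r g (proj1 pa)) _.
  by apply: rch_mono (PCcon _ _ pa) => v pv; exists (g, r).
(* Where a walk towards the labelled foot leaves the unlabelled cells, a piece outside the zones
   touches t and should have been absorbed. *)
have Mall x : M x -> asg' x <> None.
  move=> Mx E.
  have v00 : valid t (0, 0) by rewrite /valid.
  have z00 : zone b (0, 0) by exists 0 => /=; lia.
  have [l Al] := zl _ v00 z00.
  have af : asg' (sk t 0 0) <> None.
    rewrite (ex1 _ (t, l)) //; apply: azZ; exists (0, 0); split=> //.
    exact: PCsk.
  have [u [v [xu uv Mv Ev]]] := rch_exit (B := fun z => asg' z = None)
    (rch_sym (Mfoot _ Mx)) E af.
  have [Mu Eu] := rch_r xu; have [a pa] := Mu.
  have nza : ~ zone b a.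
    move=> za; have [l' Al'] := zl _ (proj1 pa) za.
    by rewrite (ex1 _ (t, l')) in Eu => //; apply: azZ; exists a.
  have Ww : W (rch (fun z => PC a z /\ asg' z = None) u).
    split; first exact: rch_con.
    - by move=> z /rch_r [_]; apply: ext_None.
    - by exists a; split=> //; [case: pa|move=> z /rch_r []].
  apply: (ne1 _ u v Ww) => //; first exact: rch0.
  by have [] := nwM v (dN _ (Mdom _ Mv)) Ev.
have LM x : Lab asg' t x <-> M x.
  split=> [[l L]|Mx]; last by have [] := nwM x (dN _ (Mdom _ Mx)) (Mall _ Mx).
  case E : (asg x) => [tl|].
    by have := ex02 _ _ E; rewrite L => -[E']; case: (fr x); exists l; rewrite E E'.
  by have [|] := nwM _ E; rewrite ?L.
exists asg'; split; split=> //.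
- move=> x y /LM Mx /LM My; apply: (@rch_mono M) => [v /LM//|].
  by apply: rch_trans (Mfoot _ My); apply: rch_sym; apply: Mfoot.
- by move=> x E /(nwM _ E) [/Mdom].
- by move=> a va; apply/LM; exists a; apply: PCsk.
Qed.

(** * Territories and the cop strategy *)

Variable msr : (V -> Prop) -> nat.
Hypothesis msr_le : forall A B, sub A B -> msr A <= msr B.
Hypothesis msr_lt : forall A B x, sub A B -> B x -> ~ A x -> msr A < msr B.
Hypothesis noK5 : forall F : nat -> V -> Prop,
  (forall i, i < 5 -> exists x, F i x) -> (forall i, i < 5 -> con (F i)) ->
  (forall i j x, i < 5 -> j < 5 -> F i x -> F j x -> i = j) ->
  (forall i j, i < j -> j < 5 -> exists x y, [/\ F i x, F j y & e x y]) -> False.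
(** A new tube has count 1 and at most three older tubes, so [cb] asks for 1 + 2 * 3^3 <= N + 2. *)
Hypothesis NE : 53 <= N.

Definition avoid asg t q := forall x, q x -> ~ Lab asg t x.
Definition ne q := exists x, q x.

(* q is exhausted by d nested tubes, each met by the part that is left. *)
Fixpoint Dep asg d q := if d is d'.+1 then
  exists t, [/\ sub q (dom t), exists x, q x /\ Lab asg t x &
    forall q', con q' -> ne q' -> sub q' q -> avoid asg t q' -> Dep asg d' q']
  else False.

Definition before (L : seq tube) t' t :=
  exists l1 l2, L = l1 ++ t :: l2 /\ List.In t' l1.

(* The tubes of L are listed from the oldest to the youngest. *)
Definition Near asg L t q := exists qh, [/\ str qh, sub q qh,
  exists x, qh x /\ Lab asg t x & forall t', before L t' t -> avoid asg t' qh].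

(** [Fs] records the surrounding tubes that longer pieces of the same string have met and q itself
    avoids. At most four tubes surround X, so 4 - [size Fs] levels of [Dep] remain to be spent. *)
Definition pre_claim X asg L q (Fs : seq tube) :=
  [/\ str q, ne q, sub q X, List.NoDup Fs &
   forall t, List.In t Fs -> [/\ List.In t L, avoid asg t q & Near asg L t q]].

Definition claim X L asg := forall q Fs, pre_claim X asg L q Fs ->
  Dep asg (4 - size Fs) q.

Lemma first_hit (L : seq tube) (P : tube -> Prop) :
  (exists t, List.In t L /\ P t) -> exists l1 t l2,
    [/\ L = l1 ++ t :: l2, P t & forall t', List.In t' l1 -> ~ P t'].
Proof.
elim: L => [[t []//]|u L IH [t [tL Pt]]].
have [Pu|nPu] := EM (P u); first by exists [::], u, L.
case: tL => [E|tL]; first by rewrite E in nPu.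
have [|l1 [t' [l2 [-> Pt' H]]]] := IH; first by exists t.
by exists (u :: l1), t', l2; split=> // t'' [<-//|/H].
Qed.

Lemma NoDup_split (T : Type) (l1 l2 l1' l2' : seq T) t : List.NoDup (l1 ++ t :: l2) ->
  l1 ++ t :: l2 = l1' ++ t :: l2' -> l1 = l1'.
Proof.
elim: l1 l1' => [|a l1 IH] [|a' l1'] //= nd [].
- move=> E E2; move: nd; rewrite E2 => /List.NoDup_cons_iff [nin _].
  by case: nin; rewrite E; apply: List.in_or_app; right; left.
- move=> E E2; move: nd; rewrite E => /List.NoDup_cons_iff [nin _].
  by case: nin; apply: List.in_or_app; right; left.
- by move=> -> E2; move/List.NoDup_cons_iff: nd => [_ nd]; rewrite (IH l1').
Qed.

Lemma size_length (T : Type) (s : seq T) : size s = length s.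
Proof. by []. Qed.

Lemma pre_sub X X' asg L q q' Fs : pre_claim X asg L q Fs -> con q' -> ne q' ->
  sub q' q -> sub q' X' -> pre_claim X' asg L q' Fs.
Proof.
move=> [sq nq qX nd H] cq' nq' q'q q'X; split=> //.
  exact: (str_sub sq).
move=> t /H [tL aq [qh [sh qqh hit bf]]]; split=> //.
  by move=> x /q'q /aq.
by exists qh; split=> // x /q'q /qqh.
Qed.

(* Only strings missing every listed tube need to be treated: otherwise the
   oldest listed tube that is hit plays the role of [t] in [Dep]. *)
Lemma claim_listed X L asg : size L <= 4 -> List.NoDup L ->
  (forall t, List.In t L -> sub X (dom t)) ->
  (forall q Fs, pre_claim X asg L q Fs -> (forall t, List.In t L -> avoid asg t q) ->
     Dep asg (4 - size Fs) q) ->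
  claim X L asg.
Proof.
move=> sL ndL Xd H q Fs; move: {2}(4 - size Fs) (leqnn (4 - size Fs)) => k.
elim: k q Fs => [|k IH] q Fs hk pc.
  have [h|h] := EM (forall t, List.In t L -> avoid asg t q); first exact: H.
  exfalso; apply: h => t tL x qx Lx; have [_ _ _ nd HF] := pc.
  have nin : ~ List.In t Fs by move=> /HF [_ /(_ x qx)].
  have nd' : List.NoDup (t :: Fs) by constructor.
  have inc : List.incl (t :: Fs) L by move=> t' [<-//|/HF []].
  have := List.NoDup_incl_length nd' inc; rewrite -!size_length /=; lia.
have [h|h] := EM (forall t, List.In t L -> avoid asg t q); first exact: H.
have : exists t, List.In t L /\ exists x, q x /\ Lab asg t x.
  apply: contrapT => h'; apply: h => t tL x qx Lx; apply: h'.
  by exists t; split=> //; exists x.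
move=> /first_hit [l1 [t [l2 [LE hit bf]]]].
have tL : List.In t L by rewrite LE; apply: List.in_or_app; right; left.
have [sq nq qX nd HF] := pc.
have nin : ~ List.In t Fs.
  by move=> /HF [_ aq _]; case: hit => x [qx]; apply: aq.
have nd' : List.NoDup (t :: Fs) by constructor.
have inc : List.incl (t :: Fs) L by move=> t' [<-//|/HF []].
have sz : size Fs < 4.
  have := List.NoDup_incl_length nd' inc; rewrite -!size_length /=; lia.
have -> : 4 - size Fs = (4 - size (t :: Fs)).+1 by move=> /=; lia.
exists t; split=> //.
  by move=> x /qX; apply: Xd.
move=> q' cq' nq' q'q aq'; apply: IH; first by move=> /=; lia.
have [sq' _ q'X _ HF'] := pre_sub (X' := X) pc cq' nq' q'q (fun x h => qX _ (q'q _ h)).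
split=> // t' [<-|/HF'//]; split=> //.
exists q; split=> // t'' [l1' [l2' [LE' in1]]].
have E : l1 = l1' by apply: (@NoDup_split _ _ l2 _ l2' t); rewrite -?LE.
rewrite -E in in1; move=> x qx Lx; apply: (bf _ in1); by exists x.
Qed.

(* The tube at position k can still be charged 4 + 12 + ... = 2 * (3 ^ k - 1). *)
Fixpoint cb k (ts : seq (tube * nat)) : Prop :=
  if ts is p :: r then p.2 + 2 * 3 ^ k <= N + 2 /\ cb k.+1 r else True.

Lemma cb_cat k a b : cb k (a ++ b) <-> cb k a /\ cb (k + size a) b.
Proof.
elim: a k => [|p a IH] k /=; first by rewrite addn0; split=> [|[]].
by rewrite IH addSnnS; split=> [[h1 [h2 h3]]|[[h1 h2] h3]].
Qed.

(** When an older tube goes, positions drop by one and 2 * 3^(k+1) - 2 * 3^k = 4 * 3^k of the budget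
    is freed. *)
Lemma cb_bump c k ts : c <= 4 * 3 ^ k -> cb k.+1 ts -> cb k (bump c ts).
Proof.
elim: ts c k => [//|[t n] r IH] c k h /= [h1 h2]; split.
  move: h1; rewrite expnS; lia.
by apply: IH h2; rewrite expnS; lia.
Qed.

Lemma cb_le k ts p : cb k ts -> List.In p ts -> p.2 <= N.
Proof.
elim: ts k => [//|u r IH] k /= [h1 h2] [<-|h]; last exact: IH h2 h.
have := expn_gt0 3 k; lia.
Qed.

Definition Dm asg := forall t x, Lab asg t x -> dom t x.

Definition Good asg x := forall t l, asg x = Some (t, l) ->
  wf t /\ exists a, [/\ valid t a, D (dom t) (rho N) (ska t a) x & Acc (bb N) a l].

Definition tubes (ts : seq (tube * nat)) := map fst ts.

(** The last block keeps the surrounding tubes connected and pairwise adjacent, ready to serve as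
    branch sets of a K5 minor, and makes them a complete barrier around X. *)
Definition Inv X ts asg :=
  [/\ [/\ con X, ne X & forall x, X x -> asg x = None],
      [/\ nodup ts, size ts <= 4, cb 0 ts & TIs asg ts],
      Conn asg, Dm asg &
      [/\ forall p, List.In p ts -> [/\ wf p.1, sub X (dom p.1),
            ne (Lab asg p.1) & con (Lab asg p.1)],
          forall p p', List.In p ts -> List.In p' ts -> p.1 <> p'.1 ->
            exists x y, [/\ Lab asg p.1 x, Lab asg p'.1 y & e x y] &
          forall x y, X x -> e x y -> ~ X y ->
            exists p, List.In p ts /\ Lab asg p.1 y]].

(** A label found on X is an old label of a surrounding tube or belongs to a tube born inside X, so
    disjoint territories share no new label. The claim is made for every later [fin], because other
    territories are still to be labelled. *)
Definition Out X L asg asg' :=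
  [/\ ext asg asg', forall x, ~ X x -> asg' x = asg x,
      forall x, X x -> asg' x <> None, Conn asg' & Dm asg'] /\
  [/\ forall x t l, X x -> asg' x = Some (t, l) ->
        (List.In t L /\ exists y, asg y = Some (t, l)) \/ sub (dom t) X,
      forall x, X x -> Good asg' x &
      forall fin, (forall x, X x -> fin x = asg' x) -> ext asg fin ->
        claim X L fin].

(** Components are treated independently. A class with an old label is connected through its old
    cells; a new label belongs to a tube whose territory lies in one component. A string piece
    inside Rg also stays in one component. *)
Lemma Out_comps (Rg : V -> Prop) L asg : Conn asg -> Dm asg ->
  (forall x, Rg x -> asg x = None) ->
  (forall x, Rg x -> exists asg', Out (rch Rg x) L asg asg') ->
  exists asg', Out Rg L asg asg'.
Proof.
move=> cA dA RN H.
have /choice [F HF] : forall C, exists asg', (exists x, Rg x /\ C = rch Rg x) ->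
    Out C L asg asg'.
  move=> C; have [[x [Rx ->]]|n] := EM (exists x, Rg x /\ C = rch Rg x).
    by have [a h] := H _ Rx; exists a.
  by exists asg => /n.
have FO x : Rg x -> Out (rch Rg x) L asg (F (rch Rg x)).
  by move=> Rx; apply: HF; exists x.
have rcE x y : rch Rg x y -> rch Rg x = rch Rg y.
  move=> xy; apply/funext => z; apply/propext; split; last exact: rch_trans.
  by apply: rch_trans; apply: rch_sym.
pose a' x := if pselect (Rg x) is left _ then F (rch Rg x) x else asg x.
have a'R x : Rg x -> a' x = F (rch Rg x) x by move=> h; rewrite /a'; case: pselect.
have a'N x : ~ Rg x -> a' x = asg x by move=> h; rewrite /a'; case: pselect.
have ex : ext asg a'.
  by move=> x tl E; rewrite a'N // => /RN; rewrite E.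
have agr x y : rch Rg x y -> a' y = F (rch Rg x) y.
  by move=> xy; rewrite (a'R _ (rch_r xy)) (rcE _ _ xy).
have exF x tl v : Rg x -> F (rch Rg x) v = Some tl -> a' v = Some tl.
  move=> Rx E; have [[h1 h2 _ _ _] _] := FO _ Rx.
  have [xv|nxv] := EM (rch Rg x v); first by rewrite (agr _ _ xv).
  by rewrite h2 // in E; apply: ex.
have dA' : Dm a'.
  move=> t x [l E]; have [Rx|nRx] := EM (Rg x).
    have [[_ _ _ _ dF] _] := FO _ Rx; apply: dF; exists l; by rewrite -a'R.
  by apply: dA; exists l; rewrite -a'N.
have lab x t l : Rg x -> a' x = Some (t, l) ->
    (List.In t L /\ exists y, asg y = Some (t, l)) \/ sub (dom t) (rch Rg x).
  move=> Rx E; have [_ [h _ _]] := FO _ Rx.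
  by apply: (h x) => //; [apply: rch0|rewrite -a'R].
exists a'; split; split=> //.
- move=> x Rx; rewrite a'R //; have [[_ _ h _ _] _] := FO _ Rx.
  by apply: h; apply: rch0.
- have toold x tl y0 : a' x = Some tl -> asg y0 = Some tl ->
      rch (fun v => a' v = Some tl) x y0.
    move=> E E0; have [Rx|nRx] := EM (Rg x).
      have [[exx _ _ cF _] _] := FO _ Rx.
      apply: (@rch_mono (fun v => F (rch Rg x) v = Some tl)) => [v|].
        exact: exF.
      by apply: cF; [rewrite -a'R|apply: exx].
    apply: (@rch_mono (fun v => asg v = Some tl)) => [v /ex//|].
    by apply: cA => //; rewrite -a'N.
  move=> x y tl Ex Ey.
  have [[y0 E0]|no] := EM (exists y0, asg y0 = Some tl).
    by apply: rch_trans (toold _ _ _ Ex E0) (rch_sym (toold _ _ _ Ey E0)).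
  have Rof z : a' z = Some tl -> Rg z.
    move=> E; apply: contrapT => nR; apply: no; exists z; by rewrite -a'N.
  have Rx := Rof _ Ex; have Ry := Rof _ Ey.
  case: tl Ex Ey no Rof => t l Ex Ey no _.
  have [[_ yy]|sx] := lab _ _ _ Rx Ex; first by case: no.
  have xy : rch Rg x y by apply: sx; apply: dA'; exists l.
  apply: (@rch_mono (fun v => F (rch Rg x) v = Some (t, l))) => [v|]; first exact: exF.
  have [[_ _ _ cF _] _] := FO _ Rx; apply: cF; first by rewrite -a'R.
  by rewrite -agr.
- move=> x t l Rx E; have [h|h] := lab _ _ _ Rx E; [by left|right].
  by move=> v /h /rch_r.
- move=> x Rx t l E; have [_ [_ h _]] := FO _ Rx; apply: (h x); first exact: rch0.
  by rewrite -a'R.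
- move=> fin fE exf q Fs pc; have [sq [x qx] qR nd HFs] := pc.
  have Rx := qR _ qx; have [_ [_ _ h]] := FO _ Rx.
  apply: (h fin _ exf).
    by move=> y xy; rewrite fE ?(agr _ _ xy) //; apply: rch_r xy.
  apply: (pre_sub pc) => //; [exact: str_con|by exists x|].
  by move=> y qy; apply: rch_mono qR (str_con sq qx qy).
Qed.

Lemma Lab_con a a' t : ext a a' -> Conn a' -> old_labels a a' -> con (Lab a t) ->
  con (Lab a' t).
Proof.
move=> ex cA ol cL.
have toold x : Lab a' t x -> exists y, Lab a t y /\ rch (Lab a' t) x y.
  move=> [l E]; have [y Ey] := ol _ _ E; exists y; split; first by exists l.
  apply: (@rch_mono (fun v => a' v = Some (t, l))) => [v Ev|]; first by exists l.
  by apply: cA => //; apply: ex.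
move=> x y /toold [x' [Lx xx']] /toold [y' [Ly yy']].
apply: rch_trans xx' _; apply: rch_trans (rch_sym yy').
by apply: rch_mono (cL _ _ Lx Ly) => v; apply: ext_Lab.
Qed.

Lemma nodup_NoDup ts : nodup ts -> List.NoDup (tubes ts).
Proof.
elim: ts => [_|p r IH /= [h1 h2]]; first exact: List.NoDup_nil.
apply: List.NoDup_cons; last exact: IH.
move=> h; have [p' [E in']] := (List.in_map_iff _ _ _).1 h; exact: (h1 _ in' E).
Qed.

Lemma nodup_cat a b : nodup (a ++ b) <-> [/\ nodup a, nodup b &
  forall p p', List.In p a -> List.In p' b -> p'.1 <> p.1].
Proof.
elim: a => [|p a IH] /=; first by split=> [h|[]].
rewrite IH; split=> [[h1 [h2 h3 h4]]|[[h1 h2] h3 h4]].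
  split=> // [|q q' [<-|h] h']; last exact: h4.
    by split=> // p' h; apply: h1; apply: List.in_or_app; left.
  by apply: h1; apply: List.in_or_app; right.
split; last by split=> // q q' h; apply: h4; right.
move=> p' h; case: (List.in_app_or _ _ _ h) => [/h1//|h']; apply: h4 => //; by left.
Qed.

Lemma In_cat (T : Type) (x : T) a b : List.In x (a ++ b) <-> List.In x a \/ List.In x b.
Proof. exact: List.in_app_iff. Qed.

Lemma In_tubes t ts : List.In t (tubes ts) <-> exists n, List.In (t, n) ts.
Proof.
split=> [h|[n h]]; last by apply: (List.in_map fst _ (t, n)).
by have [[t' n] [/= <- h']] := (List.in_map_iff _ _ _).1 h; exists n.
Qed.

Lemma tubes_bump c ts : tubes (bump c ts) = tubes ts.
Proof. by elim: ts c => [//|[t n] r IH] c /=; rewrite IH. Qed.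

(** The tube s has lost contact with X and is dropped. Beforehand the tubes younger than s absorb
    every string piece of X in contact with them; older tubes are not charged. *)
Lemma Out_type2 X ts asg : Inv X ts asg ->
  (forall X' ts' asg', sub X' X -> size ts' < size ts -> Inv X' ts' asg' ->
     exists asg'', Out X' (tubes ts') asg' asg'') ->
  (exists p, List.In p ts /\ forall x y, X x -> e x y -> ~ Lab asg p.1 y) ->
  exists asg', Out X (tubes ts) asg asg'.
Proof.
move=> [[cX nX XN] [ndts sz cbts tIs] cA dA [tsP tsadj bnd]] IH [s [sin nadj]].
have [pre [J tsE]] := List.in_split _ _ sin; rewrite -[(_ ++ _)%list]/(pre ++ s :: J) in tsE.
have [ndpre ndsJ ndpJ] : [/\ nodup pre, nodup (s :: J) &
    forall p p', List.In p pre -> List.In p' (s :: J) -> p'.1 <> p.1].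
  by apply/nodup_cat; rewrite -tsE.
have [nds ndJ] := ndsJ.
have Jts p : List.In p J -> List.In p ts.
  by move=> h; rewrite tsE In_cat; right; right.
have prets p : List.In p pre -> List.In p ts.
  by move=> h; rewrite tsE In_cat; left.
have tsC p : List.In p ts -> [\/ List.In p pre, p = s | List.In p J].
  by rewrite tsE In_cat => -[h|[h|h]]; [constructor 1|constructor 2|constructor 3].
have [cbp [cbs cbJ]] : cb 0 pre /\ cb (size pre) (s :: J).
  by move: cbts; rewrite tsE cb_cat add0n.
have cbJ' : cb (size pre) (bump 4 J).
  by apply: cb_bump cbJ; have := expn_gt0 3 (size pre); lia.
pose Y y := [/\ str y, sub y X & exists p, List.In p J /\ contact asg y p.1].
have [|||||a1 [[ex1 cA1 ol1 tI1] [nw1 cov1]]] :=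
  @resolve (size J) J Y asg (erefl _) ndJ.
- by move=> p /Jts /tsP [].
- by [].
- by move=> p /Jts /tIs.
- by move=> p; apply: cb_le cbJ'.
- move=> y [sy yX ct]; split=> //; first by move=> x /yX /XN.
  by move=> p /Jts /tsP [_ h _ _] x /yX /h.
- pose ts1 := pre ++ bump 4 J.
  have ts1C p : List.In p ts1 -> List.In p pre \/ List.In p (bump 4 J).
    by rewrite In_cat.
  have ts1ts p : List.In p ts1 -> exists n, List.In (p.1, n) ts.
    move=> /ts1C [/prets h|/bump_InV [n [/Jts h _]]]; last by exists n.
    by exists p.2; case: (p) h.
  have Jts1 p : List.In p J -> exists n, List.In (p.1, n) ts1.
    by move=> /(bump_In 4) [n h]; exists n; rewrite In_cat; right.
  have prets1 p : List.In p pre -> exists n, List.In (p.1, n) ts1.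
    by move=> h; exists p.2; rewrite In_cat; left; case: (p) h.
  have tsts1 p : List.In p ts -> p.1 <> s.1 -> exists n, List.In (p.1, n) ts1.
    by move=> /tsC [/prets1//|->//|/Jts1].
  have ts1s p : List.In p ts1 -> p.1 <> s.1.
    move=> /ts1C [h|/bump_InV [n [/nds//]]].
    by move=> E; apply: (ndpJ p s h) => //; left.
  have a1X x : asg x = None -> a1 x <> None -> X x.
    by move=> E /(nw1 _ E) [[y [[_ yX _] yx]] _]; apply: yX.
  have dA1 : Dm a1.
    move=> t x [l E]; case E0 : (asg x) => [tl|].
      by apply: dA; exists l; rewrite E0 -E; apply/esym/ex1.
    have [|[y [[_ yX _] yx]] [p [pJ [l' L]]]] := nw1 _ E0; first by rewrite E.
    have [_ h _ _] := tsP _ (Jts _ pJ); move: L; rewrite E => -[-> _].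
    exact/h/yX.
  pose Rg x := X x /\ a1 x = None.
  have tI1s : TIs a1 ts1.
    move=> p /ts1C [h|h]; last exact: tI1.
    apply: TIn_other ex1 (tIs _ (prets _ h)) _ => x E E1 [l L].
    have [_ [p' [pJ [l' L']]]] := nw1 _ E E1.
    by apply: (ndpJ p p' h); [right|move: L; rewrite L' => -[]].
  have InvC x : Rg x -> Inv (rch Rg x) ts1 a1.
    move=> Rx; split=> //.
    + split; [exact: rch_con|by exists x; apply: rch0|].
      by move=> v /rch_r [].
    + split=> //.
      * apply/nodup_cat; split=> //; first exact: nodup_bump.
        by move=> p p' h /bump_InV [n [h' _]]; apply: (ndpJ p (p'.1, n)) => //; right.
      * move: sz; rewrite tsE /ts1 !size_cat size_bump /=; lia.
      * by apply/cb_cat; rewrite add0n.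
    + split.
      * move=> p /ts1ts [n pn]; have [h1 h2 h3 h4] := tsP _ pn; split=> //.
        - by move=> v /rch_r [/h2].
        - by case: h3 => v Lv; exists v; apply: ext_Lab ex1 Lv.
        - exact: Lab_con ex1 cA1 ol1 h4.
      * move=> p p' /ts1ts [n pn] /ts1ts [n' pn'] neq.
        have [u [v [Lu Lv uv]]] := tsadj _ _ pn pn' neq.
        by exists u, v; split=> //; apply: ext_Lab ex1 _.
      * move=> u v xu uv nxv; have [Xv|nXv] := EM (X v).
          have E1 : a1 v <> None.
            by move=> E1; apply: nxv; apply: rchS xu uv _.
          have [_ [p [/Jts1 [n h] L]]] := nw1 _ (XN _ Xv) E1.
          by exists (p.1, n).
        have Xu : X u by have [] := rch_r xu.
        have [p [pin L]] := bnd _ _ Xu uv nXv.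
        have [E|ns] := EM (p.1 = s.1); first by rewrite E in L; case: (nadj _ _ Xu uv).
        by have [n h] := tsts1 _ pin ns; exists (p.1, n); split=> //; apply: ext_Lab ex1 L.
  have [||a2 [[ex2 N2 al2 cA2 dA2] [lab2 G2 cl2]]] :=
      @Out_comps Rg (tubes ts1) a1 cA1 dA1.
  + by move=> x [].
  + move=> x Rx; apply: IH; [by move=> v /rch_r []| |exact: InvC].
    by rewrite /ts1 tsE !size_cat size_bump /= addnS.
  have ex02 := ext_trans ex1 ex2.
  have a2ne x : X x -> a2 x <> None.
    move=> Xx; have [R|nR] := EM (Rg x); first exact: al2.
    by rewrite N2 // => E; apply: nR.
  have a1new x : X x -> ~ Rg x -> exists p, [/\ List.In p J, Lab a1 p.1 x & Lab a2 p.1 x].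
    move=> Xx nR; have [|_ [p [pJ L]]] := nw1 _ (XN _ Xx).
      by move=> E; apply: nR.
    by exists p; split=> //; apply: ext_Lab ex2 L.
  have lab x t l : X x -> a2 x = Some (t, l) ->
      (List.In t (tubes ts1) /\ exists y, asg y = Some (t, l)) \/ sub (dom t) Rg.
    move=> Xx E; have [R|nR] := EM (Rg x).
      have [[tin [y Ey]]|h] := lab2 _ _ _ R E; [left|by right].
      by split=> //; apply: (ol1 y).
    have [p [pJ [l' L] _]] := a1new _ Xx nR; left.
    have E' : a1 x = Some (t, l) by rewrite -N2.
    split; last exact: (ol1 x).
    move: L; rewrite E' => -[-> _]; apply/In_tubes; exact: Jts1.
  exists a2; split; split=> //.
  + move=> x nX'; rewrite N2 => [|[]//].
    case E : (asg x) => [tl|]; first exact: ex1.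
    by apply: contrapT => /(a1X _ E).
  + move=> x t l Xx E; have [[/In_tubes [n /ts1ts [n' h]] ol]|h] := lab _ _ _ Xx E.
      by left; split=> //; apply/In_tubes; exists n'.
    by right=> v /h [].
  + move=> x Xx; have [R|nR] := EM (Rg x); first exact: G2.
    move=> t l; rewrite N2 // => E; have [p [pJ [l' L] _]] := a1new _ Xx nR.
    have [n hn] := bump_In 4 pJ.
    move: L; rewrite E => -[tE _]; subst t; split; first by have [] := tsP _ (Jts _ pJ).
    have nN : n <= N by apply: (cb_le cbJ' hn).
    exact: (TIn_mono nN (tI1 _ hn) E).
  + move=> fin fE exf.
    have exf1 : ext a1 fin.
      move=> v tl E; have [Xv|nXv] := EM (X v); first by rewrite fE //; apply: ex2.
      apply: exf; case E0 : (asg v) => [tl'|].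
        by rewrite -E; apply/esym/ex1.
      by case: nXv; apply: (a1X _ E0); rewrite E.
    apply: claim_listed => //.
    * by rewrite /tubes size_map.
    * exact: nodup_NoDup.
    * by move=> t /In_tubes [n /tsP []].
    move=> q Fs pc av; have [sq nq qX nd HF] := pc.
    have tubesJ p : List.In p J -> List.In p.1 (tubes ts).
      by move=> h; apply/In_tubes; exists p.2; case: (p) (Jts _ h).
    have qR : sub q Rg.
      move=> x qx; apply: contrapT => nR.
      have [p [pJ [l L] _]] := a1new _ (qX _ qx) nR.
      by apply: (av _ (tubesJ _ pJ) x qx); exists l; apply: exf1.
    have sX x : X x -> ~ Lab fin s.1 x.
      move=> Xx [l]; rewrite fE // => E.
      have [[/In_tubes [n /ts1s]//]|h] := lab _ _ _ Xx E.
      have [_ _ [v Lv] _] := tsP _ sin; have [Xv _] := h _ (dA _ _ Lv).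
      by case: Lv => lv; rewrite XN.
    (* If s were listed, the witness string qh would run from q out of X. The first tube it enters
       is not older than s by [Near], not s itself, which does not touch X, and not younger, since
       then the piece around q would have been absorbed. *)
    have sF : ~ List.In s.1 Fs.
      move=> /HF [_ _ [qh [sh qqh [z [qz Lz]] bf]]]; have [x qx] := nq.
      have nXz : ~ X z by move=> /sX.
      have [u [v [xu uv qv nXv]]] := con_exit (str_con sh) (qqh _ qx) (qX _ qx) qz nXz.
      have Xu := (rch_r xu).2.
      have [p [pin L]] := bnd _ _ Xu uv nXv.
      have Lf := ext_Lab exf L.
      case: (tsC _ pin) => [pp|E|pJ].
      * apply: (bf p.1 _ v qv Lf); exists (tubes pre), (tubes J); split.
          by rewrite tsE /tubes map_cat.
        by apply: List.in_map.
      * by rewrite E in L; apply: (nadj _ _ Xu uv L).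
      * pose y := rch (fun z => qh z /\ X z) x.
        have yY : Y y.
          have yq : sub y qh by move=> w /rch_r [].
          split.
          - by apply: (str_sub sh yq); apply: rch_con.
          - by move=> w /rch_r [].
          - exists p; split=> //; exists u, v; split=> //.
            apply: (str_sub sh); first by move=> w [/yq|->].
            by apply: (con_add _ xu uv); apply: rch_con.
        have yx : y x by apply: rch0; split; [apply: qqh|apply: qX].
        exact: (cov1 _ _ yY yx (qR _ qx).2).
    apply: cl2 => //.
      by move=> x [Xx E]; apply: fE.
    split=> // t tF; have [tin aq [qh [sh qqh hit bf]]] := HF _ tF; split=> //.
      have [n tn] := (In_tubes _ _).1 tin; apply/In_tubes; apply: (tsts1 _ tn).
      by move=> /= E; rewrite E in tF.
    exists qh; split=> // t' [l1 [l2 [LE inl]]]; apply: bf.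
    have LE0 : tubes pre ++ tubes J = l1 ++ t :: l2.
      by rewrite -LE /ts1 /tubes map_cat -!/(tubes _) tubes_bump.
    rewrite /before tsE /tubes map_cat -!/(tubes _) /=.
    elim: (tubes pre) l1 LE0 inl {LE} => [|a pr IHp] [|b l1] //=.
      by move=> E h; exists (s.1 :: b :: l1), l2; split; [rewrite /tubes /= -/(tubes J) E|right].
    move=> [<- E] [->|h].
      have [l1' [l2' E']] : exists l1' l2', pr ++ s.1 :: tubes J = l1' ++ t :: l2'.
        have : List.In t (pr ++ s.1 :: tubes J).
          have : List.In t (pr ++ tubes J) by rewrite E In_cat; right; left.
          by rewrite !In_cat => -[h|h]; [left|right; right].
        by move=> h; have [l1' [l2' E']] := List.in_split _ _ h; exists l1', l2'.
      by exists (t' :: l1'), l2'; split; [rewrite /= -E'|left].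
    have [l1' [l2' [E' h']]] := IHp _ E h.
    by exists (a :: l1'), l2'; split; [rewrite /= -E'|right].
Qed.

(** If four tubes all touched X, they and X would be five connected, pairwise adjacent sets. So
    there are at most three, and a tripod has enough tips to touch them all; the new tube can then
    join the list. *)
Lemma Out_type1 X ts asg : Inv X ts asg ->
  (forall X' ts' asg', sub X' X -> msr X' < msr X -> size ts' <= 4 ->
     Inv X' ts' asg' -> exists asg'', Out X' (tubes ts') asg' asg'') ->
  (forall p, List.In p ts -> exists x y, [/\ X x, e x y & Lab asg p.1 y]) ->
  exists asg', Out X (tubes ts) asg asg'.
Proof.
move=> [[cX nX XN] [ndts sz cbts tIs] cA dA [tsP tsadj bnd]] IH adj.
have [x0 X0] := nX.
have sz3 : size ts <= 3.
  rewrite leqNgt; apply/negP => sz4.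
  have sz4' : size ts = 4 by lia.
  case: ts ndts tsP tsadj adj sz4' {sz sz4 cbts tIs bnd IH} =>
    [|p0 [|p1 [|p2 [|p3 [|p4 ts]]]]] //= nd tsP tsadj adj _.
  have [n0 [n1 [n2 _]]] := nd.
  pose T i := match i with 0 => p0 | 1 => p1 | 2 => p2 | _ => p3 end.
  have Tin i : i < 4 -> p0 = T i \/ p1 = T i \/ p2 = T i \/ p3 = T i \/ False.
    by case: i => [|[|[|[|i]]]] //= _; tauto.
  have Tneq i j : i < j -> j < 4 -> (T i).1 <> (T j).1.
    have n01 : p1.1 <> p0.1 by apply: n0; tauto.
    have n02 : p2.1 <> p0.1 by apply: n0; tauto.
    have n03 : p3.1 <> p0.1 by apply: n0; tauto.
    have n12 : p2.1 <> p1.1 by apply: n1; tauto.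
    have n13 : p3.1 <> p1.1 by apply: n1; tauto.
    have n23 : p3.1 <> p2.1 by apply: n2; tauto.
    by case: i => [|[|[|[|i]]]]; case: j => [|[|[|[|j]]]] //= _ _ /esym.
  have nXL i x : X x -> ~ Lab asg (T i).1 x by move=> /XN h [l]; rewrite h.
  apply: (noK5 (F := fun i => if i < 4 then Lab asg (T i).1 else X)).
  - move=> i _; case: ifP => // h; by have [] := tsP _ (Tin _ h).
  - move=> i _; case: ifP => // h; by have [] := tsP _ (Tin _ h).
  - move=> i j x hi hj; case: ifP => hi4; case: ifP => hj4.
    + move=> [l Ei] [l' Ej]; move: Ej; rewrite Ei => -[E _].
      by case: (ltngtP i j) => // h; [case: (Tneq i j)|case: (Tneq j i)].
    + by move=> L h; case: (nXL _ _ h L).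
    + by move=> h L; case: (nXL _ _ h L).
    + lia.
  - move=> i j ij hj; have i4 : i < 4 by lia.
    rewrite i4; case: ifP => hj4; first by apply: tsadj; [exact: Tin|exact: Tin|exact: Tneq].
    have [x [y [Xx xy Ly]]] := adj _ (Tin _ i4).
    by exists y, x; split=> //; apply: e_sym.
(* One attaching cell for each surrounding tube; x0 pads the triple when there are fewer than
   three. *)
have [x1 [x2 [x3 [X1 X2 X3 xadj]]]] : exists x1 x2 x3, [/\ X x1, X x2, X x3 &
    forall p, List.In p ts -> exists x y, [/\ x = x1 \/ x = x2 \/ x = x3,
      e x y & Lab asg p.1 y]].
  case: ts adj sz3 {ndts tsP tsadj sz cbts tIs bnd IH} =>
      [|p0 [|p1 [|p2 [|p3 ts]]]] //= adj _.
  - by exists x0, x0, x0; split.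
  - have [x [y [Xx xy L]]] := adj p0 (or_introl (erefl _)).
    by exists x, x0, x0; split=> // p [<-|//]; exists x, y; split=> //; left.
  - have [x [y [Xx xy L]]] := adj p0 (or_introl (erefl _)).
    have [x' [y' [Xx' xy' L']]] := adj p1 (or_intror (or_introl (erefl _))).
    exists x, x', x0; split=> // p [<-|[<-|//]]; first by exists x, y; split=> //; left.
    by exists x', y'; split=> //; right; left.
  - have [x [y [Xx xy L]]] := adj p0 (or_introl (erefl _)).
    have [x' [y' [Xx' xy' L']]] := adj p1 (or_intror (or_introl (erefl _))).
    have [x'' [y'' [Xx'' xy'' L'']]] := adj p2 (or_intror (or_intror (or_introl (erefl _)))).
    exists x, x', x''; split=> // p [<-|[<-|[<-|//]]].
    + by exists x, y; split=> //; left.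
    + by exists x', y'; split=> //; right; left.
    + by exists x'', y''; split=> //; right; right.
have [t0 [wf0 dom0 sk0]] := tube_exists cX X1 X2 X3.
have fr x : ~ Lab asg t0 x.
  move=> L; have := dA _ _ L; rewrite dom0 => /XN E; by case: L => l; rewrite E.
have [||a1 [[ex1 cA1 tI1 con1] [nw1 sk1]]] := tube_init cA wf0 _ fr.
- by rewrite dom0.
- lia.
rewrite dom0 in nw1.
have a1X x : asg x = None -> a1 x <> None -> X x by move=> E /(nw1 _ E) [].
have x1L : Lab a1 t0 x1.
  by have [|a [va <-]] := sk0 x1; [left|apply: sk1].
have t0ts p : List.In p ts -> p.1 <> t0.
  by move=> /tsP [_ _ [v Lv] _] E; rewrite E in Lv; case: (fr v).
have dA1 : Dm a1.
  move=> t x [l E]; case E0 : (asg x) => [tl|].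
    by apply: dA; exists l; rewrite E0 -E; apply/esym/ex1.
  have [|Xx [l' L]] := nw1 _ E0; first by rewrite E.
  by move: L; rewrite E => -[-> _]; rewrite dom0.
have a1ts p x : List.In p ts -> Lab a1 p.1 x -> Lab asg p.1 x.
  move=> pin [l E]; case E0 : (asg x) => [tl|].
    by exists l; rewrite E0 -E; apply/esym/ex1.
  have [|_ [l' L]] := nw1 _ E0; first by rewrite E.
  by move: L; rewrite E => -[/(t0ts _ pin)].
pose ts1 := ts ++ [:: (t0, 1)].
have ts1C p : List.In p ts1 -> List.In p ts \/ p = (t0, 1).
  by rewrite In_cat => -[h|[h|//]]; [left|right].
have tsts1 p : List.In p ts -> List.In p ts1 by move=> h; rewrite In_cat; left.
have t0ts1 : List.In (t0, 1) ts1 by rewrite In_cat; right; left.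
have con_ts p : List.In p ts -> con (Lab a1 p.1).
  move=> h x y /(a1ts _ _ h) Lx /(a1ts _ _ h) Ly; have [_ _ _ c] := tsP _ h.
  by apply: rch_mono (c _ _ Lx Ly) => v; apply: ext_Lab.
have adj0 p : List.In p ts -> exists x y, [/\ Lab a1 p.1 x, Lab a1 t0 y & e x y].
  move=> /xadj [x [y [h xy L]]]; exists y, x; split; last exact: e_sym.
    exact: ext_Lab ex1 L.
  by have [a [va <-]] := sk0 _ h; apply: sk1.
pose Rg x := X x /\ a1 x = None.
have InvC x : Rg x -> Inv (rch Rg x) ts1 a1.
  move=> Rx; split=> //.
  + split; [exact: rch_con|by exists x; apply: rch0|].
    by move=> v /rch_r [].
  + split.
    * apply/nodup_cat; split=> //=.
      by move=> p p' /t0ts h [<-|//] /= E; apply: h.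
    * by rewrite /ts1 size_cat /= addn1.
    * apply/cb_cat; split=> //=; split=> //.
      have : 3 ^ (0 + size ts) <= 3 ^ 3 by rewrite leq_exp2l.
      rewrite -[3 ^ 3]/27; lia.
    * move=> p /ts1C [h|->//].
      apply: TIn_other ex1 (tIs _ h) _ => v E E1 [l L].
      have [_ [l' L']] := nw1 _ E E1.
      by apply: (t0ts p h); move: L; rewrite L' => -[].
  + split.
    * move=> p /ts1C [h|->].
        have [h1 h2 h3 h4] := tsP _ h; split=> //.
        - by move=> v /rch_r [/h2].
        - by case: h3 => v Lv; exists v; apply: ext_Lab ex1 Lv.
        - exact: con_ts.
      split=> //; last by exists x1.
      by rewrite dom0 => v /rch_r [].
    * move=> p p' /ts1C [h|->] /ts1C [h'|->] neq //.
      - have [u [v [Lu Lv uv]]] := tsadj _ _ h h' neq.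
        by exists u, v; split=> //; apply: ext_Lab ex1 _.
      - exact: adj0.
      - have [u [v [Lu Lv uv]]] := adj0 _ h'.
        by exists v, u; split=> //; apply: e_sym.
    * move=> u v xu uv nxv; have [Xv|nXv] := EM (X v).
        have E1 : a1 v <> None.
          by move=> E1; apply: nxv; apply: rchS xu uv _.
        by have [_ L] := nw1 _ (XN _ Xv) E1; exists (t0, 1).
      have Xu : X u by have [] := rch_r xu.
      have [p [pin L]] := bnd _ _ Xu uv nXv.
      by exists p; split; [exact: tsts1|apply: ext_Lab ex1 L].
have [||a2 [[ex2 N2 al2 cA2 dA2] [lab2 G2 cl2]]] :=
    @Out_comps Rg (tubes ts1) a1 cA1 dA1.
- by move=> x [].
- move=> x Rx; apply: IH; [by move=> v /rch_r []| | |exact: InvC].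
    apply: (msr_lt (x := x1)) => [v /rch_r []//|//|/rch_r [_ E]].
    by case: x1L => l; rewrite E.
  by rewrite /ts1 size_cat /= addn1.
have ex02 := ext_trans ex1 ex2.
have a1new x : X x -> ~ Rg x -> Lab a1 t0 x.
  move=> Xx nR; have [|_ //] := nw1 _ (XN _ Xx).
  by move=> E; apply: nR.
exists a2; split; split=> //.
- move=> x nX'; rewrite N2 => [|[]//].
  case E : (asg x) => [tl|]; first exact: ex1.
  by apply: contrapT => /(a1X _ E).
- move=> x Xx; have [R|nR] := EM (Rg x); first exact: al2.
  by rewrite N2 // => E; apply: nR.
- move=> x t l Xx E; have [R|nR] := EM (Rg x); last first.
    have [l' L] := a1new _ Xx nR; rewrite N2 // in E.
    by right; move: L; rewrite E => -[-> _]; rewrite dom0.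
  have [[tin [y Ey]]|h] := lab2 _ _ _ R E; last by right=> v /h [].
  have [n /ts1C [tn|tn]] := (In_tubes _ _).1 tin.
    left; split; first by apply/In_tubes; exists n.
    have [l' L'] : Lab asg t y by apply: (a1ts _ _ tn); exists l.
    by exists y; rewrite L'; have := ex1 _ _ L'; rewrite Ey => ->.
  by right; case: tn => -> _; rewrite dom0.
- move=> x Xx; have [R|nR] := EM (Rg x); first exact: G2.
  move=> t l; rewrite N2 // => E; have [l' L] := a1new _ Xx nR.
  move: L; rewrite E => -[tE _]; subst t; split=> //.
  by apply: (TIn_mono _ tI1 E); lia.
- move=> fin fE exf.
  have exf1 : ext a1 fin.
    move=> v tl E; have [Xv|nXv] := EM (X v); first by rewrite fE //; apply: ex2.
    apply: exf; case E0 : (asg v) => [tl'|].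
      by rewrite -E; apply/esym/ex1.
    by case: nXv; apply: (a1X _ E0); rewrite E.
  apply: claim_listed => //.
  + by rewrite /tubes size_map.
  + exact: nodup_NoDup.
  + by move=> t /In_tubes [n /tsP []].
  move=> q Fs pc av; have [sq nq qX nd HF] := pc.
  have nR0 w : sub w X -> avoid fin t0 w -> sub w Rg.
    move=> wX aw x wx; apply: contrapT => nR.
    by apply: (aw x wx); apply: ext_Lab exf1 (a1new _ (wX _ wx) nR).
  have tE : tubes ts1 = tubes ts ++ [:: t0] by rewrite /tubes map_cat.
  have ndts1 : List.NoDup (tubes ts1).
    apply: nodup_NoDup; apply/nodup_cat; split=> //=.
    by move=> p p' /t0ts h [<-|//] /= E; apply: h.
  have t0F : ~ List.In t0 Fs.
    by move=> /HF [/In_tubes [n /t0ts]].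
  have near t w : List.In t (tubes ts) -> Near fin (tubes ts) t w ->
      Near fin (tubes ts1) t w.
    move=> tin [qh [sh wq hit bf]]; exists qh; split=> // t' [l1 [l2 [LE inl]]].
    have [m1 [m2 ME]] := List.in_split _ _ tin.
    apply: bf; exists m1, m2; split=> //.
    rewrite (_ : m1 = l1) //; apply: (@NoDup_split _ _ (m2 ++ [:: t0]) _ l2 t).
      by rewrite -cat_cons catA -[m1 ++ _]ME -tE.
    by rewrite -LE tE ME -cat_cons catA.
  (* A piece met by t0 spends one level of [Dep] on it, and t0 is listed for what remains; q itself
     is the witness for [Near], since it avoids all older tubes. *)
  have [[z [qz Lz]]|nhit] := EM (exists x, q x /\ Lab fin t0 x); last first.
    apply: cl2 => //.
      by move=> x [Xx E]; apply: fE.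
    split=> //.
      by apply: nR0 => // x qx L; apply: nhit; exists x.
    move=> t tF; have [tin aq nr] := HF _ tF; split=> //; last exact: near.
    by rewrite tE In_cat; left.
  have szF : size Fs <= 3.
    apply: leq_trans sz3; rewrite -(size_map fst ts) !size_length.
    by apply/leP; apply: List.NoDup_incl_length => // t /HF [].
  have -> : 4 - size Fs = (4 - size (t0 :: Fs)).+1 by move=> /=; lia.
  exists t0; split; [by rewrite dom0|by exists z|].
  move=> q' cq' nq' q'q aq'.
  have q'X : sub q' X by move=> x /q'q /qX.
  have [sq' _ _ _ HF'] := pre_sub (X' := X) pc cq' nq' q'q q'X.
  apply: cl2 => //.
    by move=> x [Xx E]; apply: fE.
  split=> //; first exact: nR0.
    by constructor.
  move=> t [<-|tF].
    split=> //; first by rewrite tE In_cat; right; left.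
    exists q; split=> //; first by exists z.
    move=> t' [l1 [l2 [LE inl]]]; apply: av.
    rewrite (_ : tubes ts = l1) //; apply: (@NoDup_split _ _ [::] _ l2 t0).
      by rewrite -tE.
    by rewrite -LE tE.
  have [tin aq nr] := HF' _ tF; split=> //; last exact: near.
  by rewrite tE In_cat; left.
Qed.

(** The weight 5 makes the measure drop in both cases: a new tube lowers [msr] and leaves at most
    four tubes, a dropped tube shortens the list. *)
Lemma cop_strategy m : forall X ts asg, 5 * msr X + size ts < m -> Inv X ts asg ->
  exists asg', Out X (tubes ts) asg asg'.
Proof.
elim: m => [//|m IH] X ts asg hm inv.
have [t2|nt2] := EM (exists p, List.In p ts /\
    forall x y, X x -> e x y -> ~ Lab asg p.1 y).
  apply: Out_type2 inv _ t2 => X' ts' a' sX hs; apply: IH.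
  have := msr_le sX; lia.
apply: Out_type1 inv _ _ => [X' ts' a' sX hX hs|p pin].
  by apply: IH; lia.
apply: contrapT => h; apply: nt2; exists p; split=> // x y Xx xy L.
by apply: h; exists x, y.
Qed.

(** * Diameter of clusters and passage of strings *)

Lemma leg_D t g i j : wf t -> i <= j -> j <= len t g ->
  D (dom t) (j - i) (sk t g i) (sk t g j).
Proof.
case=> _ _ w3 _ ij jl; apply: walk_D ij jl => k hk; exact: w3.
Qed.

(** The anchors admitting one label fill a window shorter than 2 * Q on a leg. On different legs the
    label is (0, 0), and both anchors are less than Q from the foot. *)
Lemma class_D asg x y tl : Good asg x -> asg x = Some tl -> asg y = Some tl ->
  Good asg y -> D (fun=> True) (2 * Q + 2 * rho N) x y.
Proof.
case: tl => t l Gx Ex Ey Gy.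
have [wft [a [va Da [A1 A2 A3 A4]]]] := Gx _ _ Ex.
have [_ [a' [va' Da' [A1' A2' A3' A4']]]] := Gy _ _ Ey.
suff h : D (dom t) (2 * Q) (ska t a) (ska t a').
  apply: (@D_sub (dom t)) => //.
  apply: (@D_mono _ (rho N + 2 * Q + rho N)); first lia.
  exact: D_trans (D_trans (D_sym Da) h) Da'.
have [E|E] := EM (a.1 = a'.1).
  rewrite /ska; case: a a' va va' E {Da Da' A1 A1'} A3 A4 A3' A4' => g r [g' r'].
  rewrite /valid /= => h h' E; subst g'; rewrite mulSn => *.
  case: (leqP r r') => rr.
    by apply: D_mono (leg_D wft rr h'); lia.
  by apply: D_sym; apply: D_mono (leg_D wft (ltnW rr) h); lia.
have l0 : l.2 = 0.
  by case: A1 => // E1; case: A1' => // E1'; case: E; rewrite -E1.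
rewrite l0 in A3 A4 A3' A4'.
have [_ w2 _ _] := wft.
have h1 := leg_D wft (leq0n a.2) va; have h2 := leg_D wft (leq0n a'.2) va'.
rewrite w2 in h1; rewrite w2 in h2.
by apply: D_mono (D_trans (D_sym h1) h2); lia.
Qed.

Lemma Acc0 a a' l : Acc sg a l -> dT a a' < sg -> Acc 0 a' l.
Proof.
have Q0 : sg < Q by lia.
move=> [A1 A2 A3 A4]; rewrite /dT; case: eqP => [E|E] dd.
  by split; [rewrite -E; exact: A1|exact: A2|lia|lia].
have l0 : l.2 = 0.
  apply/eqP; rewrite -leqn0 leqNgt; apply/negP => l1; have := QlemA l1; lia.
by split; [left|exact: A2|rewrite l0; lia|rewrite l0; lia].
Qed.

Lemma Acc_inj a l l' : Acc 0 a l -> Acc 0 a l' -> l.2 = l'.2 -> l = l'.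
Proof.
case: l l' => [g r] [g' r'] [/= A1 A2 _ _] [/= A1' A2' _ _] E; subst r'.
congr (_, _); case: A1 => [E|E]; first by rewrite A2 // A2'.
by case: A1' => [E'|E']; [rewrite A2 // A2'|rewrite E E'].
Qed.

(** Windows of labels whose indices differ by two or more are disjoint, so no three distinct indices
    are admissible at one anchor. *)
Lemma two_labels a l1 l2 l3 : Acc 0 a l1 -> Acc 0 a l2 -> Acc 0 a l3 -> l1 <> l2 ->
  l3 = l1 \/ l3 = l2.
Proof.
move=> A1 A2 A3 n12.
have near l l' : Acc 0 a l -> Acc 0 a l' -> l.2 <= l'.2.+1.
  move=> [_ _ _ h1] [_ _ h2 _]; rewrite leqNgt; apply/negP => h.
  have := QlemA h; lia.
have n12' : l1.2 <> l2.2 by move=> E; apply: n12; apply: Acc_inj A1 A2 E.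
have h12 := near _ _ A1 A2; have h21 := near _ _ A2 A1.
have h13 := near _ _ A1 A3; have h31 := near _ _ A3 A1.
have h23 := near _ _ A2 A3; have h32 := near _ _ A3 A2.
have [E|E] : l3.2 = l1.2 \/ l3.2 = l2.2 by lia.
  by left; apply: Acc_inj A3 A1 E.
by right; apply: Acc_inj A3 A2 E.
Qed.

(** The final margin sg exceeds the distance between anchors of cells on one string, so all labels
    seen on q are admissible, with margin 0, at the single anchor of x. *)
Lemma str_labels asg q t x y z lx ly lz : str q -> sub q (dom t) ->
  q x -> q y -> q z -> (forall v, q v -> Good asg v) ->
  asg x = Some (t, lx) -> asg y = Some (t, ly) -> asg z = Some (t, lz) ->
  lx <> ly -> lz = lx \/ lz = ly.
Proof.
move=> sq qd qx qy qz G Ex Ey Ez.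
have bN : bb N = sg by rewrite /bb subnn addn0.
have [wft [a [va Da Aa]]] := G _ qx _ _ Ex; rewrite bN in Aa.
have H v l : q v -> asg v = Some (t, l) -> Acc 0 a l.
  move=> qv Ev; have [_ [a' [va' Da' Aa']]] := G _ qv _ _ Ev; rewrite bN in Aa'.
  apply: Acc0 Aa' _.
  have Dx : D (dom t) (rho N + 1) (ska t a') x.
    by apply: D_trans Da' _; apply: D1; exists q.
  have := dT_close wft va' va Dx Da; rewrite /rho; lia.
by apply: two_labels; [exact: H qx Ex|exact: H qy Ey|exact: H qz Ez].
Qed.

Section Hop.
Variables (T : Type) (cl : V -> T).

(** Distance at most n in the quotient by [cl]: moving inside a class is free. *)
Fixpoint hop n x y := if n is m.+1 then
  exists z v, [/\ hop m x z, z = v \/ e z v & cl v = cl y] else cl x = cl y.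

Lemma hop_cl n x y z : hop n x y -> cl y = cl z -> hop n x z.
Proof.
case: n => [/= -> //|n [u [w [h1 h2 h3]]] E]; exists u, w; split=> //.
by rewrite h3.
Qed.

Lemma hop_mono n m x y : n <= m -> hop n x y -> hop m x y.
Proof.
move=> /subnKC <-; elim: (m - n) => [|k IH] H; first by rewrite addn0.
by rewrite addnS; exists y, y; split; [exact: IH|left|].
Qed.

Lemma hop_trans n m x y z : hop n x y -> hop m y z -> hop (n + m) x z.
Proof.
move=> xy; elim: m z => [z /= E|m IH z [u [w [h1 h2 h3]]]].
  by rewrite addn0; apply: hop_cl E.
by rewrite addnS; exists u, w; split=> //; apply: IH.
Qed.

Lemma hop_edge x y : e x y -> hop 1 x y.
Proof. by move=> xy; exists x, y; split=> //; right. Qed.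

Lemma hop_sym n x y : hop n x y -> hop n y x.
Proof.
elim: n y => [y /= -> //|n IH y [z [w [h1 h2 h3]]]].
rewrite -addn1 addnC; apply: hop_trans (IH _ h1).
case: h2 => [E|h]; first by rewrite E; apply: (@hop_mono 0).
by apply: (@hop_trans 0 1 y w z) => //=; apply: hop_edge; apply: e_sym.
Qed.

End Hop.

(* Number of clusters visited: two of the tube and, at both ends and between
   them, a string exhausted by d tubes. *)
Fixpoint hv d := if d is d'.+1 then 3 * hv d' + 2 else 0.

Lemma hv_gt0 d : 0 < d -> 0 < hv d.
Proof. by case: d => // d _ /=; lia. Qed.

(** From either end the string reaches t in [hv d] hops, and passing between its two labels takes
    one more than that. The total 3 * [hv d] + 1 is one less than the number of clusters visited. *)
Lemma Dep_hop asg d q x y : (forall v, Good asg v) -> str q -> Dep asg d q ->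
  q x -> q y -> hop asg (hv d).-1 x y.
Proof.
move=> G; elim: d q x y => [//|d IH] q x y sq [t [qd [z0 [qz0 L0]] Hq]] qx qy.
pose W z := q z /\ ~ Lab asg t z.
have cp z : W z -> 0 < hv d /\ forall u v, rch W z u -> rch W z v ->
    hop asg (hv d).-1 u v.
  move=> Wz; have sw : sub (rch W z) q by move=> v /rch_r [].
  have dep : Dep asg d (rch W z).
    apply: Hq => //; [exact: rch_con|by exists z; apply: rch0|].
    by move=> v /rch_r [].
  split; first by apply: hv_gt0; case: (d) dep.
  by move=> u v; apply: IH dep; apply: (str_sub sq sw); apply: rch_con.
have tot z : q z -> exists v, [/\ q v, Lab asg t v & hop asg (hv d) z v].
  move=> qz; have [L|nL] := EM (Lab asg t z).
    by exists z; split=> //; apply: (@hop_mono _ _ 0).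
  have Wz : W z by [].
  have nz0 : ~ rch W z z0 by move=> /rch_r [].
  have [u [v [zu uv qv nzv]]] := con_exit (B := rch W z) (str_con sq) qz (rch0 Wz) qz0 nz0.
  have zu' := (rch_r zu).2; have [h0 hh] := cp _ Wz; exists v; split=> //.
    apply: contrapT => nLv; apply: nzv; apply: rchS zu' uv _; by split.
  rewrite -(prednK h0) -addn1; apply: hop_trans (hop_edge _ uv).
  by apply: hh => //; apply: rch0.
have [v [qv Lv hx]] := tot _ qx; have [v' [qv' Lv' hy]] := tot _ qy.
suff h : hop asg (hv d).+1 v v'.
  apply: (@hop_mono _ _ (hv d + (hv d).+1 + hv d)); first by move=> /=; lia.
  exact: hop_trans (hop_trans hx h) (hop_sym hy).
have [l Ev] := Lv; have [l' Ev'] := Lv'.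
have [E|ll] := EM (l = l').
  by apply: (@hop_mono _ _ 0) => //=; rewrite Ev Ev' E.
(* The cells labelled l, with all components of q outside t that touch them. Where q leaves B it
   enters a cell of t with a label other than l, which can only be l'; the crossing uses one
   component at most. *)
pose B z := asg z = Some (t, l) \/ (W z /\
  exists u u', [/\ rch W z u, e u u' & asg u' = Some (t, l)]).
have Bv : B v by left.
have nBv' : ~ B v'.
  by case=> [|[[_ nL] _]]; [rewrite Ev' => -[]/esym|apply: nL; exists l'].
have [u [w [vu uw qw nBw]]] := con_exit (str_con sq) qv Bv qv' nBv'.
have [qu Bu] := rch_r vu.
have Lw : Lab asg t w.
  apply: contrapT => nLw; apply: nBw; right; split=> //.
  have Ww : W w by [].
  case: Bu => [Eu|[Wu [u1 [u2 [uu1 u12 E2]]]]].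
    by exists w, u; split=> //; [apply: rch0|apply: e_sym].
  exists u1, u2; split=> //; apply: rch_trans uu1.
  by apply: rchS (e_sym uw) Wu; apply: rch0.
have [lw Ew] := Lw.
have lwE : lw = l'.
  have [E|//] := str_labels sq qd qv qv' qw (fun z _ => G z) Ev Ev' Ew ll.
  by case: nBw; left; rewrite Ew E.
have wv' : asg w = asg v' by rewrite Ew Ev' lwE.
apply: hop_cl wv'.
case: Bu => [Eu|[Wu [u1 [u2 [uu1 u12 E2]]]]].
  apply: (@hop_mono _ _ 1) => //; apply: (@hop_trans _ _ 0 1 _ u) => /=.
    by rewrite Ev Eu.
  exact: hop_edge.
have [h0 hh] := cp _ Wu.
have -> : (hv d).+1 = 1 + (hv d).-1 + 1 by lia.
apply: hop_trans (hop_edge _ uw).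
apply: (@hop_trans _ _ 1 _ _ u1); last by apply: hh => //; apply: rch0.
apply: (@hop_trans _ _ 0 1 _ u2) => /=; first by rewrite Ev E2.
by apply: hop_edge; apply: e_sym.
Qed.

(** The partition is encoded by an idempotent choice of representatives. At the start nothing
    surrounds and nothing is listed, so the depth is 4 and 79 = [(hv 4).-1]. *)
Theorem clustering (x0 : V) : exists r : V -> V,
  [/\ forall x, r (r x) = r x,
      forall x y, r x = r y -> rch (fun z => r z = r x) x y,
      forall x y, r x = r y -> D (fun=> True) (2 * Q + 2 * rho N) x y &
      forall q x y, str q -> q x -> q y -> hop r 79 x y].
Proof.
have [||||asg [[_ _ al cA _] [_ G cl]]] :=
  @Out_comps (fun=> True) [::] (fun=> None).
- by [].
- by move=> t x [].
- by [].
- move=> x _; apply: (cop_strategy (ts := [::]) (ltnSn _)); split.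
  + by split; [exact: rch_con|exists x; exact: rch0|].
  + by split.
  + by [].
  + by move=> t y [].
  + by split=> // u v xu uv nxv; case: nxv; apply: rchS xu uv _.
have lab x : exists tl, asg x = Some tl.
  by case E : (asg x) => [tl|]; [exists tl|case: (al x)].
pose pk (o : option (tube * lbl)) :=
  if pselect (exists z, asg z = o) is left h then projT1 (cid h) else x0.
pose r x := pk (asg x).
have rE x : asg (r x) = asg x.
  by rewrite /r /pk; case: pselect => [h|[]]; [case: cid|exists x].
have rr x y : r x = r y -> asg x = asg y by move=> h; rewrite -rE h rE.
have rr' x y : asg x = asg y -> r x = r y by rewrite /r => ->.
exists r; split.
- by move=> x; apply: rr'.
- move=> x y /rr E; have [tl Ex] := lab x.
  have Ey : asg y = Some tl by rewrite -E.
  by apply: rch_mono (cA _ _ _ Ex Ey) => z Ez; apply: rr'; rewrite Ez.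
- move=> x y /rr E; have [tl Ex] := lab x.
  by apply: (class_D (G x I) Ex _ (G y I)); rewrite -E.
- move=> q x y sq qx qy.
  have dep : Dep asg 4 q.
    apply: (cl asg _ _ q [::]) => //; split=> //; [by exists x|exact: List.NoDup_nil].
  have : hop asg 79 x y by apply: (@Dep_hop asg 4 q) => // v; apply: G.
  elim: (79) (y) => [y1 /= /rr'//|n IH y1 [z [v [h1 h2 h3]]]].
  by exists z, v; split=> //; [exact: IH|exact: rr'].
Qed.

End Reach.

(** * The grid has no K5 minor *)

Section GridK5.
Local Notation cell := (nat * nat)%type.

Definition g4 (u v : cell) : bool :=
  (u.1 == v.1) && ((u.2.+1 == v.2) || (v.2.+1 == u.2)) ||
  (u.2 == v.2) && ((u.1.+1 == v.1) || (v.1.+1 == u.1)).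

Local Notation step := (cell * cell)%type.
Implicit Types (s : step) (S : seq step) (f : cell -> bool).

Definition okc S := all (fun s => g4 s.1 s.2) S.
Definition xsum S (F : step -> bool) := \big[addb/false]_(s <- S) F s.
(** The mod 2 boundary of S paired with the function f; S is a cycle when this vanishes for every
    f. *)
Definition bd f S := xsum S (fun s => f s.1 (+) f s.2).
Definition hor s := s.1.2 == s.2.2.
Definition lo s : cell := (minn s.1.1 s.2.1, minn s.1.2 s.2.2).
Definition hi s : cell := (maxn s.1.1 s.2.1, maxn s.1.2 s.2.2).

(* [x1 s s'] tells whether the edge s crosses the edge s' shifted by (1/2, 1/2);
   two crossing edges then share the lattice point [lo s = hi s']. *)
Definition x1 s s' := (hor s != hor s') && (lo s == hi s').
Definition X S S' := xsum S (fun s => xsum S' (x1 s)).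

Lemma xsum_cat S S' F : xsum (S ++ S') F = xsum S F (+) xsum S' F.
Proof. by rewrite /xsum big_cat. Qed.

Lemma xsum_add S F G : xsum S (fun s => F s (+) G s) = xsum S F (+) xsum S G.
Proof. by rewrite /xsum big_split. Qed.

Lemma xsum_ex S S' (F : step -> step -> bool) :
  xsum S (fun s => xsum S' (F s)) = xsum S' (fun s' => xsum S (F^~ s')).
Proof. by rewrite /xsum exchange_big. Qed.

Lemma eq_xsum S F G : okc S -> (forall s, g4 s.1 s.2 -> F s = G s) ->
  xsum S F = xsum S G.
Proof.
move=> ok FG; rewrite /xsum !big_seq; apply: eq_bigr => s sS.
by apply: FG; apply: (allP ok).
Qed.

Lemma X_catl S1 S2 S : X (S1 ++ S2) S = X S1 S (+) X S2 S.
Proof. exact: xsum_cat. Qed.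

Lemma X_catr S S1 S2 : X S (S1 ++ S2) = X S S1 (+) X S S2.
Proof. by rewrite /X -xsum_add; apply: eq_bigr => s _; rewrite xsum_cat. Qed.

Lemma g4_ind (P : step -> Prop) : (forall x y, P ((x, y), (x.+1, y))) ->
  (forall x y, P ((x.+1, y), (x, y))) -> (forall x y, P ((x, y), (x, y.+1))) ->
  (forall x y, P ((x, y.+1), (x, y))) -> forall s, g4 s.1 s.2 -> P s.
Proof.
move=> h1 h2 h3 h4 [[a b] [c d]]; rewrite /g4 /=.
by case/orP=> /andP [/eqP <-] /orP[] /eqP <-.
Qed.

Lemma bd_cat f S S' : bd f (S ++ S') = bd f S (+) bd f S'.
Proof. exact: xsum_cat. Qed.

(** The parity [phi v] of the edges of S under the shifted point v + (1/2, 1/2) tells whether S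
    encloses it. An edge of S' crosses S exactly when this parity changes, so the form is the
    boundary of S' paired with [phi]. *)
Lemma X_cycle S S' : okc S -> okc S' -> (forall f, bd f S = false) ->
  (forall f, bd f S' = false) -> X S S' = false.
Proof.
move=> ok ok' cS cS'.
pose hle (v : cell) s := [&& hor s, (lo s).1 == v.1 & (lo s).2 <= v.2].
pose phi v := xsum S (hle v).
rewrite -(cS' phi) /X xsum_ex; apply: eq_xsum ok' _; apply: g4_ind => x y /=;
  rewrite -xsum_add -[LHS]addbF.
(* A horizontal edge of S' moves the downward ray to the next column; closedness of S on the
   half-column between the two rays leaves just the vertical edge that is crossed. *)
- rewrite -(cS (fun v => (v.1 == x.+1) && (v.2 <= y))) /bd -xsum_add.
  apply: eq_xsum ok _; apply: g4_ind => a b; rewrite /x1 /hle /hor /lo /hi /= !xpair_eqE; lia.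
- rewrite -(cS (fun v => (v.1 == x.+1) && (v.2 <= y))) /bd -xsum_add.
  apply: eq_xsum ok _; apply: g4_ind => a b; rewrite /x1 /hle /hor /lo /hi /= !xpair_eqE; lia.
- rewrite addbF; apply: eq_xsum ok _; apply: g4_ind => a b;
    rewrite /x1 /hle /hor /lo /hi /= !xpair_eqE; lia.
- rewrite addbF; apply: eq_xsum ok _; apply: g4_ind => a b;
    rewrite /x1 /hle /hor /lo /hi /= !xpair_eqE; lia.
Qed.

Lemma eqnS n : ((n == n.+1) = false) * ((n.+1 == n) = false).
Proof. by split; lia. Qed.

Lemma minmaxS n : (minn n n.+1 = n) * (minn n.+1 n = n) *
  (maxn n n.+1 = n.+1) * (maxn n.+1 n = n.+1).
Proof. by do !split; lia. Qed.

(** The index encodes the relative position of a and c in every equality that [X_sym] meets, so its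
    subcases are settled by computation. *)
Lemma near_cases a c : {i : nat & ((a == c) = (i == 0)) * ((c == a) = (i == 0)) *
  ((a == c.+1) = (i == 1)) * ((c.+1 == a) = (i == 1)) *
  ((a.+1 == c) = (i == 2)) * ((c == a.+1) = (i == 2))}.
Proof.
case: (a =P c) => h1; first by exists 0; do !split; lia.
case: (a =P c.+1) => h2; first by exists 1; do !split; lia.
case: (a.+1 =P c) => h3; first by exists 2; do !split; lia.
by exists 3; do !split; lia.
Qed.

Definition se (q : cell) s := if hor s then lo s == q else hi s == q.
Definition nw (q : cell) s := if hor s then hi s == q else lo s == q.

(** Up to translation, the two forms count the crossings of S with S' shifted by (1/2, 1/2) and by
    (-1/2, -1/2). While the shift passes from one to the other through (1/2, -1/2), the count
    changes only when an end of S' crosses an edge of S to its east or south ([se]), or an end of S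
    crosses an edge of S' to its west or north ([nw]). *)
Lemma X_sym S S' : okc S -> okc S' -> X S S' (+) X S' S =
  bd (fun q => xsum S (se q)) S' (+) bd (fun q => xsum S' (nw q)) S.
Proof.
move=> ok ok'.
have -> : bd (fun q => xsum S (se q)) S' =
    xsum S (fun s => xsum S' (fun s' => se s'.1 s (+) se s'.2 s)).
  by rewrite xsum_ex; apply: eq_bigr => s _; rewrite xsum_add.
have -> : bd (fun q => xsum S' (nw q)) S =
    xsum S (fun s => xsum S' (fun s' => nw s.1 s' (+) nw s.2 s')).
  by apply: eq_bigr => s _; rewrite xsum_add.
rewrite [X S' S]xsum_ex /X -!xsum_add; apply: eq_xsum ok _ => s hs.
rewrite -!xsum_add; apply: eq_xsum ok' _ => s' hs'.
move: s hs s' hs'; apply: g4_ind => a b; apply: g4_ind => c d;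
  have [i ac] := near_cases a c; have [j bd'] := near_cases b d;
  rewrite /x1 /se /nw /hor /lo /hi /= ?eqxx ?eqnS ?minmaxS ?minnn ?maxnn /=
    ?xpair_eqE ?eqSS ?ac ?bd'; case: i {ac} => [|[|[|i]]]; case: j {bd'} => [|[|[|j]]] //.
Qed.

(** The four directions together count the degree of q modulo 2. *)
Lemma se_nw q S : okc S -> xsum S (se q) (+) xsum S (nw q) = bd (fun v => v == q) S.
Proof.
move=> ok; rewrite -xsum_add; apply: eq_xsum ok _; case: q => x y.
apply: g4_ind => a b; rewrite /se /nw /hor /lo /hi /= ?eqxx ?eqnS /= !xpair_eqE; lia.
Qed.

Definition cin (A : cell -> Prop) S := forall s, s \in S -> A s.1 /\ A s.2.

Lemma xsum0 S F : (forall s, s \in S -> F s = false) -> xsum S F = false.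
Proof. by move=> h; rewrite /xsum big_seq big1. Qed.

Lemma X_disj (A B : cell -> Prop) S S' : okc S -> okc S' -> cin A S -> cin B S' ->
  (forall v, A v -> B v -> False) -> X S S' = false.
Proof.
move=> ok ok' cA cB AB; apply: xsum0 => s sS; apply: xsum0 => s' sS'.
apply/negP => h; have [A1 A2] := cA _ sS; have [B1 B2] := cB _ sS'.
have := allP ok _ sS; have := allP ok' _ sS'.
suff H : g4 s.1 s.2 -> g4 s'.1 s'.2 ->
    [\/ s.1 = s'.1, s.1 = s'.2, s.2 = s'.1 | s.2 = s'.2].
  by move=> g' g; case: (H g g') => E; [apply: (AB s.1)|apply: (AB s.1)|
     apply: (AB s.2)|apply: (AB s.2)]; rewrite // E.
move=> g g'; move: s g s' g' h {sS A1 A2 sS' B1 B2}.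
apply: g4_ind => a b; apply: g4_ind => c d; rewrite /x1 /hor /lo /hi /= xpair_eqE => h;
  first [ lia
  | constructor 1; congr (_, _); lia | constructor 2; congr (_, _); lia
  | constructor 3; congr (_, _); lia | constructor 4; congr (_, _); lia ].
Qed.

Definition walk a b S := okc S /\ forall f, bd f S = f a (+) f b.

Lemma rch_walk A x y : rch (fun u v => g4 u v) A x y ->
  exists S, walk x y S /\ cin A S.
Proof.
elim=> [Ax|u v xu [S [[ok bS] cS]] uv Av].
  by exists [::]; split=> //; split=> // f; rewrite /bd /xsum big_nil addbb.
exists (rcons S (u, v)); split; last first.
  move=> s; rewrite mem_rcons inE => /orP[/eqP -> /=|/cS//].
  by split=> //; apply: rch_r xu.
split; first by rewrite /okc all_rcons uv.
move=> f; rewrite -cats1 bd_cat bS /bd /xsum big_seq1 /=.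
by case: (f x); case: (f u); case: (f v).
Qed.

(* For walks w0a from p0 to pa, M a b + M b a is computed at p0 by [X_sym] and
   equals s a + s b + 1; the three pairs of opposite triangles through p0 force
   the sum of these numbers over {2, 3, 4} to be even. *)
Lemma grid_noK5 (F : nat -> cell -> Prop) :
  (forall i, i < 5 -> exists x, F i x) ->
  (forall i, i < 5 -> con (fun u v => g4 u v) (F i)) ->
  (forall i j x, i < 5 -> j < 5 -> F i x -> F j x -> i = j) ->
  (forall i j, i < j -> j < 5 -> exists x y, [/\ F i x, F j y & g4 x y]) -> False.
Proof.
move=> ne cn dj ad.
have /choice [p pP] : forall i, exists x, i < 5 -> F i x.
  by move=> i; case: (ltnP i 5) => [/ne [x]|]; [exists x|exists (0, 0)].
have /choice [w wP] : forall ij : nat * nat, exists S, ij.1 < ij.2 -> ij.2 < 5 ->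
    walk (p ij.1) (p ij.2) S /\ cin (fun v => F ij.1 v \/ F ij.2 v) S.
  move=> [i j] /=; case: (ltnP i j) => ij; last by exists [::].
  case: (ltnP j 5) => j5; last by exists [::].
  have i5 := ltn_trans ij j5.
  have [x [y [Fx Fy xy]]] := ad _ _ ij j5.
  have : rch (fun u v => g4 u v) (fun v => F i v \/ F j v) (p i) (p j).
    apply: (@rch_trans _ _ _ _ y); last first.
      by apply: (rch_mono _ (cn _ j5 _ _ Fy (pP _ j5))) => v; right.
    apply: (rchS _ xy); last by right.
    by apply: (rch_mono _ (cn _ i5 _ _ (pP _ i5) Fx)) => v; left.
  by move=> /rch_walk [S [h1 h2]]; exists S.
have W i j : i < j -> j < 5 -> walk (p i) (p j) (w (i, j)).
  by move=> h1 h2; have [] := wP (i, j) h1 h2.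
have C i j : i < j -> j < 5 -> cin (fun v => F i v \/ F j v) (w (i, j)).
  by move=> h1 h2; have [] := wP (i, j) h1 h2.
have O i j : i < j -> j < 5 -> okc (w (i, j)).
  by move=> h1 h2; have [] := W i j h1 h2.
have X0 i j k l : i < j -> j < 5 -> k < l -> l < 5 -> i != k -> i != l -> j != k ->
    j != l -> X (w (i, j)) (w (k, l)) = false.
  move=> ij j5 kl l5 nik nil njk njl.
  apply: (X_disj (O _ _ ij j5) (O _ _ kl l5) (C _ _ ij j5) (C _ _ kl l5)).
  move=> v [] h [] h'; have i5 := ltn_trans ij j5; have k5 := ltn_trans kl l5.
  - by have := dj _ _ _ i5 k5 h h'; lia.
  - by have := dj _ _ _ i5 l5 h h'; lia.
  - by have := dj _ _ _ j5 k5 h h'; lia.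
  - by have := dj _ _ _ j5 l5 h h'; lia.
pose cy i j := w (0, i) ++ w (i, j) ++ w (0, j).
have cyP i j : 0 < i -> i < j -> j < 5 -> okc (cy i j) /\ forall f, bd f (cy i j) = false.
  move=> i0 ij j5; split.
    by rewrite /okc !all_cat; apply/and3P; split; apply: O; lia.
  move=> f; rewrite !bd_cat.
  have [_ ->] : walk (p 0) (p i) (w (0, i)) by apply: W; lia.
  have [_ ->] := W i j ij j5.
  have [_ ->] : walk (p 0) (p j) (w (0, j)) by apply: W; lia.
  by case: (f (p 0)); case: (f (p i)); case: (f (p j)).
pose M a b := X (w (0, a)) (w (0, b)).
(* Two triangles with only vertex 0 in common: walks over disjoint pairs of sets contribute nothing,
   and four terms at p0 remain. *)
have E i j k l : 0 < i -> i < j -> j < 5 -> 0 < k -> k < l -> l < 5 ->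
    i != k -> i != l -> j != k -> j != l ->
    M i k (+) M i l (+) M j k (+) M j l = false.
  move=> i0 ij j5 k0 kl l5 nik nil njk njl.
  have [ok1 c1] := cyP _ _ i0 ij j5; have [ok2 c2] := cyP _ _ k0 kl l5.
  have := X_cycle ok1 ok2 c1 c2; rewrite /cy !X_catl !X_catr.
  rewrite (X0 0 i k l) ?(X0 i j 0 k) ?(X0 i j k l) ?(X0 i j 0 l) ?(X0 0 j k l); try lia.
  by rewrite /M; case: X; case: X; case: X; case: X.
pose s a := xsum (w (0, a)) (se (p 0)).
have A a b : 0 < a -> a < 5 -> 0 < b -> b < 5 -> a != b ->
    M a b (+) M b a = s a (+) s b (+) true.
  move=> a0 a5 b0 b5 ab; rewrite /M X_sym; try by apply: O; lia.
  have [ok bda] : walk (p 0) (p a) (w (0, a)) by apply: W; lia.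
  have [ok' bdb] : walk (p 0) (p b) (w (0, b)) by apply: W; lia.
  rewrite bda bdb.
  have notin c d (q : cell -> step -> bool) : 0 < c -> c < 5 -> 0 < d -> d < 5 -> c != d ->
      (forall v t, g4 t.1 t.2 -> q v t -> v = t.1 \/ v = t.2) ->
      xsum (w (0, c)) (q (p d)) = false.
    move=> c0 c5 d0 d5 cd hq; apply: xsum0 => t tS; apply/negP => h.
    have [] := C 0 c c0 c5 _ tS.
    have := hq _ _ (allP (O 0 c c0 c5) _ tS) h => -[] <- /=.
    - by move=> [] h' _; have := dj _ _ _ _ d5 h' (pP _ d5); lia.
    - by move=> _ [] h'; have := dj _ _ _ _ d5 h' (pP _ d5); lia.
  rewrite (notin a b se) //; last first.
    move=> [x y] t; move: t; apply: g4_ind => m n; rewrite /se /hor /lo /hi /=;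
      case: ifP => _; rewrite xpair_eqE => h; first [left; congr (_, _); lia|right; congr (_, _); lia].
  rewrite (notin b a nw) //; last first.
  - move=> [x y] t; move: t; apply: g4_ind => m n; rewrite /nw /hor /lo /hi /=;
      case: ifP => _; rewrite xpair_eqE => h; first [left; congr (_, _); lia|right; congr (_, _); lia].
  - by rewrite eq_sym.
  (* The walk to pb has odd degree at its end p0, so its [nw] sum there is s b + 1. *)
  have := se_nw (p 0) ok'; rewrite bdb eqxx.
  have -> : (p b == p 0) = false.
    apply/eqP => E0; have := pP b b5; rewrite E0 => h.
    have := dj 0 b (p 0) isT b5 (pP 0 isT) h; lia.
  rewrite -/(s b) -/(s a).
  by case: (s a); case: (s b); case: (xsum _ (nw _)).
have := E 1 2 3 4 isT isT isT isT isT isT isT isT isT isT.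
have := E 1 3 2 4 isT isT isT isT isT isT isT isT isT isT.
have := E 1 4 2 3 isT isT isT isT isT isT isT isT isT isT.
have := A 2 3 isT isT isT isT isT; have := A 2 4 isT isT isT isT isT.
have := A 3 4 isT isT isT isT isT.
case: (s 2); case: (s 3); case: (s 4); case: (M 1 2); case: (M 1 3); case: (M 1 4);
  case: (M 2 3); case: (M 2 4); case: (M 3 4); case: (M 3 2); case: (M 4 2);
  case: (M 4 3) => //.
Qed.

End GridK5.

Import Order.TTheory GRing.Theory Num.Theory.
Import numFieldNormedType.Exports.

Local Open Scope classical_set_scope.
Local Open Scope ring_scope.

(** * Quotients of the grid by connected classes are planar *)

Section Collapse.
Variable R : realType.
Local Notation pl := (R * R)%type.
Implicit Types (a b z : pl) (h u w t : R).

(** Slope of the collapse at offset w: 0 on the line of the segment and 1 from offset 1/2 on, so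
    that neighbouring lattice lines stay put. *)
Definition hgt w : R := Num.min 1 (2 * `|w|).
(** Slope h on [0, 1], slope 3 - 2 * h on [1, 3/2], identity elsewhere. Writing it with min and max
    makes continuity in both arguments immediate. *)
Definition squeeze h u : R := Num.min u (Num.max (h * u) ((3 - 2 * h) * (u - 1) + h)).

Lemma hgt_bounds w : 0 <= hgt w <= 1.
Proof.
have h0 := normr_ge0 w; rewrite /hgt; case: (leP 1 (2 * `|w|)) => h1;
  apply/andP; split; lra.
Qed.

Lemma hgt0 w : hgt w = 0 -> w = 0.
Proof.
rewrite /hgt; case: (leP 1 (2 * `|w|)) => h1 h2; first lra.
by apply/eqP; rewrite -normr_eq0; apply/eqP; lra.
Qed.

Lemma squeezeE h u : 0 <= h <= 1 -> squeeze h u =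
  if u <= 0 then u else if u <= 1 then h * u else
  if u <= 3 / 2 then (3 - 2 * h) * (u - 1) + h else u.
Proof.
move=> /andP[h0 h1]; rewrite /squeeze.
by case: (leP u 0) => u0; [|case: (leP u 1) => u1; [|case: (leP u (3 / 2)) => u2]];
  (case: (leP (h * u) ((3 - 2 * h) * (u - 1) + h)) => e1;
    [case: (leP u ((3 - 2 * h) * (u - 1) + h)) => e2|case: (leP u (h * u)) => e2]); nra.
Qed.

Lemma squeeze_inj h u u' : 0 <= h <= 1 -> squeeze h u = squeeze h u' ->
  u = u' \/ [/\ h = 0, 0 <= u <= 1 & 0 <= u' <= 1].
Proof.
move=> hh; rewrite !squeezeE //; move/andP: hh => [h0 h1].
wlog lt : u u' / u < u'.
  move=> H E; case: (ltgtP u u') => [/H/(_ E)//|/H/(_ (esym E)) [->|[h2 h3 h4]]|->];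
    by [left|right].
case: (ltP 0 h) => hp E.
  by exfalso; move: E; case: (leP u 0) => u0; [|case: (leP u 1) => u1; [|case: (leP u (3 / 2)) => u2]];
  (case: (leP u' 0) => v0; [|case: (leP u' 1) => v1; [|case: (leP u' (3 / 2)) => v2]]); nra.
have hE : h = 0 by lra.
right; move: E; rewrite hE.
by case: (leP u 0) => u0; [|case: (leP u 1) => u1; [|case: (leP u (3 / 2)) => u2]];
  (case: (leP u' 0) => v0; [|case: (leP u' 1) => v1; [|case: (leP u' (3 / 2)) => v2]]) => E;
  split=> //; try apply/andP; try split; lra.
Qed.

Lemma squeeze_id w u : u <= 0 \/ 3 / 2 <= u \/ 1 / 2 <= w \/ w <= - (1 / 2) ->
  squeeze (hgt w) u = u.
Proof.
case=> [u0|[u0|[w0|w0]]].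
- by rewrite squeezeE ?hgt_bounds // u0.
- rewrite squeezeE ?hgt_bounds //; case: (leP u 0) => // h1; case: (leP u 1) => h2; first lra.
  case: (leP u (3 / 2)) => // h3; have -> : u = 3 / 2 by lra.
  by lra.
- have h1 : 1 <= 2 * w by lra.
  have -> : hgt w = 1 by rewrite /hgt ger0_norm; [exact/min_idPl|lra].
  rewrite /squeeze (_ : (3 - 2 * 1) * (u - 1) + 1 = u); last ring.
  by rewrite mul1r maxxx minxx.
- have h1 : 1 <= 2 * - w by lra.
  have -> : hgt w = 1 by rewrite /hgt ler0_norm; [exact/min_idPl|lra].
  rewrite /squeeze (_ : (3 - 2 * 1) * (u - 1) + 1 = u); last ring.
  by rewrite mul1r maxxx minxx.
Qed.

Definition alg (a b z : pl) : R :=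
  (b.1 - a.1) * (z.1 - a.1) + (b.2 - a.2) * (z.2 - a.2).
Definition off (a b z : pl) : R :=
  (b.1 - a.1) * (z.2 - a.2) - (b.2 - a.2) * (z.1 - a.1).

(* The frame at a with first axis b - a turns z into (alg, off); the segment
   from a to b is shrunk to a and the plane is stretched just behind b. *)
Definition coll (a b z : pl) : pl :=
  let k := squeeze (hgt (off a b z)) (alg a b z) in
  (a.1 + k * (b.1 - a.1) - off a b z * (b.2 - a.2),
   a.2 + k * (b.2 - a.2) + off a b z * (b.1 - a.1)).

Definition seg (a b z : pl) := exists2 t : R, 0 <= t <= 1 &
  z = (a.1 + t * (b.1 - a.1), a.2 + t * (b.2 - a.2)).

Definition P (c : nat * nat) : pl := (c.1%:R, c.2%:R).

Lemma P_inj : injective P.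
Proof.
by move=> [x y] [x' y'] [/eqP]; rewrite eqr_nat => /eqP -> /eqP; rewrite eqr_nat => /eqP ->.
Qed.

Lemma seg_sym a b z : seg a b z -> seg b a z.
Proof.
case=> t ht ->; exists (1 - t); first by move/andP: ht => [? ?]; apply/andP; split; lra.
by congr (_, _); ring.
Qed.

Lemma seg_l a b : seg a b a.
Proof.
exists 0; first by rewrite lexx ler01.
by case: a => ? ?; congr (_, _) => /=; ring.
Qed.

Lemma seg_r a b : seg a b b.
Proof. exact/seg_sym/seg_l. Qed.

Definition unit_dir (a b : pl) := [\/ b.1 = a.1 + 1 /\ b.2 = a.2,
  b.1 = a.1 - 1 /\ b.2 = a.2, b.1 = a.1 /\ b.2 = a.2 + 1 |
  b.1 = a.1 /\ b.2 = a.2 - 1].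

Lemma g4_dir c d : g4 c d -> unit_dir (P c) (P d).
Proof.
case: c d => [x y] [x' y']; rewrite /g4 /unit_dir /P /=.
case/orP => /andP[/eqP <-] /orP[] /eqP <-; rewrite -natr1;
  [constructor 3|constructor 4|constructor 1|constructor 2]; split=> //; lra.
Qed.

Lemma coll_inj a b z z' : unit_dir a b -> coll a b z = coll a b z' ->
  z = z' \/ seg a b z /\ seg a b z'.
Proof.
move=> ud [E1 E2].
have hb := hgt_bounds (off a b z).
have wE : off a b z = off a b z'.
  by case: ud => -[d1 d2]; rewrite d1 d2 in E1 E2 *; lra.
have kE : squeeze (hgt (off a b z)) (alg a b z) = squeeze (hgt (off a b z)) (alg a b z').
  by rewrite -wE in E1 E2; case: ud => -[d1 d2]; rewrite d1 d2 in E1 E2 *; lra.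
have [uE|[h0 /andP[u0 u1] /andP[v0 v1]]] := squeeze_inj hb kE.
  left; case: z z' wE uE {kE E1 E2 hb} => [x y] [x' y']; rewrite /off /alg /= => wE uE.
  by congr (_, _); case: ud => -[d1 d2]; rewrite d1 d2 in wE uE *; lra.
have w0 := hgt0 h0; rewrite w0 in wE.
right; split; [exists (alg a b z)|exists (alg a b z')]; try by apply/andP.
  case: z w0 u0 u1 {E1 E2 kE wE h0 hb} => x y; rewrite /off /alg /= => w0 _ _.
  by congr (_, _); case: ud => -[d1 d2]; rewrite d1 d2 in w0 *; lra.
case: z' wE v0 v1 {E1 E2 kE h0 hb} => x y; rewrite /off /alg /= => w0' _ _.
by congr (_, _); case: ud => -[d1 d2]; rewrite d1 d2 in w0' *; lra.
Qed.

Lemma coll_l a b : coll a b a = a.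
Proof.
have -> : coll a b a = (a.1 + squeeze (hgt 0) 0 * (b.1 - a.1), a.2 + squeeze (hgt 0) 0 * (b.2 - a.2)).
  rewrite /coll; have -> : off a b a = 0 by rewrite /off; ring.
  have -> : alg a b a = 0 by rewrite /alg; ring.
  by congr (_, _); ring.
rewrite squeeze_id; last by left.
by case: a => ? ? /=; congr (_, _); ring.
Qed.

Lemma coll_r a b : unit_dir a b -> coll a b b = a.
Proof.
move=> ud.
have o0 : off a b b = 0 by rewrite /off; ring.
have u1 : alg a b b = 1.
  by rewrite /alg; case: ud => -[d1 d2]; rewrite d1 d2; ring.
have h0 : hgt 0 = 0 :> R by rewrite /hgt normr0 mulr0; case: (leP 1 0) => // h; lra.
have hb : 0 <= (0 : R) <= 1 by rewrite lexx ler01.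
rewrite /coll o0 u1 h0 squeezeE //; have -> : (1 <= 0 :> R) = false by apply/negP; lra.
by rewrite lexx; case: a {ud o0 u1} => ? ? /=; congr (_, _); ring.
Qed.

Lemma coll_id a b z : unit_dir a b -> alg a b z <= 0 \/ 3 / 2 <= alg a b z \/
  1 / 2 <= off a b z \/ off a b z <= - (1 / 2) -> coll a b z = z.
Proof.
move=> ud h; rewrite /coll squeeze_id //; case: z {h} => x y; rewrite /off /alg /=.
by congr (_, _); case: ud => -[d1 d2]; rewrite d1 d2; ring.
Qed.

(** A unit lattice segment without end (1, 0) lies in one of the half-planes u <= 0, u >= 2, w >= 1,
    w <= -1, all of which the collapse leaves fixed. *)
Lemma lattice_far (U W U' W' : int) t : 0 <= t <= 1 ->
  (U = U' /\ (W' = W + 1 \/ W' = W - 1)) \/ (W = W' /\ (U' = U + 1 \/ U' = U - 1)) ->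
  ~ (U = 1 /\ W = 0) -> ~ (U' = 1 /\ W' = 0) ->
  let u := U%:~R + t * (U'%:~R - U%:~R) in let w := W%:~R + t * (W'%:~R - W%:~R) in
  u <= 0 \/ 3 / 2 <= u \/ 1 / 2 <= w \/ w <= - (1 / 2) :> R.
Proof.
move=> /andP[t0 t1] adj n1 n2 u w.
have : (U <= 0 /\ U' <= 0) \/ (2 <= U /\ 2 <= U') \/ (1 <= W /\ 1 <= W') \/
    (W <= -1 /\ W' <= -1) by lia.
have cst (x y : int) : x <= y -> (x%:~R <= y%:~R :> R) by rewrite ler_int.
case=> [|[|[|]]] [/cst h1 /cst h2]; rewrite /u /w.
- left; nra.
- right; left; nra.
- right; right; left; nra.
- right; right; right; nra.
Qed.

(** In the frame at c the cell d has coordinates (1, 0), so [lattice_far] applies to every grid edge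
    that does not end at d. *)
Lemma coll_fix c d p q z : g4 c d -> g4 p q -> d <> p -> d <> q ->
  seg (P p) (P q) z -> coll (P c) (P d) z = z.
Proof.
move=> cd pq dp dq [t ht ->]; have ud := g4_dir cd.
apply: (coll_id ud).
have dp' : ~~ ((d.1 == p.1) && (d.2 == p.2)).
  apply/negP => /andP[/eqP h1 /eqP h2]; apply: dp.
  by case: (d) (p) h1 h2 => ? ? [? ?] /= -> ->.
have dq' : ~~ ((d.1 == q.1) && (d.2 == q.2)).
  apply/negP => /andP[/eqP h1 /eqP h2]; apply: dq.
  by case: (d) (q) h1 h2 => ? ? [? ?] /= -> ->.
set z0 := (_, _).
have key (U W U' W' : int) : alg (P c) (P d) z0 = U%:~R + t * (U'%:~R - U%:~R) ->
    off (P c) (P d) z0 = W%:~R + t * (W'%:~R - W%:~R) ->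
    (U = U' /\ (W' = W + 1 \/ W' = W - 1)) \/ (W = W' /\ (U' = U + 1 \/ U' = U - 1)) ->
    ~ (U = 1 /\ W = 0) -> ~ (U' = 1 /\ W' = 0) ->
    alg (P c) (P d) z0 <= 0 \/ 3 / 2 <= alg (P c) (P d) z0 \/
    1 / 2 <= off (P c) (P d) z0 \/ off (P c) (P d) z0 <= - (1 / 2).
  by move=> -> -> h1 h2 h3; exact: (lattice_far ht h1 h2 h3).
move=> {dp dq ud}; move: pq dp' dq' key; rewrite /z0 /alg /off /P /= => {z0}.
case: p q => [p1 p2] [q1 q2] /=.
case: c d cd => [x y] [x' y']; rewrite /g4 /=.
case/orP => /andP[/eqP <-] /orP[] /eqP <- pq dp dq key.
- apply: (key (p2%:Z - y%:Z) (x%:Z - p1%:Z) (q2%:Z - y%:Z) (x%:Z - q1%:Z));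
    first [by rewrite !rmorphB /= -?pmulrn -?natr1; ring | lia].
- apply: (key (y'.+1%:Z - p2%:Z) (p1%:Z - x%:Z) (y'.+1%:Z - q2%:Z) (q1%:Z - x%:Z));
    first [by rewrite !rmorphB /= -?pmulrn -?natr1; ring | lia].
- apply: (key (p1%:Z - x%:Z) (p2%:Z - y%:Z) (q1%:Z - x%:Z) (q2%:Z - y%:Z));
    first [by rewrite !rmorphB /= -?pmulrn -?natr1; ring | lia].
- apply: (key (x'.+1%:Z - p1%:Z) (y%:Z - p2%:Z) (x'.+1%:Z - q1%:Z) (y%:Z - q2%:Z));
    first [by rewrite !rmorphB /= -?pmulrn -?natr1; ring | lia].
Qed.

Lemma ncmp (m x : nat) : m = x \/ m = x.+1 \/ x = m.+1 \/
  (m%:R + 2 <= x%:R :> R) \/ (x%:R + 2 <= m%:R :> R).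
Proof.
have [h|[h|[h|[h|h]]]] : (m = x \/ m = x.+1 \/ x = m.+1 \/ (m + 2 <= x) \/ (x + 2 <= m))%N by lia.
- by left.
- by right; left.
- by right; right; left.
- by right; right; right; left; rewrite -natrD ler_nat.
- by right; right; right; right; rewrite -natrD ler_nat.
Qed.

Lemma g4_lo (Q : nat * nat -> nat * nat -> Prop) : (forall c d, Q c d -> Q d c) ->
  (forall x y, Q (x, y) (x.+1, y)) -> (forall x y, Q (x, y) (x, y.+1)) ->
  forall c d, g4 c d -> Q c d.
Proof.
move=> sy h1 h2 [x y] [x' y']; rewrite /g4 /=.
by case/orP => /andP[/eqP <-] /orP[] /eqP <-; auto.
Qed.

Lemma seg_int p q p' q' z : g4 p q -> g4 p' q' -> seg (P p) (P q) z ->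
  seg (P p') (P q') z -> ((p = p' /\ q = q') \/ (p = q' /\ q = p')) \/
  exists c, [/\ z = P c, c = p \/ c = q & c = p' \/ c = q'].
Proof.
move=> pq; move: pq p' q'; move: p q.
apply: g4_lo.
- move=> c d H p' q' g s1 s2; case: (H p' q' g (seg_sym s1) s2).
    by case=> -[-> ->]; left; [right|left].
  by case=> c' [h1 h2 h3]; right; exists c'; split=> //; case: h2; auto.
all: move=> x y; apply: g4_lo.
1,4: move=> c d H s1 s2; case: (H s1 (seg_sym s2)); [by case=> -[h1 h2]; left; auto|];
  case=> c' [h1 h2 h3]; right; exists c'; split=> //; case: h3; auto.
all: move=> x' y' [t /andP[t0 t1] ->] [t' /andP[t0' t1']]; rewrite /P /= -!natr1 => -[E1 E2].
- have yE : y = y' by apply/eqP; rewrite -(eqr_nat R); apply/eqP; lra.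
  subst y'; case: (ncmp x x') => [->|[h|[h|[h|h]]]]; [by left; left| | |exfalso; lra|exfalso; lra].
    subst x; right; exists (x'.+1, y); split; [|by left|by right].
    by rewrite /= -natr1 in E1 *; congr (_, _); lra.
  subst x'; right; exists (x.+1, y); split; [|by right|by left].
  by rewrite /= -natr1 in E1 *; congr (_, _); lra.
- right; exists (x', y); split.
  + by congr (_, _) => /=; lra.
  + case: (ncmp x x') => [->|[h|[h|[h|h]]]]; [by left| |by right; rewrite h|exfalso; lra|exfalso; lra].
    by exfalso; subst x; rewrite -natr1 in E1; lra.
  + case: (ncmp y y') => [->|[h|[h|[h|h]]]]; [by left|by right; rewrite h| |exfalso; lra|exfalso; lra].
    by exfalso; subst y'; rewrite -natr1 in E2; lra.
- right; exists (x, y'); split.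
  + by congr (_, _) => /=; lra.
  + case: (ncmp y y') => [->|[h|[h|[h|h]]]]; [by left| |by right; rewrite h|exfalso; lra|exfalso; lra].
    by exfalso; subst y; rewrite -natr1 in E2; lra.
  + case: (ncmp x x') => [->|[h|[h|[h|h]]]]; [by left|by right; rewrite h| |exfalso; lra|exfalso; lra].
    by exfalso; subst x'; rewrite -natr1 in E1; lra.
- have xE : x = x' by apply/eqP; rewrite -(eqr_nat R); apply/eqP; lra.
  subst x'; case: (ncmp y y') => [->|[h|[h|[h|h]]]]; [by left; left| | |exfalso; lra|exfalso; lra].
    subst y; right; exists (x, y'.+1); split; [|by left|by right].
    by rewrite /= -natr1 in E2 *; congr (_, _); lra.
  subst y'; right; exists (x, y.+1); split; [|by right|by left].
  by rewrite /= -natr1 in E2 *; congr (_, _); lra.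
Qed.

Lemma seg_lattice p q c : g4 p q -> seg (P p) (P q) (P c) -> c = p \/ c = q.
Proof.
move=> pq s; have gc : g4 c (c.1.+1, c.2) by rewrite /g4 /= !eqxx orbT.
have [[[h _]|[_ h]]|[c' [h1 h2 h3]]] := seg_int pq gc s (seg_l _ _); [by left|by right|].
by move/P_inj: h1 => ->.
Qed.

Section CollCont.
Variables (T : topologicalType).
Implicit Types f g : T -> R.

Lemma cont_min f g : continuous f -> continuous g ->
  continuous (fun x => Num.min (f x) (g x)).
Proof. move=> cf cg x; exact: (continuous_min (cf x) (cg x)). Qed.

Lemma cont_max f g : continuous f -> continuous g ->
  continuous (fun x => Num.max (f x) (g x)).
Proof. move=> cf cg x; exact: (continuous_max (cf x) (cg x)). Qed.

Lemma cont_add f g : continuous f -> continuous g -> continuous (fun x => f x + g x).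
Proof. move=> cf cg x; exact: (continuousD (cf x) (cg x)). Qed.

Lemma cont_mul f g : continuous f -> continuous g -> continuous (fun x => f x * g x).
Proof. move=> cf cg x; exact: (continuousM (cf x) (cg x)). Qed.

Lemma cont_sub f g : continuous f -> continuous g -> continuous (fun x => f x - g x).
Proof. move=> cf cg x; exact: (continuousB (cf x) (cg x)). Qed.

Lemma cont_cst (k : R) : continuous (fun _ : T => k).
Proof. by move=> x; exact: cvg_cst. Qed.

Lemma cont_norm f : continuous f -> continuous (fun x => `|f x|).
Proof. by move=> cf x; apply: continuous_comp; [exact: cf|exact: norm_continuous]. Qed.

Lemma cont_pair f g : continuous f -> continuous g -> continuous (fun x => (f x, g x)).
Proof. by move=> cf cg x; exact: (cvg_pair (cf x) (cg x)). Qed.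

End CollCont.

Lemma cont_fst : continuous (fun z : pl => z.1).
Proof. by move=> z; exact: cvg_fst. Qed.

Lemma cont_snd : continuous (fun z : pl => z.2).
Proof. by move=> z; exact: cvg_snd. Qed.

Lemma coll_cont a b : continuous (coll a b).
Proof.
have co : continuous (off a b).
  by apply: cont_sub; apply: cont_mul; try exact: cont_cst; apply: cont_sub;
    try exact: cont_cst; [exact: cont_snd|exact: cont_fst].
have ca : continuous (alg a b).
  by apply: cont_add; apply: cont_mul; try exact: cont_cst; apply: cont_sub;
    try exact: cont_cst; [exact: cont_fst|exact: cont_snd].
have ch : continuous (fun z => hgt (off a b z)).
  apply: cont_min; first exact: cont_cst.
  by apply: cont_mul; [exact: cont_cst|exact: cont_norm].
have cs : continuous (fun z => squeeze (hgt (off a b z)) (alg a b z)).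
  apply: cont_min => //; apply: cont_max; first exact: cont_mul.
  apply: cont_add => //; apply: cont_mul; last by apply: cont_sub => //; exact: cont_cst.
  by apply: cont_sub; [exact: cont_cst|apply: cont_mul => //; exact: cont_cst].
apply: cont_pair.
  apply: cont_sub; last by apply: cont_mul => //; exact: cont_cst.
  by apply: cont_add; [exact: cont_cst|apply: cont_mul => //; exact: cont_cst].
apply: cont_add; last by apply: cont_mul => //; exact: cont_cst.
by apply: cont_add; [exact: cont_cst|apply: cont_mul => //; exact: cont_cst].
Qed.

End Collapse.

(** * Collapsing the spanning trees and drawing the quotient *)

Section Drawing.
Variables (R : realType) (V : finType) (cp : V -> nat * nat).
Hypothesis cp_inj : injective cp.
Variable e : V -> V -> Prop.
Hypothesis e_sym : forall x y, e x y -> e y x.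
Hypothesis e_g4 : forall x y, e x y -> g4 (cp x) (cp y).
Variable r : V -> V.
Hypothesis rr : forall x, r (r x) = r x.
Hypothesis r_con : forall x y, r x = r y -> rch e (fun z => r z = r x) x y.

Local Notation pos x := (P R (cp x)).

Fixpoint cwalk n x y := if n is m.+1 then
  exists z, [/\ cwalk m x z, e z y & r y = r x] else x = y.

Lemma cwalk_r n x y : cwalk n x y -> r y = r x.
Proof. by case: n => [/= ->|n [z []]]. Qed.

(** The depth is the distance to the representative inside the class. *)
Lemma spanning_forest : exists (dep : V -> nat) (par : V -> V), forall x, r x <> x ->
  [/\ e (par x) x, r (par x) = r x & (dep (par x) < dep x)%N].
Proof.
have cw x y : rch e (fun z => r z = r x) x y -> exists n, cwalk n x y.
  elim=> [_|u v xu [n hn] uv Ev]; first by exists 0%N.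
  by exists n.+1, u; split.
have /choice [dep depP] : forall x, exists n, cwalk n (r x) x /\
    forall m, cwalk m (r x) x -> (n <= m)%N.
  by move=> x; apply: min_ex; apply: cw; apply: r_con; rewrite rr.
have /choice [par parP] : forall x, exists y, r x <> x ->
    [/\ e y x, r y = r x & (dep y < dep x)%N].
  move=> x; have [h1 h2] := depP x; case E : (dep x) h1 => [|n] /= h1.
    by exists x => /(_ h1).
  have [z [h3 h4 h5]] := h1; exists z => _; split=> //.
    by rewrite (cwalk_r h3) rr.
  have zr : r z = r x by rewrite (cwalk_r h3) rr.
  by have [_ H] := depP z; rewrite ltnS; apply: H; rewrite zr.
by exists dep, par.
Qed.

Section Tree.
Variable par : V -> V.
Hypothesis parP : forall x, r x <> x -> e (par x) x /\ r (par x) = r x.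

Local Notation collx x := (coll (pos (par x)) (pos x)).
Local Notation segx x := (seg (pos (par x)) (pos x)).

Fixpoint qmap (L : seq V) z := if L is x :: L' then qmap L' (collx x z) else z.

(** Once x has been collapsed onto its parent, no later tree edge ends at x. By [coll_fix] the
    collapse of x therefore leaves all later tree edges straight. *)
Fixpoint ordered (L : seq V) : Prop := if L is x :: L' then
  [/\ r x <> x, forall y, y \in L' -> y <> x /\ par y <> x & ordered L'] else True.

Definition tr (L : seq V) c z := exists2 x, x \in L & r x = c /\ segx x z.

Lemma ordered_r L x : ordered L -> x \in L -> r x <> x.
Proof.
elim: L => [//|y L IH] [h1 _ h3]; rewrite inE => /orP[/eqP -> //|]; exact: IH.
Qed.

Lemma par_g4 x : r x <> x -> g4 (cp (par x)) (cp x).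
Proof. by move=> /parP [/e_g4]. Qed.

Lemma qmap_cont L : continuous (qmap L).
Proof.
elim: L => [|x L IH] /=; first by move=> z.
move=> z; apply: (@continuous_comp _ _ _ (collx x) (qmap L)).
  exact: coll_cont.
exact: IH.
Qed.

Lemma collx_fix x y z : r x <> x -> r y <> y -> y <> x -> par y <> x -> segx y z ->
  collx x z = z.
Proof.
move=> rx ry nyx npx s; apply: (coll_fix (par_g4 rx) (par_g4 ry) _ _ s).
  by move=> /cp_inj /esym.
by move=> /cp_inj /esym.
Qed.

(** If the first collapse carries v to a point of a later tree edge, which it fixes pointwise, then
    v is that point or both lie on the collapsed edge. In the second case the two tree edges share a
    cell, hence a class. *)
Lemma qmap_fib L z z' : ordered L -> qmap L z = qmap L z' ->
  z = z' \/ exists c, tr L c z /\ tr L c z'.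
Proof.
elim: L z z' => [z z' _ /= ->|x L IH z z' [rx hx oL] /=]; first by left.
have ud := g4_dir R (par_g4 rx).
have up c v : tr L c (collx x v) -> tr (x :: L) c v.
  move=> [y yL [ry sy]]; have ryy := ordered_r oL yL; have [nyx npx] := hx _ yL.
  have fx := collx_fix rx ryy nyx npx sy.
  have [wE|[sw sv]] := coll_inj ud fx.
    by exists y; [rewrite inE yL orbT|rewrite -wE].
  have [[[_ /cp_inj h]|[_ /cp_inj /esym h]]|[c1 [_ h2 h3]]] :=
      seg_int (par_g4 rx) (par_g4 ryy) sw sy; [by case: nyx|by case: npx|].
  exists x; first by rewrite inE eqxx.
  split=> //.
  have [_ rpx] := parP rx; have [_ rpy] := parP ryy.
  case: h2 => h2; last first.
    by case: h3 => h3; rewrite h2 in h3; move/cp_inj: h3 => h3; [case: npx|case: nyx].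
  by rewrite -rpx -ry; case: h3 => h3; rewrite h2 in h3; move/cp_inj: h3 => ->.
move/IH => -/(_ oL) [/(coll_inj ud) [->|[s1 s2]]|[c [t1 t2]]]; first by left.
  by right; exists (r x); split; exists x; rewrite ?inE ?eqxx.
by right; exists c; split; apply: up.
Qed.

Lemma qmap_par L x : ordered L -> x \in L -> qmap L (pos x) = qmap L (pos (par x)).
Proof.
elim: L => [//|y L IH] [ry hy oL] /=; rewrite inE => /orP[/eqP ->|xL].
  by rewrite coll_l coll_r //; apply: g4_dir; apply: par_g4.
have rx := ordered_r oL xL; have [nxy npy] := hy _ xL.
rewrite (collx_fix ry rx nxy npy (seg_l _ _)) (collx_fix ry rx nxy npy (seg_r _ _)).
exact: IH.
Qed.

End Tree.

Definition qvertex := {x : V | r x == x}.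

Definition qrel (u v : qvertex) : Prop :=
  val u <> val v /\ exists x y, [/\ r x = val u, r y = val v & e x y].

Definition qadj : rel qvertex := fun u v => `[< qrel u v >].

Lemma qadj_sym : symmetric qadj.
Proof.
have H u v : qrel u v -> qrel v u.
  case=> neq [x [y [h1 h2 h3]]]; split; first exact/nesym.
  by exists y, x; split=> //; apply: e_sym.
by move=> u v; apply/asboolP/asboolP; apply: H.
Qed.

Lemma qadj_irr : irreflexive qadj.
Proof. by move=> u; apply/asboolP => -[]. Qed.

Definition quotient_graph : sgraph := SGraph qadj_sym qadj_irr.

Lemma rk_subproof x : r (r x) == r x. Proof. by rewrite rr. Qed.
Definition rk x : qvertex := exist _ (r x) (rk_subproof x).

Lemma rkE (u : qvertex) x : r x = val u -> u = rk x.
Proof. by move=> h; apply: val_inj; rewrite /= h. Qed.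

Lemma collapse_map : exists q : R * R -> R * R,
  [/\ continuous q, forall x, q (pos x) = q (pos (r x)) &
   forall z z', q z = q z' -> z = z' \/ exists a b c d, [/\ g4 (cp a) (cp b),
     g4 (cp c) (cp d), r a = r b /\ r c = r d, r a = r c &
     seg (pos a) (pos b) z /\ seg (pos c) (pos d) z']].
Proof.
have [dep [par parP]] := spanning_forest.
have parP' x : r x <> x -> e (par x) x /\ r (par x) = r x.
  by move=> /parP [].
pose ge x y := (dep y <= dep x)%N.
pose L := sort ge [seq x <- enum V | r x != x].
have Lm x : (x \in L) = (r x != x) by rewrite mem_sort mem_filter mem_enum andbT.
have Lu : uniq L by rewrite sort_uniq filter_uniq // enum_uniq.
have Ls : sorted ge L by apply: sort_sorted => x y; exact: leq_total.
have ge_tr : transitive ge by move=> x y z h1 h2; apply: leq_trans h2 h1.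
have oL : ordered par L.
  have : forall x, x \in L -> r x <> x by move=> x; rewrite Lm => /eqP.
  elim: (L) Lu Ls => [//|x s IH] /= /andP[xs us] ss sr; split.
  - by apply: sr; rewrite inE eqxx.
  - move=> y ys; split; first by move=> E; rewrite E in ys; rewrite ys in xs.
    move=> E; have := allP (order_path_min ge_tr ss) _ ys.
    have [|_ _] := parP y; first by apply: sr; rewrite inE ys orbT.
    by rewrite E /ge; lia.
  - by apply: IH => //; [exact: path_sorted ss|move=> y ys; apply: sr; rewrite inE ys orbT].
exists (qmap par L); split.
- exact: qmap_cont.
- move=> x; move: {2}(dep x) (leqnn (dep x)) => n; elim: n x => [|n IH] x hx;
    (have [->//|nx] := EM (r x = x)); have [_ rp dp] := parP _ nx; first lia.
  rewrite (qmap_par parP' oL) ?Lm; last exact/eqP.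
  by rewrite IH ?rp //; lia.
- move=> z z' /(qmap_fib parP' oL) [->|]; first by left.
  move=> [c [[x xL [rx sx]] [y yL [ry sy]]]]; right.
  rewrite Lm in xL; rewrite Lm in yL; move/eqP: xL => xL; move/eqP: yL => yL.
  have [ex rpx] := parP' _ xL; have [ey rpy] := parP' _ yL.
  exists (par x), x, (par y), y; split=> //; try exact: e_g4.
  by rewrite rpx rpy rx ry.
Qed.

Lemma set2_eq (T : Type) (a b c d : T) : [set a; b] = [set c; d] ->
  (a = c /\ b = d) \/ (a = d /\ b = c).
Proof.
move=> E.
have ha : [set c; d] a by rewrite -E; left.
have hb : [set c; d] b by rewrite -E; right.
have hc : [set a; b] c by rewrite E; left.
have hd : [set a; b] d by rewrite E; right.
case: ha => /= ha; case: hb => /= hb; subst.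
- by case: hd => /= ->; left.
- by left.
- by right.
- by case: hc => /= ->; left.
Qed.

(** For two adjacent classes the arc is the image of one chosen grid edge between them. The map
    identifies only points on tree edges of one class, and a chosen edge meets these at its ends
    alone, so arcs are simple and meet only at vertices. *)
Theorem quotient_planar : planar R quotient_graph.
Proof.
have [q [cq qr qf]] := collapse_map.
pose door (A : set qvertex) (xy : V * V) :=
  [/\ e xy.1 xy.2, r xy.1 <> r xy.2 & A = [set rk xy.1; rk xy.2]].
pose pt (u : qvertex) := q (pos (val u)).
pose arc (A : set qvertex) : set (R * R) :=
  if pselect (exists xy, door A xy) is left h then
    q @` seg (pos (projT1 (cid h)).1) (pos (projT1 (cid h)).2) else set0.
have ptk x : pt (rk x) = q (pos x) by rewrite /pt /= -qr.
have arcP u v : qadj u v -> exists x y, [/\ e x y, r x <> r y,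
    arc [set u; v] = q @` seg (pos x) (pos y) & [set u; v] = [set rk x; rk y]].
  move=> /asboolP [neq [x [y [rx ry xy]]]]; rewrite /arc.
  case: pselect => [h|[]]; last first.
    exists (x, y); split=> //=; first by rewrite rx ry.
    by rewrite (rkE rx) (rkE ry).
  by case: cid => -[x' y'] [/= h1 h2 h3]; exists x', y'.
have ends x y z z' : e x y -> r x <> r y -> seg (pos x) (pos y) z -> q z = q z' ->
    z = z' \/ q z = q (pos x) \/ q z = q (pos y).
  move=> xy nxy sz /qf [->|[a [b [c [d [gab _ [rab _] _ [sab _]]]]]]]; first by left.
  right; have [[[/cp_inj h1 /cp_inj h2]|[/cp_inj h1 /cp_inj h2]]|[c1 [-> h2 _]]] :=
    seg_int (e_g4 xy) gab sz sab.
  - by case: nxy; rewrite h1 h2.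
  - by case: nxy; rewrite h1 h2.
  - by case: h2 => ->; [left|right].
have qinj x y : q (pos x) = q (pos y) -> r x = r y.
  move=> /qf [/P_inj /cp_inj -> //|[a [b [c [d [gab gcd [rab rcd] rac [sab scd]]]]]]].
  have hx : r x = r a by have [/cp_inj ->|/cp_inj ->] := seg_lattice gab sab.
  have hy : r y = r c by have [/cp_inj ->|/cp_inj ->] := seg_lattice gcd scd.
  by rewrite hx hy.
have seg01 a b (t : R) : 0 <= t <= 1 ->
    seg a b (a.1 + t * (b.1 - a.1), a.2 + t * (b.2 - a.2)) by exists t.
have is_arcP x y : e x y -> r x <> r y ->
    is_arc (q (pos x)) (q (pos y)) (q @` seg (pos x) (pos y)).
  move=> xy nxy; pose l (t : R) := ((pos x).1 + t * ((pos y).1 - (pos x).1),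
    (pos x).2 + t * ((pos y).2 - (pos x).2)) : R * R.
  have l0 : l 0 = pos x by rewrite /l; case: (pos x) => ? ? /=; congr (_, _); ring.
  have l1 : l 1 = pos y by rewrite /l; case: (pos y) => ? ? /=; congr (_, _); ring.
  have cl : continuous l.
    by apply: cont_pair; apply: cont_add; try exact: cont_cst; apply: cont_mul;
      try exact: cont_cst; move=> t.
  have linj : injective l.
    move=> t t' [E1 E2]; have := g4_dir R (e_g4 xy).
    by rewrite /P /= in E1 E2 *; case=> -[/= d1 d2]; rewrite d1 d2 in E1 E2; lra.
  exists (q \o l); split.
  - apply: continuous_subspaceT => t; apply: continuous_comp; [exact: cl|exact: cq].
  - move=> t t'; rewrite !in_itv /= => ht ht' E.
    have [h|[a [b [c [d [gab gcd [rab rcd] rac [sab scd]]]]]]] := qf _ _ E.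
      exact: linj.
    have cor s a' b' : 0 <= s <= 1 -> g4 (cp a') (cp b') -> r a' = r b' ->
        seg (pos a') (pos b') (l s) -> (s = 0 /\ r a' = r x) \/ (s = 1 /\ r a' = r y).
      move=> hs g' rab' s'.
      have [[[/cp_inj h1 /cp_inj h2]|[/cp_inj h1 /cp_inj h2]]|[c1 [h1 h2 h3]]] :=
        seg_int (e_g4 xy) g' (seg01 _ _ _ hs) s'.
      + by case: nxy; rewrite h1 h2.
      + by case: nxy; rewrite h1 h2.
      + case: h2 => h2; rewrite h2 in h1 h3.
          left; split; first by apply: linj; rewrite l0.
          by case: h3 => /cp_inj ->.
        right; split; first by apply: linj; rewrite l1.
        by case: h3 => /cp_inj ->.
    have [[-> r1]|[-> r1]] := cor t a b ht gab rab sab;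
      have [[-> r2]|[-> r2]] := cor t' c d ht' gcd rcd scd => //.
      by case: nxy; rewrite -r1 -r2.
    by case: nxy; rewrite -r1 -r2.
  - by rewrite /= l0.
  - by rewrite /= l1.
  - apply/seteqP; split=> [_ [t ht <-]|_ [_ [t ht ->] <-]].
      by move: ht; rewrite /= in_itv /= => ht; exists (l t) => //; exact: seg01.
    by exists t => //=; rewrite in_itv.
have segC a b : seg a b = seg b a :> set (R * R).
  by apply/seteqP; split=> z; apply: seg_sym.
have cover u v x y : [set u; v] = [set rk x; rk y] -> forall z,
    z = q (pos x) \/ z = q (pos y) -> z = pt u \/ z = pt v.
  by move=> E z; have [[-> ->]|[-> ->]] := set2_eq E; rewrite !ptk; tauto.
exists pt, arc; split.
- move=> u v /qinj h; apply: val_inj.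
  by move: h; rewrite (eqP (valP u)) (eqP (valP v)).
- move=> u v /arcP [x [y [xy nxy -> E]]]; have [[-> ->]|[-> ->]] := set2_eq E;
    rewrite !ptk; first exact: is_arcP.
  by rewrite segC; apply: is_arcP; [exact: e_sym|exact/nesym].
- move=> u v w /arcP [x [y [xy nxy -> E0]]] [[z sz zE] nz]; have cv := cover _ _ _ _ E0.
  apply: nz; have [E|h] := ends _ _ _ _ xy nxy sz zE; last first.
    by rewrite -zE; apply: cv.
  rewrite E in sz; have := seg_lattice (e_g4 xy) sz.
  by rewrite /pt => -[] ->; apply: cv; [left|right].
- move=> u v x1 y1 /arcP [x [y [xy nxy -> uv]]] /arcP [x' [y' [xy' nxy' -> uv']]] neq.
  rewrite -subset0 => _ [[[z sz <-] nz] [z' sz' zE]]; apply: nz.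
  have cv := cover _ _ _ _ uv.
  have [E|h] := ends _ _ _ _ xy nxy sz (esym zE); last exact: cv.
  rewrite -E in sz'.
  have [[[/cp_inj h1 /cp_inj h2]|[/cp_inj h1 /cp_inj h2]]|[c1 [-> h2 _]]] :=
    seg_int (e_g4 xy) (e_g4 xy') sz sz'.
  + by case: neq; rewrite uv uv' h1 h2.
  + by case: neq; rewrite uv uv' h1 h2 setUC.
  + by apply: cv; case: h2 => ->; [left|right].
Qed.

End Drawing.

(** * From strings to regions of grid cells *)

Section Regions.
Variable R : realType.
Local Notation pl := (R * R)%type.
Implicit Types (g : R -> pl).

Definition in01 (t : R) := 0 <= t <= 1.
Definition pathc g := {within `[0, 1], continuous g}.

Lemma norm_lt2 (z : pl) (k : R) : `|z| < k -> `|z.1| < k /\ `|z.2| < k.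
Proof. by rewrite prod_normE gt_max => /andP. Qed.

Lemma pathc_near g t (k : R) : pathc g -> in01 t -> 0 < k -> exists2 d : R, 0 < d &
  forall t', in01 t' -> `|t - t'| < d -> `|g t - g t'| < k.
Proof.
move=> cg t01 k0.
have tt : `[0, 1]%classic t by rewrite /= in_itv.
have /cvgrPdist_lt /(_ _ k0) := (@subspace_continuousP _ _ _ _).1 cg t tt.
rewrite near_withinE => /nbhs_ballP [d d0 H]; exists d => // t' t'01 h.
by apply: H => //=; rewrite in_itv.
Qed.

Definition kstep g (k : R) : rel R := fun t t' => [&& in01 t, in01 t' & `|g t - g t'| < k].

(** The times reachable from 0 by steps of size below k contain their supremum and, if it were below
    1, a later time as well. *)
Lemma path_chain g (k : R) : pathc g -> 0 < k ->
  exists s, path (kstep g k) 0 s /\ last 0 s = 1.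
Proof.
move=> cg k0.
pose A : set R := [set t | in01 t /\ exists s, path (kstep g k) 0 s /\ last 0 s = t].
have A0 : A 0 by split; [rewrite /in01 lexx ler01|exists [::]].
have Aub : has_sup A by split; [exists 0|exists 1 => t [/andP[]]].
have s0 : 0 <= sup A by apply: sup_upper_bound.
have s1 : sup A <= 1 by apply: ge_sup; [exists 0|move=> t [/andP[]]].
have s01 : in01 (sup A) by apply/andP.
have [d d0 H] := pathc_near cg s01 k0.
have step t t' : A t -> in01 t' -> `|g t - g t'| < k -> A t'.
  move=> [t01 [s [ps ls]]] t'01 h; split=> //; exists (rcons s t').
  by rewrite rcons_path last_rcons ps ls /kstep t01 t'01 h.
have As : A (sup A).
  have [a Aa ha] := sup_adherent d0 Aub; have a01 := Aa.1.
  have ale : a <= sup A by apply: sup_upper_bound.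
  apply: (step a) => //; rewrite distrC; apply: H => //.
  by rewrite ger0_norm ?subr_ge0 //; lra.
have [lt1|ge1] := ltP (sup A) 1; last first.
  have E : sup A = 1 by lra.
  by have [_ [s hs]] := As; rewrite E in hs; exists s.
pose t' := Num.min 1 (sup A + d / 2).
have t'l : sup A < t' by rewrite /t' lt_min lt1 /=; lra.
have t'01 : in01 t'.
  by apply/andP; split; [lra|rewrite /t' ge_min lexx].
have t'd : t' <= sup A + d / 2 by rewrite /t' ge_min lexx orbT.
have : A t'.
  apply: (step (sup A)) => //; apply: H => //.
  by rewrite distrC ger0_norm ?subr_ge0; lra.
by move=> At'; have := sup_upper_bound Aub At'; lra.
Qed.

Lemma path_image_compact g : pathc g -> compact (g @` `[0, 1]).
Proof. by move=> cg; apply: continuous_compact cg _; exact: segment_compact. Qed.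

(** The differences of points of the two images form a compact, hence closed set, which misses 0. *)
Lemma path_sep g g' : pathc g -> pathc g' ->
  (forall t t', in01 t -> in01 t' -> g t <> g' t') ->
  exists2 d : R, 0 < d & forall t t', in01 t -> in01 t' -> d <= `|g t - g' t'|.
Proof.
move=> cg cg' dj.
have cK := compact_setX (path_image_compact cg) (path_image_compact cg').
pose F (z : pl * pl) := z.1 - z.2.
have cF : continuous F by move=> z; exact: sub_continuous.
have cI := continuous_compact (continuous_subspaceT cF) cK.
have clI := compact_closed (@norm_hausdorff _ _) cI.
have n0 : (~` (F @` (g @` `[0, 1] `*` g' @` `[0, 1]))) 0.
  move=> [[z z'] [/= [t t01 <-] [t' t'01 <-]]]; rewrite /F /= => /eqP.
  rewrite subr_eq0 => /eqP; apply: dj; by rewrite /= !in_itv in t01 t'01.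
have /nbhs_ballP [d d0 H] : nbhs (0 : pl) (~` (F @` (g @` `[0, 1] `*` g' @` `[0, 1]))).
  by apply: open_nbhs_nbhs; split=> //; apply: closed_openC.
exists d => // t t' t01 t'01; rewrite leNgt; apply/negP => lt.
have : ball (0 : pl) d (g t - g' t') by rewrite -ball_normE /= sub0r normrN.
move=> /H; apply; exists (g t, g' t') => //; split=> /=.
  by exists t => //; rewrite /= in_itv.
by exists t' => //; rewrite /= in_itv.
Qed.

Lemma path_bounded g : pathc g -> exists M : R, forall t, in01 t -> `|g t| <= M.
Proof.
move=> cg; have := compact_bounded (path_image_compact cg).
move=> /(pinfty_ex_gt (m := 0)) [|M _ H]; first exact: real0.
exists M => t t01; apply: (H (g t)); exists t => //; by rewrite /= in_itv.
Qed.

(** * Rounding a path to grid cells *)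

Section Discretize.
Variables (eta M : R).
Hypothesis eta0 : 0 < eta.

Definition sc (x : R) : R := (x + M) / eta.
(** The successor keeps coordinates positive and reserves (0, 0) for an empty string. *)
Definition cellc (x : R) : nat := (Num.trunc (sc x)).+1.
Definition cell (z : pl) : nat * nat := (cellc z.1, cellc z.2).
Definition nearc (c : nat * nat) (z : pl) :=
  `|c.1%:R - sc z.1| <= 2 /\ `|c.2%:R - sc z.2| <= 2.

Lemma sc_dist x y : `|x - y| < eta -> `|sc x - sc y| < 1.
Proof.
move=> h; rewrite /sc -mulrBl opprD addrACA subrr addr0 normrM normfV (gtr0_norm eta0).
by rewrite ltr_pdivrMr // mul1r.
Qed.

Lemma cellc_itv x : - M <= x -> sc x < (cellc x)%:R <= sc x + 1.
Proof.
move=> h; have xM : 0 <= x + M by lra.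
have h0 : 0 <= sc x := divr_ge0 xM (ltW eta0).
have /andP[h1 h2] := truncn_itv h0; rewrite /cellc; apply/andP; split=> //.
by rewrite -natr1; lra.
Qed.

Lemma cellc_step x y : - M <= x -> - M <= y -> `|x - y| < eta ->
  [\/ cellc x = cellc y, (cellc x).+1 = cellc y | (cellc y).+1 = cellc x].
Proof.
move=> hx hy /sc_dist; rewrite ltr_norml => /andP[d1 d2].
have /andP[x1 x2] := cellc_itv hx; have /andP[y1 y2] := cellc_itv hy.
move: x1 x2 y1 y2; move: (cellc x) (cellc y) => m n x1 x2 y1 y2.
have a1 : (m < n.+2)%N by rewrite -(ltr_nat R) -!natr1; lra.
have a2 : (n < m.+2)%N by rewrite -(ltr_nat R) -!natr1; lra.
have [->|[h|h]] : m = n \/ m.+1 = n \/ n.+1 = m by lia.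
- by constructor 1.
- by constructor 2.
- by constructor 3.
Qed.

Local Notation grch := (rch (fun a b => g4 a b)).

Lemma g4_or_eq (h : nat * nat -> Prop) c d : h c -> h d ->
  (c.1 = d.1 /\ [\/ c.2 = d.2, c.2.+1 = d.2 | d.2.+1 = c.2]) \/
  (c.2 = d.2 /\ [\/ c.1 = d.1, c.1.+1 = d.1 | d.1.+1 = c.1]) -> grch h c d.
Proof.
move=> hc hd H; have [E|g] : c = d \/ g4 c d.
  case: c d H {hc hd} => [x y] [x' y'] /=; rewrite /g4 /=.
  case=> -[-> [->|<-|<-]]; rewrite ?eqxx ?orbT; by [left|right].
- by rewrite E; apply: rch0.
- by apply: rchS g hd; apply: rch0.
Qed.

Lemma chain_cells g t s : (forall t, in01 t -> `|g t| <= M) -> in01 t ->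
  path (kstep g eta) t s ->
  exists h : seq (nat * nat), [/\ cell (g t) \in h, cell (g (last t s)) \in h,
    forall c, c \in h -> grch (fun z => z \in h) (cell (g t)) c &
    forall c, c \in h -> (0 < c.1)%N /\ exists2 t', in01 t' & nearc c (g t')].
Proof.
move=> gM.
have lo t1 : in01 t1 -> - M <= (g t1).1 /\ - M <= (g t1).2.
  move=> /gM; rewrite prod_normE ge_max => /andP[]; rewrite !ler_norml.
  by move=> /andP[h1 _] /andP[h2 _].
have nearcell t1 t2 t3 : in01 t1 -> in01 t2 -> in01 t3 -> `|g t1 - g t2| < eta ->
    `|g t1 - g t3| < eta -> nearc (cellc (g t2).1, cellc (g t3).2) (g t1).
  move=> h1 h2 h3 /norm_lt2 [/sc_dist a1 _] /norm_lt2 [_ /sc_dist a2].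
  have [l1 _] := lo _ h2; have [_ l2] := lo _ h3.
  have /andP[b1 b2] := cellc_itv l1; have /andP[b3 b4] := cellc_itv l2.
  move: a1 a2; rewrite !ltr_norml => /andP[? ?] /andP[? ?].
  by split; rewrite ler_norml; apply/andP; split; simpl in *; lra.
elim: s t => [|t2 s IH] t t01 /=.
  move=> _; exists [:: cell (g t)]; split; try by rewrite inE.
    by move=> c; rewrite inE => /eqP ->; apply: rch0; rewrite inE.
  move=> c; rewrite inE => /eqP ->; split=> //; exists t => //.
  by apply: nearcell => //; rewrite subrr normr0.
move=> /andP[/and3P[_ t201 lt] ps]; have [h [h1 h2 h3 h4]] := IH _ t201 ps.
(* A short step of the path may be diagonal in the grid; the corner cell c2 joins its two ends. *)
pose c1 := cell (g t); pose c2 := (cellc (g t).1, cellc (g t2).2).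
exists (c1 :: c2 :: h).
have [lt1 lt2] := norm_lt2 lt.
have [l1 l2] := lo _ t01; have [l3 l4] := lo _ t201.
split.
- by rewrite inE eqxx.
- by rewrite !inE h2 !orbT.
- move=> c; pose hh (z : nat * nat) : Prop := z \in c1 :: c2 :: h.
  suff : c \in c1 :: c2 :: h -> grch hh c1 c by [].
  have hh1 : hh c1 by rewrite /hh inE eqxx.
  have hh2 : hh c2 by rewrite /hh !inE eqxx orbT.
  have hh3 : hh (cell (g t2)) by rewrite /hh !inE h1 !orbT.
  have r12 : grch hh c1 c2.
    by apply: g4_or_eq => //; left; split=> //=; apply: cellc_step.
  have r23 : grch hh c2 (cell (g t2)).
    by apply: g4_or_eq => //; right; split=> //=; apply: cellc_step.
  rewrite !inE => /or3P[/eqP ->|/eqP ->//|ch]; first exact: rch0.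
  apply: rch_trans r12 _; apply: rch_trans r23 _.
  by apply: rch_mono (h3 _ ch) => z zh; rewrite /hh !inE zh !orbT.
- move=> c; rewrite !inE => /or3P[/eqP ->|/eqP ->|/h4//]; split=> //; exists t => //.
    by apply: nearcell => //; rewrite subrr normr0.
  by apply: nearcell => //; rewrite subrr normr0.
Qed.

Lemma nearc_dist c z z' : nearc c z -> nearc c z' -> `|z - z'| <= 4 * eta.
Proof.
move=> [a1 a2] [b1 b2].
have H (n : nat) x x' : `|n%:R - sc x| <= 2 -> `|n%:R - sc x'| <= 2 ->
    `|x - x'| <= 4 * eta.
  rewrite !ler_norml => /andP[h1 h2] /andP[h3 h4].
  have -> : x - x' = (sc x - sc x') * eta.
    by rewrite /sc -mulrBl divfK ?gt_eqF //; ring.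
  have e1 : sc x - sc x' <= 4 by lra.
  have e2 : -4 <= sc x - sc x' by lra.
  by rewrite -mulNr !ler_pM2r // e1 e2.
by rewrite prod_normE ge_max; apply/andP; split; [exact: H a1 b1|exact: H a2 b2].
Qed.

End Discretize.

Lemma fin_pos (T : eqType) (s : seq T) (Pd : T -> R -> Prop) :
  (forall x, exists2 d, 0 < d & forall d', 0 < d' -> d' <= d -> Pd x d') ->
  exists2 d, 0 < d & forall x, x \in s -> Pd x d.
Proof.
move=> H; suff [d d0 hd] : exists2 d, 0 < d & forall x, x \in s ->
    forall d', 0 < d' -> d' <= d -> Pd x d'.
  by exists d => // x xs; apply: hd.
elim: s => [|y s [d d0 hd]]; first by exists 1.
have [d1 d10 h1] := H y; exists (Num.min d d1); first by rewrite lt_min d0.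
move=> x; rewrite inE => /orP[/eqP ->|xs] d' d'0; rewrite le_min => /andP[? ?].
  exact: h1.
exact: hd.
Qed.

Lemma fin_bound (T : eqType) (s : seq T) (PM : T -> R -> Prop) :
  (forall x, exists M, forall M', M <= M' -> PM x M') ->
  exists M, forall x, x \in s -> PM x M.
Proof.
move=> H; suff [M hM] : exists M, forall x, x \in s -> forall M', M <= M' -> PM x M'.
  by exists M => x xs; apply: hM.
elim: s => [|y s [M hM]]; first by exists 0.
have [M1 h1] := H y; exists (Num.max M M1).
move=> x; rewrite inE => /orP[/eqP ->|xs] M'; rewrite ge_max => /andP[? ?].
  exact: h1.
exact: hM.
Qed.

(** Each string is replaced by finitely many paths from a base point to one chosen point of every
    intersection. Disjoint paths have a common positive distance d, which fixes the mesh; no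
    closedness of the strings is involved. *)
Lemma sets_regions (S : eqType) (s : seq S) (A : S -> set pl) : (forall u, u \in s) ->
  (forall u, path_connected (A u)) -> injective A ->
  exists h : S -> seq (nat * nat), [/\ forall u, exists c, c \in h u,
    forall u c d, c \in h u -> d \in h u ->
      rch (fun a b => g4 a b) (fun z => z \in h u) c d &
    forall u v, u <> v -> (A u `&` A v !=set0 <-> exists c, c \in h u /\ c \in h v)].
Proof.
move=> sS pc Ainj.
pose o u : pl := xget 0 (A u).
pose pp u v : pl := xget 0 (A u `&` A v).
have oP u : A u !=set0 -> A u (o u).
  by move=> [z Az]; apply: (@xgetPex _ 0 (A u)); exists z.
have ppP u v : A u `&` A v !=set0 -> (A u `&` A v) (pp u v).
  by move=> [z Az]; apply: (@xgetPex _ 0 (A u `&` A v)); exists z.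
have /choice [gm gmP] : forall uv : S * S, exists g : R -> pl, pathc g /\
    (A uv.1 !=set0 -> [/\ g 0 = o uv.1, forall t, in01 t -> A uv.1 (g t) &
      A uv.1 `&` A uv.2 !=set0 -> g 1 = pp uv.1 uv.2]).
  move=> [u v] /=.
  have [ne|em] := EM (A u !=set0); last first.
    by exists (fun=> 0); split=> //; apply: continuous_subspaceT; exact: cst_continuous.
  have [ad|nad] := EM (A u `&` A v !=set0); last first.
    exists (fun=> o u); split; first by apply: continuous_subspaceT; exact: cst_continuous.
    by move=> _; split=> // t _; apply: oP.
  have [g [cg g0 g1 gA]] := pc u (o u) (pp u v) (oP _ ne) (ppP _ _ ad).1.
  exists g; split=> // _; split=> // t t01; apply: gA; by exists t.
pose sp := [seq (u, v) | u <- s, v <- s].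
have spP uv : uv \in sp by case: uv => u v; apply: allpairs_f.
pose sq := [seq (a, b) | a <- sp, b <- sp].
have sqP ab : ab \in sq by case: ab => a b; apply: allpairs_f.
have [M hM] : exists M, forall uv, uv \in sp -> forall t, in01 t -> `|gm uv t| <= M.
  apply: fin_bound => uv; have [M hM] := path_bounded (gmP uv).1.
  by exists M => M' MM' t /hM h; apply: le_trans h MM'.
have [d d0 hd] : exists2 d, 0 < d & forall ab, ab \in sq ->
    (forall t t', in01 t -> in01 t' -> gm ab.1 t <> gm ab.2 t') ->
    forall t t', in01 t -> in01 t' -> d <= `|gm ab.1 t - gm ab.2 t'|.
  apply: fin_pos => -[a b] /=.
  have [dj|nd] := EM (forall t t', in01 t -> in01 t' -> gm a t <> gm b t'); last first.
    by exists 1 => // d' _ _ /nd.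
  have [d d0 hd] := path_sep (gmP a).1 (gmP b).1 dj.
  by exists d => // d' _ dd' _ t t' h h'; apply: le_trans dd' (hd _ _ h h').
(* Paths sharing a cell come within 4 * eta = d / 2 of each other, so they are not disjoint. *)
pose eta := d / 8; have eta0 : 0 < eta by rewrite /eta; lra.
have z01 : in01 (0 : R) by rewrite /in01 lexx ler01.
have /choice [H HP] : forall uv, exists h : seq (nat * nat),
   [/\ cell eta M (gm uv 0) \in h, cell eta M (gm uv 1) \in h,
    forall c, c \in h -> rch (fun a b => g4 a b) (fun z => z \in h)
      (cell eta M (gm uv 0)) c &
    forall c, c \in h -> (0 < c.1)%N /\ exists2 t', in01 t' & nearc eta M c (gm uv t')].
  move=> uv; have [sc [ps ls]] := path_chain (gmP uv).1 eta0.
  have := chain_cells eta0 (hM _ (spP uv)) z01 ps.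
  by rewrite ls.
pose h u := if pselect (A u !=set0) is left _ then flatten [seq H (u, v) | v <- s]
  else [:: (0%N, 0%N)].
have hne u c : A u !=set0 -> (c \in h u) = (c \in flatten [seq H (u, v) | v <- s]).
  by rewrite /h; case: pselect.
have hem u : ~ (A u !=set0) -> h u = [:: (0%N, 0%N)] by rewrite /h; case: pselect.
have hall u c : A u !=set0 -> c \in h u -> exists v, c \in H (u, v).
  by move=> ne; rewrite hne // => /flatten_mapP [v _ hv]; exists v.
have hin u v c : A u !=set0 -> c \in H (u, v) -> c \in h u.
  by move=> ne hc; rewrite hne //; apply/flatten_mapP; exists v.
exists h; split.
- move=> u; have [ne|em] := EM (A u !=set0); last first.
    by exists (0%N, 0%N); rewrite hem // inE.
  by have [c0 _ _ _] := HP (u, u); exists (cell eta M (gm (u, u) 0)); apply: hin c0.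
- move=> u c c'; have [ne|em] := EM (A u !=set0); last first.
    rewrite !hem // !inE => /eqP -> /eqP ->; apply: rch0; by rewrite inE.
  have base w : w \in h u -> rch (fun a b => g4 a b) (fun z => z \in h u)
      (cell eta M (o u)) w.
    move=> /hall -/(_ ne) [v wv]; have [_ _ cn _] := HP (u, v).
    have := cn _ wv; have [_ /(_ ne) [-> _ _]] := gmP (u, v).
    by apply: rch_mono => z; apply: hin.
  move=> /base hc /base hc'; apply: rch_trans hc'; apply: rch_sym hc.
  by move=> [a1 a2] [b1 b2]; rewrite /g4 /=; lia.
- move=> u v uv; split.
    move=> ad; have neu : A u !=set0 by case: ad => z [Az _]; exists z.
    have nev : A v !=set0 by case: ad => z [_ Az]; exists z.
    have ad' : A v `&` A u !=set0 by rewrite setIC.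
    exists (cell eta M (pp u v)).
    have [_ /(_ neu) [_ _ /(_ ad) e1]] := gmP (u, v).
    have [_ /(_ nev) [_ _ /(_ ad') e2]] := gmP (v, u).
    have [_ cu _ _] := HP (u, v); have [_ cv _ _] := HP (v, u).
    rewrite e1 in cu; rewrite e2 in cv.
    (* The point is chosen from the intersection as a set, so both strings run to the same point. *)
    have ppC : pp v u = pp u v by rewrite /pp setIC.
    rewrite ppC in cv; split; first exact: (hin _ _ _ neu cu).
    exact: (hin _ _ _ nev cv).
  move=> [c [cu cv]].
  have [neu|emu] := EM (A u !=set0); have [nev|emv] := EM (A v !=set0).
  + have [w cw] := hall _ _ neu cu; have [w' cw'] := hall _ _ nev cv.
    have [_ _ _ /(_ _ cw) [_ [t t01 nt]]] := HP (u, w).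
    have [_ _ _ /(_ _ cw') [_ [t' t'01 nt']]] := HP (v, w').
    have dist := nearc_dist eta0 nt nt'.
    apply: contrapT => dj.
    have [_ /(_ neu) [_ gA _]] := gmP (u, w).
    have [_ /(_ nev) [_ gA' _]] := gmP (v, w').
    have : d <= `|gm (u, w) t - gm (v, w') t'|.
      apply: (hd ((u, w), (v, w')) (sqP _)) => // t1 t2 k1 k2 E; apply: dj.
      exists (gm (u, w) t1); split; first exact: gA.
      by rewrite E; apply: gA'.
    move=> le; have {le dist} := le_trans le dist; rewrite /eta; clear -d0; lra.
  + have [w cw] := hall _ _ neu cu; have [_ _ _ /(_ _ cw) [c0 _]] := HP (u, w).
    by move: cv; rewrite hem // inE => /eqP E; rewrite E in c0.
  + have [w cw] := hall _ _ nev cv; have [_ _ _ /(_ _ cw) [c0 _]] := HP (v, w).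
    by move: cu; rewrite hem // inE => /eqP E; rewrite E in c0.
  + case: uv; apply: Ainj.
    have E w : ~ (A w !=set0) -> A w = set0.
      by move=> n; rewrite -subset0 => z Az; apply: n; exists z.
    by rewrite (E _ emu) (E _ emv).
Qed.

End Regions.

Theorem string_regions (R : realType) (S : sgraph) : finite_graph S ->
  string_graph R S -> exists h : S -> seq (nat * nat),
  [/\ forall u, exists c, c \in h u,
    forall u c d, c \in h u -> d \in h u ->
      rch (fun a b => g4 a b) (fun z => z \in h u) c d &
    forall u v, u <> v -> (adj u v <-> exists c, c \in h u /\ c \in h v)].
Proof.
move=> fS [C Cpc [phi phib phiadj]].
pose A (u : {classic S}) : set (R * R) := sval (phi u).
have Ainj : injective A.
  move=> u v E; apply: (bij_inj phib); move: E; rewrite /A.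
  case: (phi u) (phi v) => [a pa] [b pb] /= E; subst b.
  by congr exist; apply: Prop_irrelevance.
have fS' : finite_set [set: {classic S}] := fS.
have [s sE] := (finite_seqP _).1 fS'.
have sS (u : {classic S}) : u \in s.
  by have : [set: {classic S}] u by []; rewrite sE.
have pc u : path_connected (A u) by apply: Cpc; apply: (svalP (phi u)).
have [h [h1 h2 h3]] := sets_regions sS pc Ainj.
exists h; split=> // u v uv; rewrite -(h3 u v uv) -phiadj; split.
  by move=> /asboolP [].
by move=> ad; apply/asboolP; split=> // /Ainj.
Qed.

(** * The quasi-isometry *)

Lemma gdist_le (R : realType) (G : sgraph) (u v : G) p : path (@adj G) u p ->
  last u p = v -> (gdist R u v <= (size p)%:R%:E)%E.
Proof. by move=> pp lp; apply: ereal_inf_lbound; exists p. Qed.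

Lemma gdist_cases (R : realType) (G : sgraph) (u v : G) : gdist R u v = +oo%E \/
  exists p, [/\ path (@adj G) u p, last u p = v & gdist R u v = (size p)%:R%:E].
Proof.
pose A n := exists p, [/\ path (@adj G) u p, last u p = v & size p = n].
have [/min_ex [n [[p [pp lp sp]] mn]]|no] := EM (exists n, A n); [right|left].
  exists p; split=> //; apply/eqP; rewrite eq_le gdist_le //=.
  apply: le_ereal_inf_tmp => _ [p' [pp' lp'] <-]; rewrite lee_fin ler_nat sp.
  by apply: mn; exists p'.
rewrite /gdist.
have -> : [set ((size p)%:R)%:E | p in [set p : seq G |
    path (@adj G) u p /\ last u p = v]] = set0 :> set (\bar R).
  by rewrite -subset0 => x [p [pp lp] _]; apply: no; exists (size p), p.
exact: ereal_inf0.
Qed.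

Section Quasi.
Variables (S : sgraph) (V : finType) (reg : S -> V -> Prop).
Hypothesis adjE : forall u v, u <> v -> (adj u v <-> exists x, reg u x /\ reg v x).
Variable e : V -> V -> Prop.
Hypothesis e_sym : forall x y, e x y -> e y x.
Variable str : (V -> Prop) -> Prop.
Hypothesis str_edge : forall x y, e x y -> exists q, [/\ str q, q x & q y].
Hypothesis str_reg : forall q, str q -> exists u, sub q (reg u).
Hypothesis reg_str : forall u, str (reg u).
Variables (r : V -> V) (rr : forall x, r (r x) = r x) (d0 : nat).
Hypothesis r_D : forall x y, r x = r y -> D str (fun=> True) d0 x y.
Hypothesis r_hop : forall q x y, str q -> q x -> q y -> hop e r 79 x y.

Local Notation G := (quotient_graph e_sym r).
Local Notation k := (rk rr).

Lemma touch u v x : reg u x -> reg v x ->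
  exists p, [/\ path (@adj S) u p, last u p = v & (size p <= 1)%N].
Proof.
move=> ux vx; have [->|neq] := EM (u = v); first by exists [::].
by exists [:: v]; split=> //=; rewrite andbT; apply/adjE => //; exists x.
Qed.

(** One string for each step, with u and v at the ends: at most m + 1 edges of S. *)
Lemma D_path m x y u v : D str (fun=> True) m x y -> reg u x -> reg v y ->
  exists p, [/\ path (@adj S) u p, last u p = v & (size p <= m.+1)%N].
Proof.
move=> + ux; elim: m y v => [y v /= <- vx|m IH y v [z [xz zy]] vy].
  exact: touch vx.
case: zy => [zy|[q [sq _ qz qy]]].
  by rewrite zy in xz; have [p [? ? ?]] := IH _ _ xz vy; exists p; split=> //; lia.
have [w qw] := str_reg sq.
have [p [pp lp sp]] := IH _ _ xz (qw _ qz).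
have [p' [pp' lp' sp']] := touch (qw _ qy) vy.
exists (p ++ p'); split; first by rewrite cat_path pp lp.
  by rewrite last_cat lp.
by rewrite size_cat; lia.
Qed.

(** A path visits [(size p).+1] clusters of diameter at most d0 and takes one string step for each
    of its edges. *)
Lemma quotient_D p x y : path (@adj G) (k x) p -> last (k x : G) p = k y ->
  D str (fun=> True) ((size p).+1 * d0 + size p) x y.
Proof.
elim: p x => [x _ /= [E]|v p IH x /= /andP[/asboolP [_ [a [b [ra rb ab]]]] pp] lp].
  by rewrite mul1n addn0; apply: r_D.
have vE : v = k b := rkE rr rb.
rewrite vE in pp lp; have h := IH _ pp lp.
have h1 : D str (fun=> True) d0 x a by apply: r_D; rewrite ra.
have h2 : D str (fun=> True) 1 a b.
  by have [q [sq qa qb]] := str_edge ab; apply: D1; exists q.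
have := D_trans (D_trans h1 h2) h; apply: D_mono.
by rewrite /= !mulSn; lia.
Qed.

Lemma hop_path n x y : hop e r n x y ->
  exists p, [/\ path (@adj G) (k x) p, last (k x : G) p = k y & (size p <= n)%N].
Proof.
elim: n y => [y /= E|n IH y [z [w [/IH [p [pp lp sp]] zw wy]]]].
  by exists [::]; split=> //=; apply: val_inj.
have [E|nE] := EM (r z = r y).
  exists p; split=> //; last lia.
  by rewrite lp; apply: val_inj.
exists (rcons p (k y)); split; last by rewrite size_rcons.
  rewrite rcons_path pp lp; apply/asboolP; split=> //.
  exists z, w; split=> //; case: zw => // E; by case: nE; rewrite E.
by rewrite last_rcons.
Qed.

(** Along an edge uv, 79 hops lead through u to a common cell and 79 more through v. *)
Lemma hop_strings (c : S -> V) u p : (forall u, reg u (c u)) -> path (@adj S) u p ->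
  hop e r (158 * size p) (c u) (c (last u p)).
Proof.
move=> cP; elim: p u => [//|v p IH u] /= /andP[uv pp].
have neq : u <> v by move=> E; rewrite E adj_irr in uv.
have [x [ux vx]] := (adjE neq).1 uv.
have h1 := r_hop (reg_str u) (cP u) ux; have h2 := r_hop (reg_str v) vx (cP v).
have h3 := hop_trans (hop_trans h1 h2) (IH _ pp).
have le : (79 + 79 + 158 * size p <= 158 * (size p).+1)%N by rewrite mulnS.
exact: (hop_mono le h3).
Qed.

(** A path of p edges in the quotient yields at most (p + 1) * (d0 + 1) <= (p + 1) * J <= K * p + J
    edges in S. Infinite distances are treated separately. *)
Lemma quotient_quasi (R : realType) (c : S -> V) (K J : nat) :
  (forall u, reg u (c u)) -> (forall x, exists u, reg u x) ->
  (d0 < J)%N -> (J <= K)%N ->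
  (forall u v : S,
     ((1 / K%:R : R)%:E * gdist R u v - (J%:R / K%:R : R)%:E
        <= gdist R (k (c u) : G) (k (c v)))%E /\
     (gdist R (k (c u) : G) (k (c v)) <= (160 : R)%:E * gdist R u v)%E) /\
  (forall v : G, exists u : S, (gdist R (k (c u) : G) v <= (80 : R)%:E)%E).
Proof.
move=> cP cov dJ JK; split.
  move=> u v; split.
    have [->|[p [pp lp ->]]] := gdist_cases R (k (c u) : G) (k (c v)); first exact: leey.
    have h := quotient_D pp lp.
    have [p' [pp' lp' sp']] := D_path h (cP u) (cP v).
    have := gdist_le R pp' lp'.
    have [->|[p1 [_ _ ->]]] := gdist_cases R u v; first by rewrite leye_eq.
    rewrite lee_fin ler_nat => le1.
    have le2 : (size p1 <= K * size p + J)%N.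
      have a1 : ((size p).+1 * d0.+1 <= (size p).+1 * J)%N by rewrite leq_mul2l dJ orbT.
      have a2 : (J * size p <= K * size p)%N by rewrite leq_mul2r JK orbT.
      by move: a1; rewrite mulnS !mulSn [(size p * J)%N]mulnC; lia.
    have K0 : 0 < K%:R :> R by rewrite ltr0n; lia.
    rewrite -EFinM -EFinB lee_fin mul1r mulrC -mulrBl ler_pdivrMr //.
    by rewrite lerBlDr mulrC -natrM -natrD ler_nat.
  have [->|[p [pp lp ->]]] := gdist_cases R u v.
    by rewrite gt0_muley ?leey // lte_fin; lra.
  have := hop_strings cP pp; rewrite lp => /hop_path [p' [pp' lp' sp']].
  apply: le_trans (gdist_le R pp' lp') _.
  rewrite -EFinM lee_fin -natrM ler_nat; apply: leq_trans sp' _.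
  by rewrite leq_mul2r; apply/orP; right.
move=> v; have [u ux] := cov (val v); exists u.
have /hop_path [p [pp lp sp]] := r_hop (reg_str u) (cP u) ux.
have kv : k (val v) = v by apply/esym/rkE/eqP/(valP v).
rewrite kv in lp; apply: le_trans (gdist_le R pp lp) _.
by rewrite lee_fin ler_nat; apply: leq_trans sp _.
Qed.

End Quasi.

Lemma g4_sym c d : g4 c d -> g4 d c.
Proof. by case: c d => [a b] [c d]; rewrite /g4 /=; lia. Qed.

Theorem theorem5p3 (R : realType) (S : sgraph)
    (finS : finite_graph S) (stringS : string_graph R S) :
  exists G : sgraph, planar R G /\
    exists f : S -> G,
      (forall u v : S,
         ((1 / 73944%N%:R : R)%:E * gdist R u v - (73936%N%:R / 73944%N%:R : R)%:E
            <= gdist R (f u) (f v))%E /\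
         (gdist R (f u) (f v) <= (160 : R)%:E * gdist R u v)%E) /\
      (forall v : G, exists u : S, (gdist R (f u) v <= (80 : R)%:E)%E).
Proof.
have [h [hne hcon hadj]] := string_regions finS stringS.
have fS' : finite_set [set: {classic S}] := finS.
have [s sE] := (finite_seqP _).1 fS'.
have sS (u : {classic S}) : u \in s.
  by have : [set: {classic S}] u by []; rewrite sE.
pose h' (u : {classic S}) := h u.
pose cells := flatten [seq h' u | u <- s].
have cellsP c : c \in cells -> exists u, c \in h u.
  by move=> H; have [u _ hu] := flatten_mapP H; exists u.
have hcells u c : c \in h u -> c \in cells.
  by move=> H; apply/flatten_mapP; exists u.
pose V : finType := seq_sub cells.
pose reg (u : S) (x : V) : Prop := val x \in h u.
have lift u c : c \in h u -> exists x : V, val x = c.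
  by move=> /hcells hc; exists (SeqSub hc).
(* Only grid edges inside a common region are kept, so that every edge lies on a string. *)
pose e (x y : V) : Prop := g4 (val x) (val y) /\ exists u, reg u x /\ reg u y.
have e_sym x y : e x y -> e y x.
  by move=> [/g4_sym g [u [ux uy]]]; split=> //; exists u.
have reg_con u : con e (reg u).
  move=> x y ux uy.
  have H c d : rch (fun a b => g4 a b) (fun z => z \in h u) c d ->
      forall x y : V, val x = c -> val y = d -> rch e (reg u) x y.
    elim=> [hc x1 y1 E1 E2|a b ca IH ab hb x1 y1 E1 E2].
      have -> : y1 = x1 by apply: val_inj; rewrite E1 E2.
      by apply: rch0; rewrite /reg E1.
    have ha := rch_r ca; have [z Ez] := lift _ _ ha.
    apply: (rchS (IH x1 z E1 Ez)); last by rewrite /reg E2.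
    by split; [rewrite Ez E2|exists u; rewrite /reg Ez E2].
  exact: H (hcon _ _ _ ux uy) _ _ _ _.
pose str (q : V -> Prop) := con e q /\ exists u, sub q (reg u).
have reg_str u : str (reg u) by split=> //; exists u.
have str_con q : str q -> con e q by case.
have str_sub q w : str q -> sub w q -> con e w -> str w.
  by move=> [_ [u qu]] wq cw; split=> //; exists u => x /wq /qu.
have str_edge x y : e x y -> exists q, [/\ str q, q x & q y].
  by move=> [_ [u [ux uy]]]; exists (reg u).
have str_reg q : str q -> exists u, sub q (reg u) by case.
pose msr (A : V -> Prop) := #|[pred x | `[< A x >]]|.
have msr_le A B : sub A B -> (msr A <= msr B)%N.
  by move=> AB; apply/subset_leq_card/fintype.subsetP => x /asboolP /AB hB; apply/asboolP.
have msr_lt A B x : sub A B -> B x -> ~ A x -> (msr A < msr B)%N.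
  move=> AB Bx nAx; apply: proper_card; apply/fintype.properP; split.
    by apply/fintype.subsetP => y /asboolP /AB hB; apply/asboolP.
  by exists x; [apply/asboolP|apply/negP => /asboolP].
have noK5 (F : nat -> V -> Prop) :
  (forall i, (i < 5)%N -> exists x, F i x) -> (forall i, (i < 5)%N -> con e (F i)) ->
  (forall i j x, (i < 5)%N -> (j < 5)%N -> F i x -> F j x -> i = j) ->
  (forall i j, (i < j)%N -> (j < 5)%N -> exists x y, [/\ F i x, F j y & e x y]) -> False.
  move=> F1 F2 F3 F4.
  apply: (@grid_noK5 (fun i c => exists x, val x = c /\ F i x)).
  - by move=> i /F1 [x Fx]; exists (val x), x.
  - move=> i i5 _ _ [x [<- Fx]] [y [<- Fy]].
    elim: (F2 _ i5 _ _ Fx Fy) => [_|u v _ IH [uv _] Fv]; first by apply: rch0; exists x.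
    by apply: rchS IH uv _; exists v.
  - by move=> i j _ i5 j5 [x [<- Fx]] [y [/val_inj E Fy]]; apply: (F3 i j x) => //; rewrite -E.
  - move=> i j ij j5; have [x [y [Fx Fy [xy _]]]] := F4 _ _ ij j5.
    by exists (val x), (val y); split=> //; [exists x|exists y].
(* The least values allowed by [sgE], [NE] and [QE]; they give d0 = 72050. *)
pose sg := 330%N; pose N := 53%N; pose Q := (2 * bb sg N 0 + sg).+1.
have [r [rr r_con r_D r_hop]] : exists r : V -> V,
   [/\ forall x, r (r x) = r x,
      forall x y, r x = r y -> rch e (fun z => r z = r x) x y,
      forall x y, r x = r y -> D str (fun=> True) (2 * Q + 2 * rho N) x y &
      forall q x y, str q -> q x -> q y -> hop e r 79 x y].
  have [[x0]|emp] := EM (inhabited V); last first.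
    have nV (x : V) : False by apply: emp.
    by exists id; split=> [x|x|x|q x]; case: (nV x).
  exact: (@clustering V e e_sym str str_con str_sub str_edge Q sg N isT (ltnSn _)
    msr msr_le msr_lt noK5 isT x0).
have /choice [c cP] : forall u, exists x, reg u x.
  by move=> u; have [c hc] := hne u; exists (SeqSub (hcells _ _ hc)).
have adjE u v : u <> v -> (adj u v <-> exists x, reg u x /\ reg v x).
  move=> /hadj ->; split=> [[d [hu hv]]|[x [ux vx]]]; last by exists (val x).
  by exists (SeqSub (hcells _ _ hu)).
exists (quotient_graph e_sym r); split.
  by apply: (quotient_planar R (cp := val)) => // x y [].
exists (fun u => rk rr (c u)).
apply: (quotient_quasi adjE e_sym str_edge str_reg reg_str rr r_D r_hop R) => // x.
by have [u hu] := cellsP _ (valP x); exists u.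
Qed.
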